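(* Assume all of the following. (A0) The sequence $I_n:\mathcal P(\Xi)\to[0,+\infty]$ $\Gamma$-converges to a functional $I^{(0)}:\mathcal P(\Xi)\to[0,+\infty]$, and there is a finite set $\{x_1,\dots,x_{\mathfrak n_1}\}\subset\Xi$ of distinct points such that $\{\mu\in\mathcal P(\Xi): I^{(0)}(\mu)=0\}=\{\sum_{j\in S_1}\omega_j\delta_{x_j}:\omega\in\mathcal P(S_1)\}$, where $S_1=\{1,\dots,\mathfrak n_1\}$. (A1) There exist $\mathfrak q\ge1$, time-scales $1\prec\theta^{(1)}_n\prec\cdots\prec\theta^{(\mathfrak q)}_n$ and partitions $\mathfrak V_p=\{\mathcal V^{p,1}_n,\dots,\mathcal V^{p,\mathfrak n_p}_n,\Delta^{(p)}_n\}$ of $\Xi_n$, $1\le p\le\mathfrak q$ (with $\mathfrak n_1$ as in (A0)), such that for every $1\le p\le\mathfrak q$ and $i\neq j\in S_p:=\{1,\dots,\mathfrak n_p\}$ the limit $r^{(p)}(i,j):=\lim_{n\to\infty}\theta^{(p)}_n\,r^{\mathfrak V_p}_n(i,j)$ exists and is finite; moreover for each $p$, $r^{(p)}(i,j)>0$ for some $j\ne i\in S_p$. (A2) For $1\le p<\mathfrak q$, the number $\mathfrak u_p$ of closed irreducible classes $\mathfrak R^{(p)}_1,\dots,\mathfrak R^{(p)}_{\mathfrak u_p}$ of $\mathbb X^{(p)}_t$ equals $\mathfrak n_{p+1}$, and $\mathcal V^{p+1,m}_n=\bigcup_{j\in\mathfrak R^{(p)}_m}\mathcal V^{p,j}_n$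 for $m\in S_{p+1}$. (A3) The chain $\mathbb X^{(\mathfrak q)}_t$ has a unique closed irreducible class. (A4a) $\pi_n(\mathcal V^{(1)}_n)\to1$, where $\mathcal V^{(1)}_n=\bigcup_{j\in S_1}\mathcal V^{1,j}_n$, and for each $j\in S_1$ the measure $\pi^{1,j}_n:=\pi_n(\,\cdot\mid\mathcal V^{1,j}_n)$ converges weakly to $\delta_{x_j}$. (A4b) There exists $\epsilon>0$ such that the balls $B_\epsilon(x_j)$, $j\in S_1$, are pairwise disjoint and $\mathcal V^{1,j}_n\supset B_\epsilon(x_j)\cap\Xi_n$ for all $j\in S_1$, $n\ge1$. (A5) There exists a sequence $\beta_n\prec\theta^{(1)}_n$ such that for all $j\in S_1$ and $h:\mathcal V^{1,j}_n\to\mathbb R$, $$\max_{x\in\mathcal V^{1,j}_n}\sum_{y\in\mathcal V^{1,j}_n}\pi^{1,j}_n(y)\{h(y)-h(x)\}^2\le\beta_n\,D_n(\mathcal V^{1,j}_n,h).$$ Then a full $\Gamma$-expansion of $I_n$ is given by the speeds $(\theta^{(p)}_n:n\ge1)$, $1\le p\le\mathfrak q$, and the functionals $I^{(p)}:\mathcal P(\Xi)\to[0,+\infty]$, $0\le p\le\mathfrak q$, where $I^{(0)}$ is the functional in (A0) and $I^{(p)}$, $1\le p\le\mathfrak q$, is defined in the context.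
   Context: Setting. $\Xi$ is the closure of an open bounded subset of $\mathbb R^d$, or the $d$-dimensional torus; $\Xi_n=\Xi\cap(n^{-1}\mathbb Z^d)$, $n\ge1$. For each $n$, $X^{(n)}_t$ is a $\Xi_n$-valued, irreducible, continuous-time Markov chain with jump rates $R_n(x,y)$, generator $(\mathcal L_nf)(x)=\sum_{y\in\Xi_n}R_n(x,y)\{f(y)-f(x)\}$, holding rates $\lambda_n(x)=\sum_yR_n(x,y)$, and unique stationary state $\pi_n$, which satisfies detailed balance $\pi_n(x)R_n(x,y)=\pi_n(y)R_n(y,x)$. $\mathbf P^{(n)}_x$ is the law of the chain started at $x$. $\mathcal P(\Omega)$ denotes probability measures on $\Omega$ with the weak topology; $\mathcal P(\Xi_n)\subset\mathcal P(\Xi)$. For positive sequences, $\alpha_n\prec\beta_n$ means $\alpha_n/\beta_n\to0$. Rate functional. For $\mu\in\mathcal P(\Xi_n)$, $I_n(\mu)=\sup_u-\sum_{x\in\Xi_n}\frac{(\mathcal L_nu)(x)}{u(x)}\mu(x)$, supremum over $u:\Xi_n\to(0,\infty)$; $I_n(\mu)=+\infty$ for $\mu\in\mathcal P(\Xi)\setminus\mathcal P(\Xi_n)$. $\Gamma$-convergence. $U_n:\mathcal X\to[0,+\infty]$ $\Gamma$-converges to $U:\mathcal X\to[0,+\infty]$ ($\mathcal X$ Polish) if (i) $\liminf_nU_n(x_n)\ge U(x)$ whenever $x_n\to x$; (ii) for each $x$ there is $x_n\to x$ with $\limsup_nU_n(x_n)\le U(x)$. Full $\Gamma$-expansion. Speeds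 $(\theta^{(p)}_n)_{n\ge 1}$, $1\le p\le\mathfrak q$, and functionals $I^{(p)}:\mathcal P(\Xi)\to[0,+\infty]$, $0\le p\le\mathfrak q$, give a full $\Gamma$-expansion of $I_n$ if: (a) $\theta^{(1)}_n\to\infty$ and $\theta^{(p)}_n/\theta^{(p+1)}_n\to0$ for $1\le p<\mathfrak q$; (b) $I_n$ $\Gamma$-converges to $I^{(0)}$ and $\theta^{(p)}_nI_n$ $\Gamma$-converges to $I^{(p)}$ for $1\le p\le\mathfrak q$; (c) for $0\le p<\mathfrak q$, $I^{(p+1)}(\mu)<\infty$ if and only if $I^{(p)}(\mu)=0$; (d) the $0$-level set of $I^{(\mathfrak q)}$ is a singleton. Mean jump rates. For a partition $\mathfrak W=\{\mathcal W^{(1)}_n,\dots,\mathcal W^{(\mathfrak m)}_n,\Delta_n\}$ of $\Xi_n$ let $\mathcal W_n=\bigcup_j\mathcal W^{(j)}_n$ and, for $x\ne y\in\mathcal W_n$, $R^{\mathfrak W}_n(x,y)=\lambda_n(x)\mathbf P^{(n)}_x[H_y=H^+_{\mathcal W_n}]$ (the jump rates of the trace of $X^{(n)}_t$ on $\mathcal W_n$), where $H_{\mathcal A}$ is the hitting time of $\mathcal A$ and $H^+_{\mathcal A}=\inf\{t>\tau_1:X^{(n)}_t\in\mathcal A\}$, $\tau_1$ being the first jump time. Set $r^{\mathfrak W}_n(i,j)=\frac1{\pi_n(\mathcal W^{(i)}_n)}\sum_{x\in\mathcal W^{(i)}_n}\pi_n(x)\sum_{y\in\mathcal W^{(j)}_n}R^{\mathfrak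 W}_n(x,y)$. Dirichlet form. For $\mathcal A\subset\Xi_n$, $h:\mathcal A\to\mathbb R$: $D_n(\mathcal A,h)=\frac12\frac1{\pi_n(\mathcal A)}\sum_{x\in\mathcal A}\sum_{y\in\mathcal A\setminus\{x\}}\pi_n(x)R_n(x,y)[h(y)-h(x)]^2$. Reduced chains. $\mathbb X^{(p)}_t$ is the $S_p$-valued Markov chain with jump rates $r^{(p)}(i,j)$ and generator $\mathbb L^{(p)}$; $\mathfrak R^{(p)}_1,\dots,\mathfrak R^{(p)}_{\mathfrak u_p}$ are its closed irreducible classes and $M^{(p)}_m$ is the stationary state of $\mathbb X^{(p)}_t$ restricted to $\mathfrak R^{(p)}_m$. Define $\pi^{(1)}_j=\delta_{x_j}$, $j\in S_1$, and recursively, for $1\le p<\mathfrak q$, $j\in S_{p+1}$, $\pi^{(p+1)}_j=\sum_{k\in\mathfrak R^{(p)}_j}M^{(p)}_j(k)\,\pi^{(p)}_k$. Limiting functionals. For $1\le p\le\mathfrak q$, $\omega\in\mathcal P(S_p)$: $\mathbb I^{(p)}(\omega)=\sup_{\mathbf h}-\sum_{j\in S_p}\omega_j\frac{(\mathbb L^{(p)}\mathbf h)(j)}{\mathbf h(j)}$, supremum over $\mathbf h:S_p\to(0,\infty)$; and $I^{(p)}(\mu)=\mathbb I^{(p)}(\omega)$ if $\mu=\sum_{j\in S_p}\omega_j\pi^{(p)}_j$ for some $\omega\in\mathcal P(S_p)$, $I^{(p)}(\mu)=+\infty$ otherwise. *)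

(* Defs.v *)
From HB Require Import structures.
From mathcomp Require Export all_boot all_order all_algebra.
From mathcomp Require Export all_classical all_reals all_analysis.

Set Implicit Arguments.
Unset Strict Implicit.
Unset Printing Implicit Defensive.

Import Order.TTheory GRing.Theory Num.Theory.
Import numFieldNormedType.Exports.

Local Open Scope classical_set_scope.
Local Open Scope ring_scope.

(* A state space is a (finite) set [E] in a [choiceType]; [r x y] is the rate
   of jumping from [x] to [y].  The same notions are used for the microscopic
   chains (with [E] the grid) and for the reduced chains (with [E] all of
   ['I_n] or a closed class).  Only off-diagonal rates of the latter matter. *)

Section JumpRates.
Context {R : realType} {T : choiceType}.
Implicit Types (E C : set T) (r : T -> T -> R) (w f u : T -> R) (x y : T).

Definition is_jump_rate E r :=
  (forall x y, E x -> E y -> 0 <= r x y) /\ (forall x, E x -> r x x = 0).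

Definition generator E r f x := \sum_(y \in E) r x y * (f y - f x).

Definition holding_rate E r x := \sum_(y \in E) r x y.

Definition jump_rel E r : rel T :=
  fun x y => [&& y \in E, x != y & 0 < r x y].

Definition irreducible E r :=
  forall x y, E x -> E y -> exists2 s, path (jump_rel E r) x s & last x s = y.

Definition closed_irreducible_class r C :=
  [/\ C !=set0,
      (forall x y, C x -> ~ C y -> r x y = 0)
    & irreducible C r].

Definition is_pmf E w := (forall x, E x -> 0 <= w x) /\ \sum_(x \in E) w x = 1.

(* Diagonal rates contribute equally to both sides of the balance equation. *)
Definition is_stationary E r w :=
  is_pmf E w /\
  forall y, E y -> \sum_(x \in E) w x * r x y = w y * holding_rate E r y.

Definition detailed_balance E r w :=
  forall x y, E x -> E y -> w x * r x y = w y * r y x.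

Definition rate_functional E r w : \bar R :=
  ereal_sup
    [set (- \sum_(x \in E) generator E r u x / u x * w x)%:E
    | u in [set u | forall x, E x -> 0 < u x]].

Definition mass w E := \sum_(x \in E) w x.

Definition dirichlet r w E f :=
  2^-1 * (mass w E)^-1 *
  \sum_(x \in E) \sum_(y \in E `\ x) w x * r x y * (f y - f x) ^+ 2.

(* Transition probabilities of the embedded jump chain; a state with zero
   holding rate is absorbing. *)
Definition jump_prob E r x y :=
  if holding_rate E r x == 0 then (x == y)%:R else r x y / holding_rate E r x.

End JumpRates.

Section MarkovChain.
Context {R : realType} {T : choiceType} {disp : measure_display}
  {Omega : measurableType disp}.
Implicit Types (E A : set T) (r : T -> T -> R) (X : R -> Omega -> T)
  (P : T -> probability Omega R).

(* [is_markov_chain_with E r X P Z S]: under each [P x], [x \in E], the process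
   [(X t)_(t >= 0)] is the Markov chain on [E] with jump rates [r] started at
   [x]; [Z k] is the k-th visited state and [S k] the holding time there, which
   is [+oo] once the chain is absorbed (in which case the later [Z]'s and [S]'s
   play no role).  As on the canonical path space, every trajectory is a
   right-continuous, non-explosive step function. *)
Record is_markov_chain_with E r X P (Z : nat -> Omega -> T)
    (S : nat -> Omega -> \bar R) : Prop := {
  mc_state : forall k o, E (Z k o) ;
  mc_jump : forall k o, (S k o < +oo)%E -> Z k.+1 o <> Z k o ;
  mc_hold_gt0 : forall k o, (0 < S k o)%E ;
  mc_nonexplosive : forall o,
    (\sum_(i < k) S i o)%E @[k --> \oo] --> (+oo : \bar R)%E ;
  mc_path : forall k o (t : R),
    (\sum_(i < k) S i o <= t%:E)%E -> (t%:E < \sum_(i < k.+1) S i o)%E ->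
    X t o = Z k o ;
  mc_meas_state : forall k z, measurable [set o | Z k o = z] ;
  mc_meas_hold : forall k (s : R), measurable [set o | (s%:E < S k o)%E] ;
  mc_law : forall x, E x ->
    forall k (z : nat -> T) (s : nat -> R),
      (forall i, E (z i)) -> (forall i, 0 <= s i) ->
      P x [set o | forall i, (i <= k)%N -> Z i o = z i /\ ((s i)%:E < S i o)%E]
      = ((z 0%N == x)%:R
         * \prod_(i < k) jump_prob E r (z i) (z i.+1)
         * \prod_(i < k.+1) expR (- (holding_rate E r (z i) * s i)))%:E }.

Definition is_markov_chain E r X P :=
  exists Z S, is_markov_chain_with E r X P Z S.

Definition hitting_time X A (o : Omega) : \bar R :=
  ereal_inf [set t%:E | t in [set t | 0 <= t /\ A (X t o)]].

Definition first_jump_time X (o : Omega) : \bar R :=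
  ereal_inf [set t%:E | t in [set t | 0 <= t /\ X t o <> X 0 o]].

Definition return_time X A (o : Omega) : \bar R :=
  ereal_inf [set t%:E | t in [set t | (first_jump_time X o < t%:E)%E /\ A (X t o)]].

Definition trace_rate E r X P A x y : R :=
  holding_rate E r x *
  fine (P x [set o | hitting_time X [set y] o = return_time X A o]).

Definition mean_jump_rate E r X P (w : T -> R) (m : nat) (W : 'I_m -> set T)
    (i j : 'I_m) : R :=
  (mass w (W i))^-1 *
  \sum_(x \in W i) w x *
    \sum_(y \in W j) trace_rate E r X P (\bigcup_k W k) x y.

End MarkovChain.

(* Cells are allowed to be empty: for small [n] the grid may have fewer points
   than there are wells. *)
Definition is_partition (T : Type) (E : set T) (m : nat) (W : 'I_m -> set T)
    (Delta : set T) :=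
  [/\ trivIset [set: 'I_m] W, (\bigcup_j W j) `&` Delta = set0
    & (\bigcup_j W j) `|` Delta = E].

Section StateSpace.
Context {R : realType} {d : nat}.
Local Notation V := 'rV[R]_d.
Implicit Types (x y : V).

(* A metric subspace of R^d.  The torus R^d / Z^d is represented by the
   fundamental domain [0, 1)^d with the quotient metric. *)
Record space := Space { carrier : set V ; sdist : V -> V -> R }.

Definition euclid_dist x y : R := Num.sqrt (\sum_i (x 0 i - y 0 i) ^+ 2).

Definition torus_dist x y : R :=
  Num.sqrt (\sum_i Num.min `|x 0 i - y 0 i| (1 - `|x 0 i - y 0 i|) ^+ 2).

Definition torus : space :=
  Space [set x : V | forall i, 0 <= x 0 i < 1] torus_dist.

Definition closed_domain (U : set V) : space := Space (closure U) euclid_dist.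

Definition is_state_space (Xi : space) :=
  Xi = torus \/
  exists U : set V, [/\ open U, bounded_set U & Xi = closed_domain U].

Definition grid (Xi : space) (n : nat) : set V :=
  [set x | carrier Xi x /\ forall i, exists k : int, x 0 i = k%:~R / n%:R].

Definition sball (Xi : space) x (e : R) : set V :=
  [set y | carrier Xi y /\ sdist Xi x y < e].

Definition borelV := g_sigma_algebraType (@open V).

End StateSpace.
Arguments space : clear implicits.
Arguments torus : clear implicits.
Arguments borelV : clear implicits.

Section WeakTopology.
Context {R : realType} {d : nat}.
Local Notation V := 'rV[R]_d.
Implicit Types (Xi : space R d).

Definition continuous_on Xi (f : V -> R) :=
  forall x, carrier Xi x -> forall e, 0 < e ->
    exists2 delta, 0 < delta
      & forall y, carrier Xi y -> sdist Xi x y < delta -> `|f y - f x| < e.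

Definition bounded_on Xi (f : V -> R) :=
  exists K, forall x, carrier Xi x -> `|f x| <= K.

Definition test_fun Xi := {f : V -> R | bounded_on Xi f /\ continuous_on Xi f}.

HB.instance Definition _ Xi := gen_eqMixin (test_fun Xi).
HB.instance Definition _ Xi := gen_choiceMixin (test_fun Xi).

Definition prob Xi := {mu : probability (borelV R d) R | mu (carrier Xi) = 1%E}.

Definition prob_measure Xi (mu : prob Xi) : set (borelV R d) -> \bar R :=
  sval mu.

Definition test_integrals Xi (mu : prob Xi) : {ptws test_fun Xi -> R} :=
  fun f => \int[sval mu]_(x in (carrier Xi : set (borelV R d))) (sval f x).

HB.instance Definition _ Xi := gen_eqMixin (prob Xi).
HB.instance Definition _ Xi := gen_choiceMixin (prob Xi).
HB.instance Definition _ Xi :=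
  Topological.copy (prob Xi) (initial_topology (@test_integrals Xi)).

(* The values of a library measure on non-measurable sets are unspecified, so
   equality of measures is equality on Borel sets. *)
Definition meas_eq (mu nu : set (borelV R d) -> \bar R) :=
  forall A : set (borelV R d), measurable A -> mu A = nu A.

(* Weak convergence for set functions that are known to be probability measures
   on [Xi] only eventually. *)
Definition weak_cvg Xi (nu_ : nat -> set (borelV R d) -> \bar R)
    (nu : set (borelV R d) -> \bar R) :=
  exists (mu_ : nat -> prob Xi) (mu : prob Xi),
    [/\ \forall n \near \oo, meas_eq (prob_measure (mu_ n)) (nu_ n),
        meas_eq (prob_measure mu) nu
      & mu_ @ \oo --> mu].

(* [pi( . | A)]; it is the null set function when [A] is empty. *)
Definition cond_measure (pi : V -> R) (A : set V) :
    set (borelV R d) -> \bar R :=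
  fun B => (mass pi (A `&` B) / mass pi A)%:E.

Definition mixture (m : nat) (w : 'I_m -> R)
    (nu : 'I_m -> set (borelV R d) -> \bar R) : set (borelV R d) -> \bar R :=
  fun A => (\sum_(j < m) (w j)%:E * nu j A)%E.

Definition is_mixture Xi (m : nat) (nu : 'I_m -> set (borelV R d) -> \bar R)
    (mu : prob Xi) (w : 'I_m -> R) :=
  is_pmf [set: 'I_m] w /\ meas_eq (prob_measure mu) (mixture w nu).

Definition level2_functional Xi (n : nat) (r : V -> V -> R) (mu : prob Xi) :
    \bar R :=
  if prob_measure mu (grid Xi n) == 1%E then
    rate_functional (grid Xi n) r (fun x => fine (prob_measure mu [set x]))
  else +oo%E.

(* [metastable_states x cls M p] is the family pi^(p+1): levels start at 1.
   [M p m] is a mass function on the m-th class of level [p];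
   its values outside that class are not used. *)
Fixpoint metastable_states (N : nat -> nat) (x : 'I_(N 1%N) -> V)
    (cls : forall p, 'I_(N p.+1) -> set 'I_(N p))
    (M : forall p, 'I_(N p.+1) -> 'I_(N p) -> R) (p : nat) :
    'I_(N p.+1) -> set (borelV R d) -> \bar R :=
  match p with
  | 0%N => fun j A => \d_(x j : borelV R d) A
  | p'.+1 => fun j A =>
      (\sum_(k \in cls p'.+1 j)
         (M p'.+1 j k)%:E * metastable_states x cls M k A)%E
  end.

Definition reduced_functional Xi (m : nat) (r : 'I_m -> 'I_m -> R)
    (nu : 'I_m -> set (borelV R d) -> \bar R) (mu : prob Xi) : \bar R :=
  match pselect (exists w, is_mixture nu mu w) with
  | left h => rate_functional [set: 'I_m] r (sval (cid h))
  | right _ => +oo%E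
  end.

Definition limit_functionals Xi (N : nat -> nat) (x : 'I_(N 1%N) -> V)
    (cls : forall p, 'I_(N p.+1) -> set 'I_(N p))
    (M : forall p, 'I_(N p.+1) -> 'I_(N p) -> R)
    (r : forall p, 'I_(N p) -> 'I_(N p) -> R)
    (I0 : prob Xi -> \bar R) (p : nat) : prob Xi -> \bar R :=
  match p with
  | 0%N => I0
  | p'.+1 => reduced_functional (r p'.+1) (@metastable_states N x cls M p')
  end.

End WeakTopology.

Definition gamma_cvg (R : realType) (X : topologicalType)
    (U_ : nat -> X -> \bar R) (U : X -> \bar R) :=
  (forall (x_ : nat -> X) (x : X), x_ @ \oo --> x ->
     (U x <= limn_einf (fun n => U_ n (x_ n)))%E) /\
  (forall x : X, exists2 x_ : nat -> X, x_ @ \oo --> x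
     & (limn_esup (fun n => U_ n (x_ n)) <= U x)%E).

Definition prec (R : realType) (a b : nat -> R) :=
  a n / b n @[n --> \oo] --> (0 : R).

Definition full_gamma_expansion (R : realType) (d : nat) (Xi : space R d)
    (I_ : nat -> prob Xi -> \bar R) (q : nat) (theta : nat -> nat -> R)
    (I : nat -> prob Xi -> \bar R) :=
  [/\ (forall p mu, (p <= q)%N -> (0 <= I p mu)%E),
      (theta 1%N n @[n --> \oo] --> +oo /\
       forall p, (0 < p < q)%N -> prec (theta p) (theta p.+1)),
      (gamma_cvg I_ (I 0%N) /\
       forall p, (0 < p <= q)%N ->
         gamma_cvg (fun n mu => ((theta p n)%:E * I_ n mu)%E) (I p)),
      (forall p mu, (p < q)%N -> (I p.+1 mu < +oo)%E <-> I p mu = 0%E)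
    & exists mu, I q mu = 0%E /\
        forall nu, I q nu = 0%E ->
          meas_eq (prob_measure nu) (prob_measure mu)].

(* Main.v *)
From HB Require Import structures.
Require Import Defs.
From mathcomp Require Import ring lra zify.
Set Implicit Arguments.
Unset Strict Implicit.
Unset Printing Implicit Defensive.
Import Order.TTheory GRing.Theory Num.Theory.
Import numFieldNormedType.Exports.
Local Open Scope classical_set_scope.
Local Open Scope ring_scope.

(** For a reversible chain the level-two functional is a Dirichlet form: [I_n]
    of [pi_n f ^ 2] is the energy of [f >= 0] ([rate_le_energy] and
    [energy_le_rate], with [u = f + eps] as near-maximiser).  The theorem is a
    statement about this quadratic form on the time-scales [theta p].

    Lower bound at level [p].  Let [theta p n * I_n (mu_n)] stay bounded.  By
    the spectral-gap bound the square root of the density of [mu_n] with respect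
    to [pi_n] varies on each base well by [O(beta n / theta p n)] in mean square,
    so the density is nearly constant there ([near_constant]), with the value
    dictated by the weak limit of [mu_n] ([density_cvg]).  Now insert in the
    supremum that defines [I_n] the harmonic extension of a function [u] of the
    wells: its generator vanishes off the wells, and on the wells it is the
    generator of the trace chain.  What remains in the limit is the expression
    whose supremum over [u] is the reduced functional
    ([reduced_rate_le_liminf]).

    Upper bound at level [p].  Give the [j]-th well, of mass [a j], the value
    [sqrt (w j / a j)] and extend harmonically; the energy of the extension is
    that of the trace chain.  Since [a i * r_n i j = a j * r_n j i], the scaled
    energy converges to half the sum over [i, j] of
    [(sqrt (w i * r i j) - sqrt (w j * r j i)) ^ 2].  The limit rates
    [r] need not be reversible, but they are limits of reversible rates, which is
    enough for this sum to be at most the reduced functional of [w]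
    ([sqrt_form_le]).  That the mass of the measures [pi_n f ^ 2] does not escape
    from the wells is not estimated: by compactness ([prob_seq_compact]) they have
    limit points, and the lower bound of the previous level forces these to be
    mixtures of the measures of the present level ([recovery_limit]).

    Induction over the levels.  The reduced functional vanishes at [w] iff [w]
    satisfies detailed balance for the limit rates ([reduced_rate0_balance]),
    iff [w] is a mixture of the stationary states of the closed classes
    ([rate0_spread]).  Thus the zero set at one level is the finiteness set at
    the next one.  Moreover the masses of the wells of a closed class, divided by
    their sum, converge to its stationary state ([class_limit]), so the merged
    wells carry the next family of metastable measures ([next_limit]).

    The jump rates of the trace chain are defined by hitting times of the
    process; [trace_rateE] identifies them with the algebraic trace of the rate
    matrix, for which balance, harmonic extension and energy are elementary. *)

(** * Limits and the maximum principle *)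

Lemma cvg_limit_ge (R : realType) (I : Type) (F : set_system I)
    {FF : ProperFilter F} (f : I -> R) (c l : R) :
  f i @[i --> F] --> l -> (\forall i \near F, c <= f i) -> c <= l.
Proof. by move=> fl cf; rewrite -(cvg_lim _ fl)//; apply: limr_ge => //; exact: cvgP fl. Qed.

Lemma cvg_limit_le (R : realType) (I : Type) (F : set_system I)
    {FF : ProperFilter F} (f : I -> R) (c l : R) :
  f i @[i --> F] --> l -> (\forall i \near F, f i <= c) -> l <= c.
Proof. by move=> fl cf; rewrite -(cvg_lim _ fl)//; apply: limr_le => //; exact: cvgP fl. Qed.

Lemma cvg_sum_seq (R : realType) (K : Type) (F : set_system K) {FF : Filter F}
    (I : eqType) (s : seq I) (P : pred I) (f : I -> K -> R) (l : I -> R) :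
  (forall i, i \in s -> P i -> f i k @[k --> F] --> l i) ->
  \sum_(i <- s | P i) f i k @[k --> F] --> \sum_(i <- s | P i) l i.
Proof.
move=> fl; rewrite big_seq_cond; under eq_fun do rewrite big_seq_cond.
apply: cvg_big => [|i /andP[]]; [exact: add_continuous|exact: fl].
Qed.

(** In what follows a finite state space is the sequence [s] of its points, so
    that sums over it are sums over [s]. *)
Section FiniteChain.
Context {R : realType} {T : choiceType}.
Variables (s : seq T) (r : T -> T -> R).

Definition sgen (f : T -> R) x := \sum_(y <- s) r x y * (f y - f x).

Definition sjump : rel T := fun x y => [&& y \in s, x != y & 0 < r x y].

Definition sirr :=
  forall x y, x \in s -> y \in s -> exists2 p, path sjump x p & last x p = y.

Lemma seq_argmax (c : T -> R) : s != [::] ->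
  exists2 z, z \in s & forall y, y \in s -> c y <= c z.
Proof.
elim: s => // a [|b s'] IH _.
  by exists a => [|y]; rewrite !inE // => /eqP ->.
have [//|z zs cz] := IH.
case: (lerP (c a) (c z)) => caz.
  exists z => [|y]; first by rewrite inE zs orbT.
  by rewrite inE => /predU1P[->//|]; exact: cz.
exists a => [|y]; first by rewrite inE eqxx.
rewrite inE => /predU1P[->//|/cz cyz]; exact: le_trans cyz (ltW caz).
Qed.

Hypothesis r_ge0 : forall x y, x \in s -> y \in s -> 0 <= r x y.

Lemma sum_npos_eq0 (F : T -> R) : (forall y, y \in s -> F y <= 0) ->
  0 <= \sum_(y <- s) F y -> forall y, y \in s -> F y = 0.
Proof.
move=> F0 sF y ys; apply/eqP; rewrite -oppr_eq0; apply/eqP.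
have: \sum_(z <- s) - F z == 0.
  rewrite eq_le {1}sumrN oppr_le0 sF /= big_seq sumr_ge0 // => z zs.
  by rewrite oppr_ge0 F0.
rewrite big_seq psumr_eq0; last by move=> z zs; rewrite oppr_ge0 F0.
by move=> /allP/(_ _ ys); rewrite ys => /eqP.
Qed.

(** At a maximum of [c] off [A] all neighbours share the value, so the maximum
    propagates along a path of positive rates until it reaches [A]. *)
Lemma max_principle (A : pred T) (c : T -> R) a : sirr -> a \in s -> A a ->
  (forall z, z \in s -> ~~ A z -> 0 <= sgen c z) ->
  (forall z, z \in s -> A z -> c z <= 0) ->
  forall z, z \in s -> c z <= 0.
Proof.
move=> irr as_ Aa csub cA.
have sn0 : s != [::] by case: s as_.
have [z0 z0s z0max] := seq_argmax c sn0.
suff cz0 : c z0 <= 0 by move=> z zs; exact: le_trans (z0max z zs) cz0.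
rewrite leNgt; apply/negP => cz0.
have [p pp lp] := irr z0 a z0s as_.
have caz : c a = c z0.
  (* the maximum is attained all along a path from [z0] to [a] *)
  have walk : forall q z, z \in s -> c z = c z0 -> path sjump z q ->
      c (last z q) = c z0.
    elim=> [//|y q IH] z zs cz /= /andP[/and3P[ys _ rzy] pq].
    apply: IH pq => //.
    have nAz : ~~ A z by apply/negP => /(cA z zs); rewrite cz leNgt cz0.
    have F0 w : w \in s -> r z w * (c w - c z) <= 0.
      by move=> ws; rewrite mulr_ge0_le0 ?r_ge0 // subr_le0 cz z0max.
    have /eqP := sum_npos_eq0 F0 (csub z zs nAz) ys.
    by rewrite mulf_eq0 gt_eqF //= subr_eq0 cz => /eqP.
  by rewrite -lp walk.
have := cA a as_ Aa; by rewrite caz leNgt cz0.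
Qed.

End FiniteChain.

Lemma bigD1_seq_cond (V : nmodType) (T : eqType) (s : seq T) (P : pred T)
    (F : T -> V) (y : T) : y \in s -> uniq s -> P y ->
  \sum_(w <- s | P w) F w = F y + \sum_(w <- s | P w && (w != y)) F w.
Proof.
move=> ys us Py; rewrite big_mkcond (bigD1_seq y) //= Py; congr (_ + _).
rewrite big_mkcond [RHS]big_mkcond; apply: eq_bigr => w _.
by case: (P w); case: (w != y).
Qed.

(** * Hitting distributions of a finite chain *)

Section Hitting.
Context {R : realType} {T : choiceType}.
Variables (s : seq T) (p : T -> T -> R) (A : pred T).
Hypothesis p_ge0 : forall x y, x \in s -> y \in s -> 0 <= p x y.
Hypothesis p_sum : forall x, x \in s -> \sum_(y <- s) p x y = 1.
Hypothesis s_uniq : uniq s.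

(** One step of the chain with transition probabilities [p], killed on entering
    [A]. *)
Definition killed (f : T -> R) z := \sum_(w <- s | ~~ A w) p z w * f w.

(** The probability of entering [A] at [y] within [k] steps, the starting point
    not counting as a visit. *)
Definition hit_by (y : T) (k : nat) : T -> R :=
  iter k (fun g z => p z y + killed g z) (fun=> 0).

Definition surv (k : nat) : T -> R := iter k killed (fun=> 1).

Lemma killed_ge0 f z : z \in s -> (forall w, w \in s -> 0 <= f w) ->
  0 <= killed f z.
Proof.
move=> zs f0; rewrite /killed big_seq_cond sumr_ge0 // => w /andP[ws _].
by rewrite mulr_ge0 ?p_ge0 ?f0.
Qed.

Lemma killed_le f g z : z \in s -> (forall w, w \in s -> f w <= g w) ->
  killed f z <= killed g z.
Proof.
move=> zs fg; rewrite /killed big_seq_cond [leRHS]big_seq_cond.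
by rewrite ler_sum // => w /andP[ws _]; rewrite ler_wpM2l ?p_ge0 ?fg.
Qed.

Lemma hit_by_ge0 y k z : y \in s -> z \in s -> 0 <= hit_by y k z.
Proof.
move=> ys; elim: k z => [|k IH] z zs //=.
by rewrite addr_ge0 ?p_ge0 // killed_ge0.
Qed.

Lemma surv_ge0 k z : z \in s -> 0 <= surv k z.
Proof. by elim: k z => [|k IH] z zs //=; rewrite killed_ge0. Qed.

Lemma hit_by_mono y z : y \in s -> z \in s ->
  nondecreasing_seq (hit_by y ^~ z).
Proof.
move=> ys zs; apply/nondecreasing_seqP => k.
elim: k z zs => [|k IH] z zs; first exact: (@hit_by_ge0 y 1).
by rewrite /= lerD2l killed_le.
Qed.

Lemma hit_surv k z : z \in s ->
  \sum_(y <- s | A y) hit_by y k z + surv k z = 1.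
Proof.
elim: k z => [|k IH] z zs; first by rewrite /= big1 // add0r.
rewrite /= big_split /= -addrA -[RHS](p_sum zs) [RHS](bigID A) /=; congr (_ + _).
rewrite /killed exchange_big /= -big_split /= big_seq_cond [RHS]big_seq_cond.
apply: eq_bigr => w /andP[ws _]; rewrite -mulr_sumr -mulrDr.
by rewrite (IH w ws) mulr1.
Qed.

Lemma hit_by_le1 y k z : y \in s -> A y -> z \in s -> hit_by y k z <= 1.
Proof.
move=> ys Ay zs; rewrite -(hit_surv k zs) (bigD1_seq_cond _ ys) //= -addrA lerDl.
by rewrite addr_ge0 ?surv_ge0 // big_seq_cond sumr_ge0 // => w /and3P[ws _ _];
  rewrite hit_by_ge0.
Qed.

Lemma surv_le1 k z : z \in s -> surv k z <= 1.
Proof.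
move=> zs; rewrite -(hit_surv k zs) lerDr.
by rewrite big_seq_cond sumr_ge0 // => w /andP[ws _]; rewrite hit_by_ge0.
Qed.

Definition hit y z : R := limn (hit_by y ^~ z).

Lemma hit_cvg y z : y \in s -> A y -> z \in s ->
  hit_by y k z @[k --> \oo] --> hit y z.
Proof.
move=> ys Ay zs; apply: nondecreasing_is_cvgn; first exact: hit_by_mono.
by exists 1 => _ [k _ <-]; exact: hit_by_le1.
Qed.

Lemma hit_ge0 y z : y \in s -> A y -> z \in s -> 0 <= hit y z.
Proof.
move=> ys Ay zs; apply: (cvg_limit_ge (hit_cvg ys Ay zs)).
by apply: nearW => k; exact: hit_by_ge0.
Qed.

Lemma killed_cvg (f_ : nat -> T -> R) f z :
  (forall w, w \in s -> ~~ A w -> f_ k w @[k --> \oo] --> f w) ->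
  killed (f_ k) z @[k --> \oo] --> killed f z.
Proof.
move=> fcvg; apply: cvg_sum_seq => w ws Aw.
by apply: cvgM; [exact: cvg_cst|exact: fcvg].
Qed.

Lemma hitE y z : y \in s -> A y -> z \in s ->
  hit y z = p z y + killed (hit y) z.
Proof.
move=> ys Ay zs; have h1 := hit_cvg ys Ay zs.
have h2 : hit_by y k.+1 z @[k --> \oo] --> p z y + killed (hit y) z.
  rewrite /=; apply: cvgD; first exact: cvg_cst.
  by apply: killed_cvg => w ws _; exact: hit_cvg.
have h3 : hit_by y k.+1 z @[k --> \oo] --> hit y z.
  by rewrite (cvg_shiftS (fun k => hit_by y k z)).
by rewrite -[LHS](cvg_lim _ h3) // (cvg_lim _ h2).
Qed.

Hypothesis p_irr : sirr s p.
Variable a : T.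
Hypotheses (as_ : a \in s) (Aa : A a).

(** The limit of the survival probabilities, set to 0 on [A], is subharmonic off
    [A], so the maximum principle bounds it by 0. *)
Lemma surv_cvg0 z : z \in s -> surv k z @[k --> \oo] --> (0 : R).
Proof.
have mono w : w \in s -> nonincreasing_seq (surv ^~ w).
  move=> ws; apply/nonincreasing_seqP => k.
  elim: k w ws => [|k IH] w ws; first by rewrite (surv_le1 1).
  by rewrite /= killed_le.
have cv w : w \in s -> surv k w @[k --> \oo] --> limn (surv ^~ w).
  move=> ws; apply: nonincreasing_is_cvgn; first exact: mono.
  by exists 0 => _ [k _ <-]; exact: surv_ge0.
set c := fun w => limn (surv ^~ w) in cv.
have c0 w : w \in s -> 0 <= c w.
  by move=> ws; apply: (cvg_limit_ge (cv w ws)); apply: nearW => k; exact: surv_ge0.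
have cE w : w \in s -> c w = killed c w.
  move=> ws; have h3 : surv k.+1 w @[k --> \oo] --> c w.
    by rewrite (cvg_shiftS (fun k => surv k w)); exact: cv.
  have h2 : surv k.+1 w @[k --> \oo] --> killed c w.
    by apply: killed_cvg => v vs _; exact: cv.
  by rewrite -[LHS](cvg_lim _ h3) // (cvg_lim _ h2).
pose c' w := if A w then 0 else c w.
have c'0 : forall w, w \in s -> c' w <= 0.
  apply: (max_principle p_ge0 p_irr as_ Aa) => [w ws nAw|w ws Aw]; last first.
    by rewrite /c' Aw.
  rewrite /sgen; under eq_bigr do rewrite mulrBr.
  rewrite sumrB -mulr_suml (p_sum ws) mul1r subr_ge0 {1}/c' (negbTE nAw) (cE _ ws).
  rewrite /killed big_mkcond /=.
  by rewrite ler_sum // => v _; rewrite /c'; case: (A v); rewrite ?mulr0.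
move=> zs; suff -> : (0:R) = c z by exact: cv.
rewrite cE // /killed big_seq_cond big1 // => w /andP[ws nAw].
have := c'0 w ws; rewrite /c' (negbTE nAw) => cw.
have -> : c w = 0 by apply/eqP; rewrite eq_le cw c0.
by rewrite mulr0.
Qed.

Lemma hit_sum z : z \in s -> \sum_(y <- s | A y) hit y z = 1.
Proof.
move=> zs.
have h : \sum_(y <- s | A y) hit_by y k z + surv k z @[k --> \oo] -->
    \sum_(y <- s | A y) hit y z + 0.
  apply: cvgD; last exact: surv_cvg0.
  by apply: cvg_sum_seq => y ys Ay; exact: hit_cvg.
rewrite -[LHS]addr0 -(cvg_lim _ h) //.
by under eq_fun do rewrite hit_surv //; rewrite lim_cst.
Qed.

(** The harmonic measure of [A] seen from [z]; unlike [hit], a point of [A] hits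
    itself at time 0. *)
Definition hker y z : R := if A z then (z == y)%:R else hit y z.

Lemma hker_mean y z : y \in s -> A y -> z \in s ->
  \sum_(w <- s) p z w * hker y w = hit y z.
Proof.
move=> ys Ay zs; rewrite hitE // (bigID A) /=; congr (_ + _); last first.
  by apply: eq_bigr => w /negbTE nA; rewrite /hker nA.
rewrite (bigD1_seq_cond _ ys) //= /hker Ay eqxx mulr1 big1 ?addr0 // => w /andP[Aw wy].
by rewrite Aw (negbTE wy) mulr0.
Qed.

Lemma hker_ge0 y z : y \in s -> A y -> z \in s -> 0 <= hker y z.
Proof.
by move=> ys Ay zs; rewrite /hker; case: ifP => // _; exact: hit_ge0.
Qed.

Lemma hker_sum z : z \in s -> \sum_(y <- s | A y) hker y z = 1.
Proof.
move=> zs; have [Az|nAz] := boolP (A z); last first.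
  by rewrite -[RHS](hit_sum zs) /hker (negbTE nAz).
rewrite /hker Az (bigD1_seq_cond _ zs) //= eqxx big1 ?addr0 // => w /andP[_].
by rewrite eq_sym => /negbTE ->.
Qed.

End Hitting.

(** * The energy and the rate functional *)

Section Energy.
Context {R : realType} {T : choiceType}.
Variables (s : seq T) (r : T -> T -> R) (w : T -> R).

Definition energy (f : T -> R) :=
  2^-1 * \sum_(x <- s) \sum_(y <- s) w x * r x y * (f y - f x) ^+ 2.

Hypothesis balance :
  forall x y, x \in s -> y \in s -> w x * r x y = w y * r y x.

Lemma symmetric_sum (F : T -> T -> R) :
  \sum_(x <- s) \sum_(y <- s) w x * r x y * F x y =
  2^-1 * \sum_(x <- s) \sum_(y <- s) w x * r x y * (F x y + F y x).
Proof.
have E : \sum_(x <- s) \sum_(y <- s) w x * r x y * F x y =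
         \sum_(x <- s) \sum_(y <- s) w x * r x y * F y x.
  rewrite exchange_big /= big_seq [RHS]big_seq; apply: eq_bigr => x xs.
  by rewrite big_seq [RHS]big_seq; apply: eq_bigr => y ys; rewrite balance.
have -> : \sum_(x <- s) \sum_(y <- s) w x * r x y * (F x y + F y x) =
    \sum_(x <- s) \sum_(y <- s) w x * r x y * F x y +
    \sum_(x <- s) \sum_(y <- s) w x * r x y * F y x.
  rewrite -big_split; apply: eq_bigr => x _ /=; rewrite -big_split.
  by apply: eq_bigr => y _ /=; rewrite mulrDr.
by rewrite -E; lra.
Qed.

Lemma sum_genE (f g : T -> R) :
  \sum_(x <- s) w x * f x * sgen s r g x =
  \sum_(x <- s) \sum_(y <- s) w x * r x y * (f x * (g y - g x)).
Proof.
apply: eq_bigr => x _; rewrite /sgen mulr_sumr; apply: eq_bigr => y _; ring.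
Qed.

(** Detailed balance makes the generator self-adjoint. *)
Lemma green (f g : T -> R) :
  \sum_(x <- s) w x * f x * sgen s r g x =
  \sum_(x <- s) w x * g x * sgen s r f x.
Proof.
rewrite !sum_genE symmetric_sum [RHS]symmetric_sum; congr (_ * _).
by apply: eq_bigr => x _; apply: eq_bigr => y _; congr (_ * _); ring.
Qed.

Lemma energyE (f : T -> R) :
  energy f = - \sum_(x <- s) w x * f x * sgen s r f x.
Proof.
rewrite sum_genE symmetric_sum -mulrN -sumrN; congr (_ * _).
apply: eq_bigr => x _; rewrite -sumrN; apply: eq_bigr => y _; ring.
Qed.

Hypotheses (r_ge0 : forall x y, x \in s -> y \in s -> 0 <= r x y)
  (w_ge0 : forall x, x \in s -> 0 <= w x).

(** Pair by pair, the difference of the two sides is the square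
    [(f x * u y - f y * u x) ^ 2 / (u x * u y)]. *)
Lemma rate_le_energy (f u : T -> R) : (forall x, x \in s -> 0 < u x) ->
  - \sum_(x <- s) sgen s r u x / u x * (w x * f x ^+ 2) <= energy f.
Proof.
move=> u0.
have -> : \sum_(x <- s) sgen s r u x / u x * (w x * f x ^+ 2) =
    \sum_(x <- s) \sum_(y <- s) w x * r x y * (f x ^+ 2 / u x * (u y - u x)).
  rewrite -[RHS](sum_genE (fun x => f x ^+ 2 / u x) u).
  by apply: eq_bigr => x _; ring.
rewrite symmetric_sum -mulrN ler_pM2l ?invr_gt0 // -sumrN.
rewrite big_seq [leRHS]big_seq ler_sum // => x xs.
rewrite -sumrN big_seq [leRHS]big_seq ler_sum // => y ys.
rewrite -mulrN ler_wpM2l ?mulr_ge0 ?r_ge0 ?w_ge0 //.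
have [ux uy] := (u0 x xs, u0 y ys).
rewrite -subr_ge0.
have -> : (f y - f x) ^+ 2 -
    - (f x ^+ 2 / u x * (u y - u x) + f y ^+ 2 / u y * (u x - u y)) =
    (f x * u y - f y * u x) ^+ 2 / (u x * u y).
  by field; rewrite !gt_eqF.
by rewrite divr_ge0 ?sqr_ge0 // mulr_ge0 ?ltW.
Qed.

(** The optimal [u] would be [f], which may vanish; [f + d] loses at most [d] times
    the fixed constant [K]. *)
Lemma energy_le_rate (f : T -> R) (e : R) : 0 < e ->
  (forall x, x \in s -> 0 <= f x) ->
  exists2 u : T -> R, forall x, x \in s -> 0 < u x &
  energy f - e <= - \sum_(x <- s) sgen s r u x / u x * (w x * f x ^+ 2).
Proof.
(* [K] bounds the error terms, in which [f / (f + d)] is at most 1 *)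
move=> e0 f0; set K := \sum_(x <- s) w x * `|sgen s r f x|.
have K0 : 0 <= K.
  by rewrite /K big_seq sumr_ge0 // => x xs; rewrite mulr_ge0 ?w_ge0.
have d0 : 0 < e / (K + 1) by rewrite divr_gt0 // ltr_wpDl.
set d := e / (K + 1) in d0.
have ud0 x : x \in s -> 0 < f x + d by move=> xs; rewrite ltr_wpDl ?f0.
exists (fun x => f x + d) => //.
have gE x : sgen s r (fun x => f x + d) x = sgen s r f x.
  by apply: eq_bigr => y _; congr (_ * _); ring.
have -> : \sum_(x <- s) sgen s r (fun x => f x + d) x / (f x + d) *
    (w x * f x ^+ 2) = \sum_(x <- s) w x * f x * sgen s r f x -
    d * \sum_(x <- s) w x * (f x / (f x + d)) * sgen s r f x.
  rewrite mulr_sumr -sumrB big_seq [RHS]big_seq; apply: eq_bigr => x xs.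
  by rewrite gE; field; rewrite gt_eqF // ud0.
rewrite opprB [leRHS]addrC -energyE lerD2l -[leLHS]mulN1r -[e](@divfK _ (K + 1)).
  rewrite mulN1r -mulrN -/d ler_wpM2l ?(ltW d0) // lerNl.
  apply: (@le_trans _ _ K); last by rewrite lerDl.
  rewrite /K -sumrN big_seq [leRHS]big_seq ler_sum // => x xs.
  rewrite -mulrN -mulrA ler_wpM2l ?w_ge0 //.
  apply: le_trans (ler_norm _) _; rewrite normrM normrN.
  rewrite ger0_norm ?divr_ge0 ?f0 ?(ltW (ud0 _ xs)) //.
  rewrite -[leRHS]mul1r ler_wpM2r // ler_pdivrMr ?ud0 // mul1r lerDl.
  exact: ltW.
by rewrite gt_eqF // ltr_wpDl.
Qed.

End Energy.

(** * Trace chain and harmonic extensions *)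

Section Trace.
Context {R : realType} {T : choiceType}.
Variables (s : seq T) (r : T -> T -> R) (w : T -> R) (A : pred T).
Hypotheses (s_uniq : uniq s)
  (r_ge0 : forall x y, x \in s -> y \in s -> 0 <= r x y)
  (r_irr : sirr s r)
  (hold_gt0 : forall x, x \in s -> 0 < \sum_(y <- s) r x y)
  (A_neq0 : exists2 a, a \in s & A a).

Local Notation hold x := (\sum_(y <- s) r x y).

Definition jumpp x y : R := r x y / hold x.

Let p_ge0 x y : x \in s -> y \in s -> 0 <= jumpp x y.
Proof. by move=> xs ys; rewrite divr_ge0 ?r_ge0 // ltW // hold_gt0. Qed.

Let p_sum x : x \in s -> \sum_(y <- s) jumpp x y = 1.
Proof. by move=> xs; rewrite -mulr_suml divff // gt_eqF // hold_gt0. Qed.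

Lemma jumpp_irr : sirr s jumpp.
Proof.
move=> x y xs ys; have [p pp lp] := r_irr xs ys; exists p => //.
elim: p x xs pp {lp} => //= z p IH x xs /andP[/and3P[zs xz rxz] pp].
by rewrite IH // /sjump zs xz divr_gt0 ?hold_gt0.
Qed.

(** The jump rates of the chain watched on [A]. *)
Definition strace x y := hold x * hit s jumpp A y x.

Lemma strace_ge0 x y : x \in s -> y \in s -> A y -> 0 <= strace x y.
Proof.
by move=> xs ys Ay; rewrite mulr_ge0 ?(ltW (hold_gt0 _)) // hit_ge0.
Qed.

Let rE x y : x \in s -> r x y = hold x * jumpp x y.
Proof. by move=> xs; rewrite /jumpp mulrC divfK // gt_eqF // hold_gt0. Qed.

Lemma sgen_hker y z : y \in s -> A y -> z \in s ->
  sgen s r (hker s jumpp A y) z = hold z * (hit s jumpp A y z - hker s jumpp A y z).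
Proof.
move=> ys Ay zs; rewrite /sgen.
under eq_bigr do rewrite rE // -mulrA mulrBr.
rewrite -mulr_sumr sumrB -mulr_suml p_sum // mul1r.
by case: A_neq0 => a as_ Aa; rewrite hker_mean.
Qed.

Lemma sgen_hker_out y z : y \in s -> A y -> z \in s -> ~~ A z ->
  sgen s r (hker s jumpp A y) z = 0.
Proof.
by move=> ys Ay zs /negbTE Az; rewrite sgen_hker // /hker Az subrr mulr0.
Qed.

Lemma sgen_hker_in y z : y \in s -> A y -> z \in s -> A z -> z != y ->
  sgen s r (hker s jumpp A y) z = strace z y.
Proof.
by move=> ys Ay zs Az /negbTE zy; rewrite sgen_hker // /hker Az zy subr0.
Qed.

(** The extension of [g] from [A] which is harmonic off [A]. *)
Definition hext (g : T -> R) z := \sum_(y <- s | A y) g y * hker s jumpp A y z.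

Lemma hext_in g z : z \in s -> A z -> hext g z = g z.
Proof.
move=> zs Az; rewrite /hext (bigD1_seq_cond _ zs) //=.
have -> : hker s jumpp A z z = 1 by rewrite /hker Az eqxx.
rewrite mulr1 big1 ?addr0 // => y /andP[_]; rewrite eq_sym => /negbTE zy.
by rewrite /hker Az zy mulr0.
Qed.

Lemma hext_ge g c z : (forall y, y \in s -> A y -> c <= g y) -> z \in s ->
  c <= hext g z.
Proof.
move=> cg zs; case: A_neq0 => a as_ Aa.
rewrite -[c]mulr1 -(hker_sum p_ge0 p_sum s_uniq jumpp_irr as_ Aa zs) mulr_sumr.
rewrite big_seq_cond [leRHS]big_seq_cond ler_sum // => y /andP[ys Ay].
by rewrite ler_wpM2r ?cg // hker_ge0.
Qed.

Lemma sgen_hext g z :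
  sgen s r (hext g) z = \sum_(y <- s | A y) g y * sgen s r (hker s jumpp A y) z.
Proof.
rewrite /sgen /hext; under [RHS]eq_bigr do rewrite mulr_sumr.
rewrite exchange_big /=; apply: eq_bigr => v _; rewrite -sumrB mulr_sumr.
by apply: eq_bigr => y _; ring.
Qed.

Lemma sgen_hext_out g z : z \in s -> ~~ A z -> sgen s r (hext g) z = 0.
Proof.
move=> zs Az; rewrite sgen_hext big_seq_cond big1 // => y /andP[ys Ay].
by rewrite sgen_hker_out ?mulr0.
Qed.

(** On [A] the generator of a harmonic extension is the generator of the trace
    chain. *)
Lemma sgen_hext_in g z : z \in s -> A z ->
  sgen s r (hext g) z = \sum_(y <- s | A y) strace z y * (g y - g z).
Proof.
move=> zs Az; case: A_neq0 => a as_ Aa.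
have H := hit_sum p_ge0 p_sum s_uniq jumpp_irr as_ Aa zs.
transitivity (\sum_(y <- s | A y) hold z * hit s jumpp A y z * g y - hold z * g z).
  have -> : hold z * g z = \sum_(y <- s | A y) hold z * (z == y)%:R * g y.
    rewrite (bigD1_seq_cond (P := A) _ zs) //= eqxx mulr1 [X in _ + X]big1 ?addr0 // => y /andP[_].
    by rewrite eq_sym => /negbTE ->; rewrite mulr0 mul0r.
  rewrite -sumrB sgen_hext big_seq_cond [RHS]big_seq_cond.
  apply: eq_bigr => y /andP[ys Ay]; rewrite sgen_hker // /hker Az; ring.
under [RHS]eq_bigr do rewrite mulrBr.
by rewrite sumrB -mulr_suml /strace -mulr_sumr H mulr1.
Qed.

Hypothesis balance :
  forall x y, x \in s -> y \in s -> w x * r x y = w y * r y x.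

(** Green's formula applied to the harmonic measures of [x] and [y]: each
    generator vanishes off [A], and on [A] each function is an indicator. *)
Lemma strace_balance x y : x \in s -> y \in s -> A x -> A y ->
  w x * strace x y = w y * strace y x.
Proof.
move=> xs ys Ax Ay; have [->//|xy] := eqVneq x y.
have key a b : a \in s -> b \in s -> A a -> A b -> a != b ->
   \sum_(z <- s) w z * hker s jumpp A a z * sgen s r (hker s jumpp A b) z =
   w a * strace a b.
  move=> as_ bs Aa Ab ab; rewrite (bigD1_seq a) //=.
  have -> : hker s jumpp A a a = 1 by rewrite /hker Aa eqxx.
  rewrite mulr1 sgen_hker_in // big_seq_cond big1 ?addr0 // => z /andP[zs za].
  have [Az|nAz] := boolP (A z); last by rewrite sgen_hker_out ?mulr0.
  have -> : hker s jumpp A a z = 0 by rewrite /hker Az (negbTE za).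
  by rewrite mulr0 mul0r.
by rewrite -(key x y) // green // key // eq_sym.
Qed.

(** Summation by parts leaves only the points of [A], where the generator is that
    of the trace chain. *)
Lemma energy_hext g :
  energy s r w (hext g) =
  2^-1 * \sum_(x <- s | A x) \sum_(y <- s | A y)
     w x * strace x y * (g y - g x) ^+ 2.
Proof.
have bal x y : x \in seq.filter A s -> y \in seq.filter A s ->
    w x * strace x y = w y * strace y x.
  by rewrite !mem_filter => /andP[? ?] /andP[? ?]; exact: strace_balance.
transitivity (energy (seq.filter A s) strace w g); last first.
  by rewrite /energy big_filter; congr (_ * _); apply: eq_bigr => x _;
     rewrite big_filter.
rewrite (energyE bal) energyE //; congr (- _); rewrite big_filter (bigID A) /=.
rewrite [X in _ + X]big_seq_cond [X in _ + X]big1 ?addr0; last first.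
  by move=> z /andP[zs nAz]; rewrite sgen_hext_out ?mulr0.
rewrite big_seq_cond [RHS]big_seq_cond; apply: eq_bigr => z /andP[zs Az].
by rewrite hext_in // sgen_hext_in // /sgen big_filter.
Qed.

End Trace.

(** * Hitting and return times along a path *)

Section Paths.
Context {R : realType} {T : choiceType} {disp : measure_display}
  {Omega : measurableType disp}.
Variables (E : set T) (r : T -> T -> R) (X : R -> Omega -> T)
  (P : T -> probability Omega R) (Z : nat -> Omega -> T)
  (S : nat -> Omega -> \bar R).
Hypothesis mc : is_markov_chain_with E r X P Z S.

Definition jump_time k o := (\sum_(i < k) S i o)%E.

Lemma jump_time0 o : jump_time 0 o = 0%E.
Proof. by rewrite /jump_time big_ord0. Qed.

Lemma jump_timeS k o : jump_time k.+1 o = (jump_time k o + S k o)%E.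
Proof. by rewrite /jump_time big_ord_recr. Qed.

Lemma jump_time_ge0 k o : (0 <= jump_time k o)%E.
Proof. by apply: sume_ge0 => i _; exact: ltW (mc_hold_gt0 mc i o). Qed.

Lemma jump_time_leS k o : (jump_time k o <= jump_time k.+1 o)%E.
Proof. by rewrite jump_timeS leeDl // ltW // (mc_hold_gt0 mc). Qed.

Lemma jump_time_mono o j k : (j <= k)%N -> (jump_time j o <= jump_time k o)%E.
Proof.
elim: k => [|k IH]; first by rewrite leqn0 => /eqP ->.
rewrite leq_eqVlt => /predU1P[->//|]; rewrite ltnS => /IH jk.
exact: le_trans jk (jump_time_leS _ _).
Qed.

Lemma jump_time_ltS k o :
  (jump_time k o < +oo)%E -> (jump_time k o < jump_time k.+1 o)%E.
Proof.
move=> koo; rewrite jump_timeS lteDl ?(mc_hold_gt0 mc) //.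
by rewrite ge0_fin_numE // jump_time_ge0.
Qed.

Lemma jump_time_lt o j k : (j < k)%N ->
  (jump_time j o < +oo)%E -> (jump_time j o < jump_time k o)%E.
Proof.
by move=> jk joo; apply: lt_le_trans (jump_time_ltS joo) (jump_time_mono _ jk).
Qed.

Lemma jump_time_ltoo k o :
  (jump_time k o < +oo)%E <-> forall i, (i < k)%N -> (S i o < +oo)%E.
Proof.
elim: k => [|k [IH1 IH2]]; first by rewrite jump_time0 ltry.
rewrite jump_timeS; split=> [koo i|koo].
  rewrite ltnS leq_eqVlt => /predU1P[->|ik].
    by apply: le_lt_trans koo; rewrite leeDr // jump_time_ge0.
  apply: IH1 ik; apply: le_lt_trans koo.
  by rewrite leeDl // ltW // (mc_hold_gt0 mc).
by rewrite lte_add_pinfty ?koo // IH2 // => i ik; rewrite koo // ltnW.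
Qed.

Lemma jump_slot o (t : R) : 0 <= t ->
  exists k, (jump_time k o <= t%:E < jump_time k.+1 o)%E.
Proof.
move=> t0; have /cvgeyPgt/(_ t) [N _ /(_ N (leqnn N))] := mc_nonexplosive mc o.
rewrite /= -/(jump_time N o); elim: N => [|N IH].
  by rewrite jump_time0 lte_fin ltNge t0.
case: (leP (jump_time N o) t%:E) => [Nt tN|/IH//].
by exists N; rewrite Nt.
Qed.

Lemma path0 o : X 0 o = Z 0 o.
Proof.
apply: (mc_path mc); first by rewrite big_ord0.
by rewrite big_ord_recr big_ord0 /= add0e (mc_hold_gt0 mc).
Qed.

Lemma first_jump_timeE o : first_jump_time X o = jump_time 1 o.
Proof.
have before t : 0 <= t -> X t o <> X 0 o -> (jump_time 1 o <= t%:E)%E.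
  move=> t0; rewrite leNgt path0 => Xt; apply/negP => tT; apply: Xt.
  by apply: (mc_path mc) tT; rewrite big_ord0 lee_fin.
apply/eqP; rewrite eq_le; apply/andP; split; last first.
  by apply/ereal_infP => _ [t [t0 Xt] <-]; exact: before.
case: (ltP (jump_time 1 o) +oo%E) => [fin1|]; last first.
  by rewrite leye_eq => /eqP ->; rewrite leey.
have fin : jump_time 1 o \is a fin_num by rewrite ge0_fin_numE // jump_time_ge0.
apply: ereal_inf_lbound; exists (fine (jump_time 1 o)); last by rewrite fineK.
split; first by rewrite fine_ge0 // jump_time_ge0.
rewrite (mc_path mc (k := 1%N)) ?fineK //; last exact: jump_time_ltS.
rewrite path0; apply: (mc_jump mc).
by move: fin1; rewrite jump_timeS jump_time0 add0e.
Qed.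

(** The path is constant between jump times, so it enters [B] exactly at the jump
    time of the first visited state of [B]. *)
Lemma hitting_time_some o B k : (jump_time k o < +oo)%E -> B (Z k o) ->
  (forall j, (j < k)%N -> ~ B (Z j o)) -> hitting_time X B o = jump_time k o.
Proof.
move=> koo Bk nB; have fin : jump_time k o \is a fin_num.
  by rewrite ge0_fin_numE // jump_time_ge0.
apply/eqP; rewrite eq_le; apply/andP; split.
  apply: ereal_inf_lbound; exists (fine (jump_time k o)); last by rewrite fineK.
  split; first by rewrite fine_ge0 // jump_time_ge0.
  by rewrite (mc_path mc (k := k)) ?fineK //; exact: jump_time_ltS.
apply/ereal_infP => _ [t [t0 Bt] <-].
have [i /andP[it ti]] := jump_slot o t0.
apply: (le_trans _ it); apply: jump_time_mono; rewrite leqNgt; apply/negP => /nB.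
by rewrite -(mc_path mc it ti).
Qed.

Lemma hitting_time_none o B :
  (forall k, (jump_time k o < +oo)%E -> ~ B (Z k o)) ->
  hitting_time X B o = +oo%E.
Proof.
move=> nB; apply/eqP; rewrite -leye_eq; apply/ereal_infP => _ [t [t0 Bt] <-].
have [i /andP[it ti]] := jump_slot o t0.
case: (nB i); first exact: le_lt_trans it (ltry _).
by rewrite -(mc_path mc it ti).
Qed.

Lemma return_time_slot o A (t : R) : (first_jump_time X o < t%:E)%E ->
  A (X t o) -> exists2 k, (0 < k)%N /\ (jump_time k o <= t%:E)%E & A (Z k o).
Proof.
rewrite first_jump_timeE => t1 At.
have t0 : 0 <= t.
  by rewrite -lee_fin; apply: le_trans (ltW t1); exact: jump_time_ge0.
have [i /andP[it ti]] := jump_slot o t0.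
exists i; last by rewrite -(mc_path mc it ti).
split=> //; rewrite lt0n; apply/eqP => i0; move: ti; rewrite i0.
by rewrite ltNge (ltW t1).
Qed.

Lemma return_time_ge o A : (jump_time 1 o <= return_time X A o)%E.
Proof.
by apply/ereal_infP => _ [t [t1 At] <-]; move: t1; rewrite first_jump_timeE => /ltW.
Qed.

(** The return time is an infimum over [t] strictly after the first jump; when
    [k = 1] the jump time itself is excluded, hence the approximation from
    above inside the [k]-th holding interval. *)
Lemma return_time_some o A k : (0 < k)%N -> (jump_time k o < +oo)%E ->
  A (Z k o) -> (forall j, (0 < j)%N -> (j < k)%N -> ~ A (Z j o)) ->
  return_time X A o = jump_time k o.
Proof.
move=> k0 koo Ak nA; have fin : jump_time k o \is a fin_num.
  by rewrite ge0_fin_numE // jump_time_ge0.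
apply/eqP; rewrite eq_le; apply/andP; split; last first.
  apply/ereal_infP => _ [t [t1 At] <-].
  have [i [i0 it] Ai] := return_time_slot t1 At.
  apply: (le_trans _ it); apply: jump_time_mono; rewrite leqNgt; apply/negP => ik.
  exact: nA Ai.
apply/lee_addgt0Pr => e e0.
have lt1 := jump_time_ltS koo.
have [t /andP[kt tk] te] : exists2 t : R,
    (jump_time k o < t%:E < jump_time k.+1 o)%E & (t%:E <= jump_time k o + e%:E)%E.
  case: (leP (jump_time k.+1 o) (jump_time k o + e%:E)%E) => [h|h].
    have fin' : jump_time k.+1 o \is a fin_num.
      rewrite ge0_fin_numE ?jump_time_ge0 //; apply: le_lt_trans h _.
      by rewrite lte_add_pinfty ?ltry.
    move: h lt1; rewrite -(fineK fin) -(fineK fin') -EFinD lee_fin !lte_fin.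
    set a := fine _; set b := fine _ => ab ba.
    exists ((a + b) / 2); rewrite ?lte_fin ?lee_fin; first by apply/andP; lra.
    by lra.
  exists (fine (jump_time k o) + e); rewrite EFinD fineK //.
  by rewrite h andbT lteDl.
apply: le_trans te; apply: ereal_inf_lbound; exists t => //; split.
  rewrite first_jump_timeE; apply: le_lt_trans kt; exact: jump_time_mono.
by rewrite (mc_path mc (ltW kt) tk).
Qed.

Lemma return_time_none o A :
  (forall k, (0 < k)%N -> (jump_time k o < +oo)%E -> ~ A (Z k o)) ->
  return_time X A o = +oo%E.
Proof.
move=> nA; apply/eqP; rewrite -leye_eq; apply/ereal_infP => _ [t [t1 At] <-].
have [i [i0 it] Ai] := return_time_slot t1 At.
case: (nA i i0) => //; exact: le_lt_trans it (ltry _).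
Qed.

Definition first_return_at A y o := exists2 k, (0 < k)%N &
  [/\ (jump_time k o < +oo)%E, Z k o = y
    & forall j, (0 < j)%N -> (j < k)%N -> ~ A (Z j o)].

Definition no_return A o :=
  forall k, (0 < k)%N -> (jump_time k o < +oo)%E -> ~ A (Z k o).

(** Both times are infinite when [A] is never revisited; this null event has to be
    carried along in the pathwise description.  A start at [y] is excluded since the
    hitting time is then 0. *)
Lemma hitting_eq_returnP A y o : A y ->
  hitting_time X [set y] o = return_time X A o <->
  Z 0 o <> y /\ (first_return_at A y o \/ no_return A o).
Proof.
move=> Ay; have [Z0y|Z0y] := pselect (Z 0 o = y).
  split=> [HR|[//]]; exfalso.
  have /eqP := HR; rewrite (@hitting_time_some _ _ 0) ?jump_time0 //.
  apply/negP; rewrite lt_eqF //; apply: lt_le_trans (return_time_ge _ _).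
  by rewrite jump_timeS jump_time0 add0e (mc_hold_gt0 mc).
pose Q k := `[< [/\ (0 < k)%N, (jump_time k o < +oo)%E & A (Z k o)] >].
have [exK|nK] := pselect (exists k, Q k); last first.
  have nr : no_return A o.
    by move=> k k0 koo Ak; apply: nK; exists k; apply/asboolP.
  split=> _; first by split=> //; right.
  rewrite return_time_none // hitting_time_none // => -[|k] koo //= Zk.
  by apply: (nr k.+1) => //; rewrite Zk.
case: (ex_minnP exK) => K /asboolP[K0 Koo AK] Kmin.
have nA j : (0 < j)%N -> (j < K)%N -> ~ A (Z j o).
  move=> j0 jK Aj; have : (K <= j)%N.
    apply: Kmin; apply/asboolP; split=> //.
    exact: le_lt_trans (jump_time_mono _ (ltnW jK)) Koo.
  by rewrite leqNgt jK.
rewrite (return_time_some K0 Koo AK nA).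
have [ZKy|ZKy] := pselect (Z K o = y).
  split=> _; first by split=> //; left; exists K.
  apply: hitting_time_some => // j jK /= Zjy.
  case: j jK Zjy => [//|j] jK Zjy; apply: (nA j.+1) => //; by rewrite Zjy.
split=> [HR|[_ [[k k0 [koo Zk nAk]]|nr]]]; exfalso; last exact: nr AK.
  pose Q' k := `[< (jump_time k o < +oo)%E /\ Z k o = y >].
  have [exJ|nJ] := pselect (exists k, Q' k); last first.
    move: HR Koo; rewrite hitting_time_none => [<-|k koo Zk].
      by rewrite ltxx.
    by apply: nJ; exists k; apply/asboolP.
  case: (ex_minnP exJ) => J /asboolP[Joo ZJ] Jmin.
  have JK : hitting_time X [set y] o = jump_time J o.
    apply: hitting_time_some => // j jJ /= Zj.
    have : (J <= j)%N.
      apply: Jmin; apply/asboolP; split=> //.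
      exact: le_lt_trans (jump_time_mono _ (ltnW jJ)) Joo.
    by rewrite leqNgt jJ.
  case: (ltngtP J K) => [JltK|KltJ|JeqK]; last by rewrite -JeqK in ZKy.
    by have := jump_time_lt JltK Joo; rewrite -JK HR ltxx.
  by have := jump_time_lt KltJ Koo; rewrite -JK HR ltxx.
case: (ltngtP k K) => [kK|Kk|kK]; last by rewrite -kK in ZKy.
  by apply: (nA k) => //; rewrite Zk.
exact: nAk Kk AK.
Qed.

End Paths.

(** * Cylinder probabilities *)

Section Cylinders.
Context {R : realType} {T : choiceType} {disp : measure_display}
  {Omega : measurableType disp}.
Variables (E : set T) (r : T -> T -> R) (X : R -> Omega -> T)
  (P : T -> probability Omega R) (Z : nat -> Omega -> T)
  (S : nat -> Omega -> \bar R).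
Hypothesis mc : is_markov_chain_with E r X P Z S.
Hypothesis finE : finite_set E.
Variables (A : set T) (x : T).
Hypothesis (Ex : E x) (AE : A `<=` E).

Local Notation s := (finmap.enum_fset (fset_set E)).

Lemma in_enum z : (z \in s) = (z \in E).
Proof. by rewrite -[RHS](in_fset_set finE). Qed.

Let mZ k z : measurable [set o | Z k o = z] := mc_meas_state mc k z.

Lemma meas_state_in k (B : set T) : measurable [set o | B (Z k o)].
Proof.
have -> : [set o | B (Z k o)] = \bigcup_(z in E `&` B) [set o | Z k o = z].
  apply/seteqP; split=> [ o /= Bo|o [z [_ Bz] /= Zo]]; last by rewrite Zo.
  by exists (Z k o) => //; split=> //; exact: (mc_state mc).
by apply: fin_bigcup_measurable => //; exact: finite_setIl.
Qed.

Lemma split_state (B : set Omega) k (v : T -> R) : measurable B ->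
  (forall z, E z -> P x (B `&` [set o | Z k o = z]) = (v z)%:E) ->
  P x B = (\sum_(z <- s) v z)%:E.
Proof.
move=> mB Pv.
have {1}-> : B = \bigcup_(z in E) (B `&` [set o | Z k o = z]).
  rewrite -setI_bigcupr; apply/seteqP; split=> [ o Bo|o [//]].
  by split=> //; exists (Z k o) => //; exact: (mc_state mc).
rewrite measure_fin_bigcup //; first last.
- by move=> z _; exact: measurableI.
- by move=> z w _ _ [ o [[_ /= <-] [_ /= <-]]].
rewrite fsbig_finite //= -sumEFin big_seq [RHS]big_seq; apply: eq_bigr => z.
by rewrite in_enum => /set_mem; exact: Pv.
Qed.

Definition cyl (l : seq T) : set Omega :=
  [set o | forall i, (i < size l)%N -> Z i o = nth x l i].

Lemma meas_all (F : nat -> set Omega) (D : nat -> Prop) :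
  (forall i, measurable (F i)) -> measurable [set o | forall i, D i -> F i o].
Proof.
move=> mF; have -> : [set o | forall i, D i -> F i o] = \bigcap_(i in D) F i.
  by apply/seteqP; split=> o Fo i; exact: Fo.
exact: bigcap_measurableType.
Qed.

Lemma meas_ex (F : nat -> set Omega) (D : nat -> Prop) :
  (forall i, measurable (F i)) -> measurable [set o | exists2 i, D i & F i o].
Proof. by move=> mF; exact: bigcup_measurable. Qed.

Lemma meas_cyl l : measurable (cyl l).
Proof. by apply: meas_all => i; exact: mZ. Qed.

Lemma cyl_rcons l z :
  cyl (rcons l z) = cyl l `&` [set o | Z (size l) o = z].
Proof.
apply/seteqP; split=> o.
  move=> Co; split=> [i il|/=].
    by have := Co i; rewrite size_rcons nth_rcons il => -> //; rewrite ltnS ltnW.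
  by have := Co (size l); rewrite size_rcons nth_rcons ltnn eqxx => ->.
move=> [Co /= Zz] i; rewrite size_rcons ltnS leq_eqVlt nth_rcons.
by move=> /predU1P[->|il]; [rewrite ltnn eqxx|rewrite il Co].
Qed.

Fixpoint weight (z : T) (l : seq T) : R :=
  if l is z' :: l' then jump_prob E r z z' * weight z' l' else 1.

Lemma weight_rcons z l z' :
  weight z (rcons l z') = weight z l * jump_prob E r (last z l) z'.
Proof. by elim: l z => [|a l IH] z /=; rewrite ?mulr1 ?mul1r // IH mulrA. Qed.

Lemma weightE z l :
  weight z l = \prod_(i < size l) jump_prob E r (nth x (z :: l) i) (nth x (z :: l) i.+1).
Proof. by elim: l z => [|a l IH] z /=; rewrite ?big_ord0 // big_ord_recl IH. Qed.

Lemma cyl_prob l : (forall z, z \in l -> E z) -> P x (cyl (x :: l)) = (weight x l)%:E.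
Proof.
move=> lE.
have nE i : E (nth x (x :: l) i).
  case: (ltnP i (size (x :: l))) => il; last by rewrite nth_default.
  by have := mem_nth x il; rewrite inE => /predU1P[->|/lE].
have := mc_law mc Ex (size l) nE (fun=> lexx 0).
rewrite /= eqxx mul1r -weightE [X in _ * X]big1 ?mulr1; last first.
  by move=> i _; rewrite mulr0 oppr0 expR0.
move=> <-; congr (P x _); apply/seteqP; split=> o Co i il.
  by split; [exact: Co|exact: (mc_hold_gt0 mc)].
by have [] := Co i il.
Qed.

(** The first visit to [A] at or after step [m] is at [y], and it happens among the
    next [k] steps. *)
Definition hits_at y m k : set Omega :=
  [set o | exists2 i, (m <= i)%N /\ (i < m + k)%N &
    Z i o = y /\ forall j, (m <= j)%N /\ (j < i)%N -> ~ A (Z j o)].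

Definition avoids m k : set Omega :=
  [set o | forall j, (m <= j)%N /\ (j < m + k)%N -> ~ A (Z j o)].

Lemma meas_avoids m k : measurable (avoids m k).
Proof.
apply: (@meas_all (fun j => [set o | ~ A (Z j o)])) => j.
by apply: measurableC; exact: meas_state_in.
Qed.

Lemma meas_hits_at y m k : measurable (hits_at y m k).
Proof.
apply: (@meas_ex (fun i => [set o | Z i o = y] `&`
   [set o | forall j, (m <= j)%N /\ (j < i)%N -> ~ A (Z j o)])) => i.
apply: measurableI => //.
apply: (@meas_all (fun j => [set o | ~ A (Z j o)])) => j.
by apply: measurableC; exact: meas_state_in.
Qed.

Local Notation p := (jump_prob E r).
Local Notation inA := (fun z => `[< A z >]).

Lemma rcons_mem (l : seq T) z : (forall w, w \in l -> E w) -> E z ->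
  forall w, w \in rcons l z -> E w.
Proof. by move=> lE Ez w; rewrite mem_rcons inE => /predU1P[->|/lE]. Qed.

(** Induction on [k], for all prefixes [l] at once: condition on the next state and
    append it to the prefix. *)
Lemma hits_at_prob y k l : A y -> (forall z, z \in l -> E z) ->
  P x (cyl (x :: l) `&` hits_at y (size l).+1 k) =
  (weight x l * hit_by s p inA y k (last x l))%:E.
Proof.
move=> Ay; elim: k l => [|k IH] l lE.
  rewrite mulr0 (_ : _ `&` _ = set0) ?measure0 //.
  apply/seteqP; split=> // o [_ [i [mi]]]; rewrite addn0 => im.
  by move: (leq_trans im mi); rewrite ltnn.
rewrite (split_state (k := (size l).+1) (v := fun z => weight x l * (p (last x l) z *
   (if inA z then (z == y)%:R else hit_by s p inA y k z)))).
- congr EFin; rewrite -mulr_sumr; congr (_ * _) => /=.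
  rewrite (bigID inA) /= /killed; congr (_ + _); last first.
    by apply: eq_bigr => z /negbTE ->.
  have ys : y \in s by rewrite in_enum; apply/mem_set/AE.
  rewrite (bigD1_seq_cond _ ys) /= ?finmap.fset_uniq //; last exact/asboolP.
  have -> : inA y by exact/asboolP.
  rewrite eqxx mulr1 big1 ?addr0 // => z /andP[-> /negbTE ->].
  by rewrite mulr0.
- by apply: measurableI; [exact: meas_cyl|exact: meas_hits_at].
move=> z Ez; case: asboolP => Az.
  have [zy|zy] := eqVneq z y; last first.
    rewrite !mulr0 (_ : _ `&` _ = set0) ?measure0 //.
    apply/seteqP; split=> // o [[_ [i [mi _] [Zi nA]]] /= Zm].
    case: (ltnP (size l).+1 i) => im.
      by apply: (nA (size l).+1); rewrite ?im ?leqnn // Zm.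
    have ei : i = (size l).+1 by apply/eqP; rewrite eqn_leq im mi.
    by move: Zi; rewrite ei Zm => /eqP; rewrite (negbTE zy).
  rewrite mulr1 -weight_rcons -cyl_prob; last exact: rcons_mem.
  congr (P x _); rewrite -rcons_cons cyl_rcons /= -setIA zy.
  apply/seteqP; split=> o [Co /=]; first by case.
  move=> Zm; split=> //; split=> //; exists (size l).+1.
    by rewrite leqnn addnS ltnS leq_addr.
  by split=> // j [mj]; rewrite ltnNge mj.
rewrite mulrA -weight_rcons.
have := IH (rcons l z) (rcons_mem lE Ez).
rewrite last_rcons size_rcons => <-; congr (P x _).
rewrite -rcons_cons cyl_rcons /=.
apply/seteqP; split=> o.
  move=> [[Co [i [mi im] [Zi nA]]] /= Zm]; split=> //.
  have im' : ((size l).+1 < i)%N.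
    rewrite ltn_neqAle mi andbT; apply/eqP => ei; apply: Az.
    by rewrite -Zm ei Zi.
  exists i; first by rewrite im' addSnnS.
  by split=> // j [mj ji]; apply: nA; rewrite ji (ltnW mj).
move=> [[Co /= Zm] [i [mi im] [Zi nA]]]; split=> //; split=> //.
exists i; first by rewrite (ltnW mi) -addSnnS.
split=> // j [mj ji]; have [ej|nj] := eqVneq j (size l).+1.
  by rewrite ej Zm.
by apply: nA; rewrite ji ltn_neqAle eq_sym nj mj.
Qed.

Lemma avoids_prob k l : (forall z, z \in l -> E z) ->
  P x (cyl (x :: l) `&` avoids (size l).+1 k) =
  (weight x l * surv s p inA k (last x l))%:E.
Proof.
elim: k l => [|k IH] l lE.
  rewrite mulr1 -cyl_prob //; congr (P x _); apply/seteqP; split=> [ o []//|o Co].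
  by split=> // j [mj]; rewrite addn0 ltnNge mj.
rewrite (split_state (k := (size l).+1) (v := fun z => weight x l * (p (last x l) z *
   (if inA z then 0 else surv s p inA k z)))).
- congr EFin; rewrite -mulr_sumr; congr (_ * _) => /=.
  rewrite (bigID inA) /= /killed big1 ?add0r; last first.
    by move=> z ->; rewrite mulr0.
  by apply: eq_bigr => z /negbTE ->.
- by apply: measurableI; [exact: meas_cyl|exact: meas_avoids].
move=> z Ez; case: asboolP => Az.
  rewrite !mulr0 (_ : _ `&` _ = set0) ?measure0 //.
  apply/seteqP; split=> // o [[_ nA] /= Zm].
  by apply: (nA (size l).+1); rewrite ?leqnn ?addnS ?ltnS ?leq_addr // Zm.
rewrite mulrA -weight_rcons.
have := IH (rcons l z) (rcons_mem lE Ez).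
rewrite last_rcons size_rcons => <-; congr (P x _).
rewrite -rcons_cons cyl_rcons /=.
apply/seteqP; split=> o.
  move=> [[Co nA] /= Zm]; split=> // j [mj jm].
  by apply: nA; rewrite (ltnW mj) -addSnnS.
move=> [[Co /= Zm] nA]; split=> //; split=> // j [mj jm].
have [ej|nj] := eqVneq j (size l).+1; first by rewrite ej Zm.
by apply: nA; rewrite ltn_neqAle eq_sym nj mj addSnnS.
Qed.

End Cylinders.

(** * Trace rates from hitting probabilities *)

Section TraceRate.
Context {R : realType} {T : choiceType} {disp : measure_display}
  {Omega : measurableType disp}.
Variables (E : set T) (r : T -> T -> R) (X : R -> Omega -> T)
  (P : T -> probability Omega R).
Hypothesis finE : finite_set E.
Local Notation s := (finmap.enum_fset (fset_set E)).
Hypotheses (r_ge0 : forall x y, x \in s -> y \in s -> 0 <= r x y)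
  (r_irr : sirr s r)
  (hold_gt0 : forall x, x \in s -> 0 < \sum_(y <- s) r x y).
Variables (A : set T) (x y : T).
Hypotheses (AE : A `<=` E) (Ex : E x) (Ay : A y) (xy : x <> y).
Local Notation inA := (fun z => `[< A z >]).

Let xs : x \in s. Proof. by rewrite in_enum //; exact/mem_set. Qed.
Let ys : y \in s. Proof. by rewrite in_enum //; exact/mem_set/AE. Qed.

Let holdE z : holding_rate E r z = \sum_(w <- s) r z w.
Proof. by rewrite /holding_rate fsbig_finite. Qed.

Let jump_probE z w : z \in s -> jump_prob E r z w = jumpp s r z w.
Proof. by move=> zs; rewrite /jump_prob holdE gt_eqF ?hold_gt0. Qed.

Let killedE f g z : z \in s -> (forall w, w \in s -> f w = g w) ->
  killed s (jump_prob E r) inA f z = killed s (jumpp s r) inA g z.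
Proof.
move=> zs fg; rewrite /killed big_seq_cond [RHS]big_seq_cond.
by apply: eq_bigr => w /andP[ws _]; rewrite jump_probE // fg.
Qed.

Let hit_byE k z : z \in s ->
  hit_by s (jump_prob E r) inA y k z = hit_by s (jumpp s r) inA y k z.
Proof.
elim: k z => // k IH z zs; rewrite /= jump_probE //; congr (_ + _).
exact: killedE.
Qed.

Let survE k z : z \in s ->
  surv s (jump_prob E r) inA k z = surv s (jumpp s r) inA k z.
Proof. by elim: k z => // k IH z zs /=; exact: killedE. Qed.

Let jp_ge0 z w : z \in s -> w \in s -> 0 <= jumpp s r z w.
Proof. by move=> zs ws; rewrite divr_ge0 ?r_ge0 // ltW // hold_gt0. Qed.

Let jp_sum z : z \in s -> \sum_(w <- s) jumpp s r z w = 1.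
Proof. by move=> zs; rewrite -mulr_suml divff // gt_eqF // hold_gt0. Qed.

Section WithChain.
Variables (Z : nat -> Omega -> T) (S : nat -> Omega -> \bar R).
Hypothesis mc : is_markov_chain_with E r X P Z S.

Lemma null_sandwich (B C D : set Omega) : measurable B -> measurable C ->
  measurable D -> P x D = 0%E -> B `\` D `<=` C -> C `\` D `<=` B ->
  P x B = P x C.
Proof.
have half (B' C' : set Omega) : measurable B' -> measurable C' ->
    measurable D -> P x D = 0%E -> B' `\` D `<=` C' -> (P x B' <= P x C')%E.
  move=> mB mC mD D0 BC; rewrite -(measureU0 mC mD D0).
  apply: le_measure; rewrite ?inE //; first exact: measurableU.
  by move=> o Bo; have [Do|nDo] := pselect (D o); [right|left; apply: BC].
by move=> *; apply/eqP; rewrite eq_le !half.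
Qed.

Lemma start_null : P x [set o | Z 0 o <> x] = 0%E.
Proof.
have mZx : measurable [set o | Z 0 o = x] by exact: (mc_meas_state mc).
have -> : [set o | Z 0 o <> x] = ~` [set o | Z 0 o = x] by [].
rewrite probability_setC //.
have := cyl_prob mc Ex (l := [::]) (fun z => ltac:(by [])).
have -> : cyl Z x [:: x] = [set o | Z 0 o = x].
  by apply/seteqP; split=> [ o Co|o Zo [|i]//]; exact: (Co 0).
by move=> /= ->; rewrite subee.
Qed.

Lemma meas_alive i : measurable [set o | S i o = +oo%E].
Proof.
have -> : [set o | S i o = +oo%E] = \bigcap_k [set o | (k%:R%:E < S i o)%E].
  apply/seteqP; split=> o /=; first by move=> So k _ /=; rewrite So ltry.
  move=> h; apply/eqyP => e _; have e0 := archi_boundP (normr_ge0 e).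
  apply: le_trans (ltW (h (Num.bound `|e|) I)).
  by rewrite lee_fin; apply: ltW; apply: le_lt_trans (ler_norm _) e0.
by apply: bigcap_measurableType => k _; exact: (mc_meas_hold mc).
Qed.

(** An infinite holding time at a state of positive holding rate [h] has probability
    at most [expR (- h * t)] for every [t].  The law of the chain is known on
    cylinders, so one first sums over the states visited before. *)
Lemma dead_null i : P x [set o | S i o = +oo%E] = 0%E.
Proof.
suff key k l : (forall z, z \in l -> E z) -> (size l + k)%N = i ->
    P x (cyl Z x (x :: l) `&` [set o | S i o = +oo%E]) = 0%E.
  rewrite -(key i [::]) //; apply/esym/null_sandwich.
  - by apply: measurableI; [exact: (meas_cyl mc)|exact: meas_alive].
  - exact: meas_alive.
  - exact: (measurableC (mc_meas_state mc 0 x)).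
  - exact: start_null.
  - by move=> o [[]].
  move=> o [/= So Z0]; split=> // -[|j] // _ /=; exact: contrapT.
elim: k l => [|k IH] l lE; last first.
  move=> sz; rewrite (split_state (k := (size l).+1) mc finE (v := fun=> 0)).
  - by rewrite big1.
  - by apply: measurableI; [exact: (meas_cyl mc)|exact: meas_alive].
  move=> z Ez; rewrite -[RHS](IH (rcons l z)); first last.
  - by rewrite size_rcons addSnnS.
  - exact: rcons_mem.
  by rewrite -rcons_cons cyl_rcons setIAC.
rewrite addn0 => sz.
set z := last x l.
have nE j : E (nth x (x :: l) j).
  case: (ltnP j (size (x :: l))) => jl; last by rewrite nth_default.
  by have := mem_nth x jl; rewrite inE => /predU1P[->|/lE].
have zs : z \in s.
  by rewrite in_enum //; apply/mem_set; rewrite /z (last_nth x).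
have lz : 0 < holding_rate E r z by rewrite holdE hold_gt0.
apply/eqP; rewrite eq_le measure_ge0 andbT.
apply/lee_addgt0Pr => e e0; rewrite add0e.
set h := holding_rate E r z in lz.
(* this [t] gives [expR (- h * t) <= e] *)
pose t := `|ln e| / h.
have t0 : 0 <= t by rewrite divr_ge0 // ltW.
have := mc_law mc Ex i nE (s := fun j => if j == i then t else 0).
move=> law.
apply: (@le_trans _ _ (expR (- (h * t)))%:E); last first.
  rewrite /t mulrC divfK ?gt_eqF // lee_fin -[leRHS](lnK (x := e)) ?posrE //.
  by rewrite ler_expR lerNl -normrN; exact: ler_norm.
apply: (@le_trans _ _ (P x [set o | forall j, (j <= i)%N ->
    Z j o = nth x (x :: l) j /\
   ((if j == i then t else 0)%:E < S j o)%E])).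
  apply: le_measure; rewrite ?inE.
  - by apply: measurableI; [exact: (meas_cyl mc)|exact: meas_alive].
  - apply: (@meas_all _ _ (fun j => [set o | Z j o = nth x (x :: l) j] `&`
      [set o | ((if j == i then t else 0)%:E < S j o)%E]) (fun j => (j <= i)%N)).
    by move=> j; apply: measurableI; [exact: (mc_meas_state mc)|exact: (mc_meas_hold mc)].
  move=> o [Co /= So] j ji; split; first by apply: Co; rewrite /= ltnS sz.
  by case: eqP => [->|_]; [rewrite So ltry|exact: (mc_hold_gt0 mc)].
rewrite law; last by move=> j; case: eqP.
rewrite lee_fin; apply: (@le_trans _ _ (1 * expR (- (h * t)))); last by rewrite mul1r.
apply: ler_pM.
- rewrite mulr_ge0 ?ler0n // prodr_ge0 // => j _.
  by rewrite jump_probE ?jp_ge0 // in_enum //; exact/mem_set.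
- by rewrite prodr_ge0 // => j _; exact: expR_ge0.
- have jp01 (j : nat) : 0 <= jump_prob E r (nth x (x :: l) j) (nth x (x :: l) j.+1) <= 1.
    have js : nth x (x :: l) j \in s by rewrite in_enum //; exact/mem_set.
    have js' : nth x (x :: l) j.+1 \in s by rewrite in_enum //; exact/mem_set.
    rewrite jump_probE // jp_ge0 //= -(jp_sum js) (bigD1_seq _ js') /=; last first.
      exact: finmap.fset_uniq.
    by rewrite lerDl big_seq_cond sumr_ge0 // => w /andP[ws _]; rewrite jp_ge0.
  apply: mulr_ile1; rewrite ?ler0n ?prodr_ge0 //.
  - by move=> j _; have /andP[] := jp01 j.
  - by case: (_ == _).
  - by apply: prodr_ile1 => j _; exact: jp01.
rewrite big_ord_recr /= eqxx big1 ?mul1r.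
  by rewrite -sz -last_nth.
by move=> j _; rewrite ltn_eqF // mulr0 oppr0 expR0.
Qed.

Definition null_event : set Omega := [set o | Z 0 o <> x] `|`
  (\bigcup_i [set o | S i o = +oo%E] `|`
   [set o | forall k, (0 < k)%N -> ~ A (Z k o)]).

Lemma meas_never : measurable [set o | forall k, (0 < k)%N -> ~ A (Z k o)].
Proof.
apply: (@meas_all _ _ (fun j => [set o | ~ A (Z j o)])) => j.
by apply: measurableC; exact: (meas_state_in mc).
Qed.

Lemma meas_null_event : measurable null_event.
Proof.
apply: measurableU; first exact: (measurableC (mc_meas_state mc 0 x)).
apply: measurableU; last exact: meas_never.
by apply: bigcup_measurable => i _; exact: meas_alive.
Qed.

(** The probability of avoiding [A] during [k] steps is the survival probability,
    which tends to 0. *)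
Lemma never_null : P x [set o | forall k, (0 < k)%N -> ~ A (Z k o)] = 0%E.
Proof.
apply/eqP; rewrite eq_le measure_ge0 andbT.
apply/lee_addgt0Pr => e e0; rewrite add0e.
have cv := surv_cvg0 jp_ge0 jp_sum (jumpp_irr r_irr hold_gt0)
  ys (A := inA) ltac:(exact/asboolP) xs.
have [k _ /(_ k (leqnn k)) /= ke] : \forall k \near \oo, surv s (jumpp s r) inA k x <= e.
  exact: (cvgr_le _ cv).
apply: (@le_trans _ _ (P x (avoids Z A 1 k))).
  apply: le_measure; rewrite ?inE; [exact: meas_never|exact: (meas_avoids mc)|].
  by move=> o h j [j1 _]; exact: h.
have := avoids_prob mc finE A Ex k (l := [::]) (fun z => ltac:(by [])).
rewrite /= mul1r survE // => h.
rewrite -(null_sandwich (D := [set o | Z 0 o <> x]) _ _ _ _ _ _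
  (B := cyl Z x [:: x] `&` avoids Z A 1 k)).
- by rewrite h lee_fin.
- by apply: measurableI; [exact: (meas_cyl mc)|exact: (meas_avoids mc)].
- exact: (meas_avoids mc).
- exact: (measurableC (mc_meas_state mc 0 x)).
- exact: start_null.
- by move=> o [[]].
move=> o [/= So Z0]; split=> // -[|j] // _ /=; exact: contrapT.
Qed.

Lemma null_event0 : P x null_event = 0%E.
Proof.
have neg B : measurable B -> P x B = 0%E -> (P x).-negligible B.
  by move=> mB B0; exists B; split.
apply/negligibleP; first exact: meas_null_event.
apply: negligibleU.
  apply: neg; [exact: (measurableC (mc_meas_state mc 0 x))|exact: start_null].
apply: negligibleU; last by apply: neg; [exact: meas_never|exact: never_null].
by apply: negligible_bigcup => i; apply: neg; [exact: meas_alive|exact: dead_null].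
Qed.

Definition returns_at : set Omega := \bigcup_k hits_at Z A y 1 k.

Lemma meas_returns_at : measurable returns_at.
Proof. by apply: bigcup_measurable => k _; exact: (meas_hits_at mc). Qed.

Lemma returns_at_prob : P x returns_at = (hit s (jumpp s r) inA y x)%:E.
Proof.
have hp k : P x (hits_at Z A y 1 k) = (hit_by s (jumpp s r) inA y k x)%:E.
  rewrite -(hit_byE k xs).
  have := hits_at_prob mc finE Ex AE k Ay (l := [::]) (fun z => ltac:(by [])).
  rewrite /= mul1r => <-; apply/esym/null_sandwich.
  - by apply: measurableI; [exact: (meas_cyl mc)|exact: (meas_hits_at mc)].
  - exact: (meas_hits_at mc).
  - exact: (measurableC (mc_meas_state mc 0 x)).
  - exact: start_null.
  - by move=> o [[]].
  move=> o [/= So Z0]; split=> // -[|j] // _ /=; exact: contrapT.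
have := nondecreasing_cvg_mu (mu := P x)
  (fun k => meas_hits_at mc finE A y 1 k) meas_returns_at.
have mono : {homo hits_at Z A y 1 : n m / (n <= m)%N >-> (n <= m)%O}.
  move=> n m nm; apply/subsetPset => o [i [i1 im] h]; exists i => //.
  by rewrite i1 (leq_trans im) // leq_add2l.
move=> /(_ mono) c1.
have c2 : (fun k => P x (hits_at Z A y 1 k)) @ \oo --> (hit s (jumpp s r) inA y x)%:E.
  under eq_fun do rewrite hp.
  apply: cvg_EFin; first exact: nearW.
  apply: (hit_cvg jp_ge0 jp_sum (finmap.fset_uniq _) ys) => //; exact/asboolP.
by rewrite -(cvg_lim _ c1) // -(cvg_lim _ c2).
Qed.

Lemma hitting_eq_return_prob :
  P x [set o | hitting_time X [set y] o = return_time X A o] =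
  (hit s (jumpp s r) inA y x)%:E.
Proof.
have Eeq : [set o | hitting_time X [set y] o = return_time X A o] =
   [set o | Z 0 o <> y] `&`
   ((\bigcup_(k in [set k | (0 < k)%N]) ([set o | (jump_time S k o < +oo)%E] `&`
     ([set o | Z k o = y] `&`
      [set o | forall j, (0 < j)%N /\ (j < k)%N -> ~ A (Z j o)]))) `|`
    [set o | forall k, (0 < k)%N -> ((jump_time S k o < +oo)%E -> ~ A (Z k o))]).
  apply/seteqP; split=> o /=.
    move/(hitting_eq_returnP mc o Ay) => [Z0 [[k k0 [koo Zk nA]]|nr]]; split=> //.
      by left; exists k => //; split=> //; split=> // j [j0 jk]; exact: nA.
    by right.
  move=> [Z0 h]; apply/(hitting_eq_returnP mc o Ay); split=> //.
  case: h => [[k k0 [koo [Zk nA]]]|nr]; [left|by right].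
  by exists k => //; split=> // j j0 jk; exact: nA.
have mT k : measurable [set o | (jump_time S k o < +oo)%E].
  have -> : [set o | (jump_time S k o < +oo)%E] =
      [set o | forall i, (i < k)%N -> (~` [set o | S i o = +oo%E]) o].
    apply/seteqP; split=> o /=.
      by move=> /(jump_time_ltoo mc) h i /h; rewrite ltey => /eqP.
    by move=> h; apply/(jump_time_ltoo mc) => i /h; rewrite ltey => /eqP.
  apply: (@meas_all _ _ (fun i => ~` [set o | S i o = +oo%E]) (fun i => (i < k)%N)).
  by move=> i; apply: measurableC; exact: meas_alive.
rewrite -returns_at_prob; apply: (null_sandwich (D := null_event)).
- rewrite Eeq; apply: measurableI.
    exact: (measurableC (mc_meas_state mc 0 y)).
  apply: measurableU.
    apply: bigcup_measurable => k _; apply: measurableI => //.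
    apply: measurableI; first exact: (mc_meas_state mc).
    apply: (@meas_all _ _ (fun j => [set o | ~ A (Z j o)])) => j.
    by apply: measurableC; exact: (meas_state_in mc).
  apply: (@meas_all _ _ (fun k => [set o | (jump_time S k o < +oo)%E ->
     ~ A (Z k o)]) (fun k => (0 < k)%N)) => k.
  have -> : [set o | (jump_time S k o < +oo)%E -> ~ A (Z k o)] =
     ~` [set o | (jump_time S k o < +oo)%E] `|` ~` [set o | A (Z k o)].
    apply/seteqP; split=> o /=; last by case.
    have [koo|koo] := pselect (jump_time S k o < +oo)%E; last by left.
    by move=> /(_ koo); right.
  by apply: measurableU; apply: measurableC => //; exact: (meas_state_in mc).
- exact: meas_returns_at.
- exact: meas_null_event.
- exact: null_event0.
- move=> o [/(hitting_eq_returnP mc o Ay) [Z0 h] nN].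
  case: h => [[k k0 [koo Zk nA]]|nr].
    exists k.+1 => //; exists k; first by rewrite k0 add1n ltnS leqnSn.
    by split=> // j [j0 jk]; exact: nA.
  exfalso; apply: nN; right.
  have [[i Si]|alive] := pselect (exists i, S i o = +oo%E).
    by left; exists i.
  right=> k k0; apply: nr => //; apply/(jump_time_ltoo mc) => i _.
  by rewrite ltey; apply/eqP => Si; apply: alive; exists i.
move=> o [[K _ [k [k0 _] [Zk nA]]] nN].
apply/(hitting_eq_returnP mc o Ay); split.
  move=> Z0; apply: nN; left => /= Z0x; apply: xy; by rewrite -Z0x.
left; exists k => //; split=> //; last by move=> j j0 jk; exact: nA.
apply/(jump_time_ltoo mc) => i _; rewrite ltey; apply/eqP => Si.
by apply: nN; right; left; exists i.
Qed.

End WithChain.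

(** Off a null event, the hitting time of [y] is the return time to [A] iff the first
    return to [A] is at [y], and this event has probability [hit]. *)
Lemma trace_rateE : is_markov_chain E r X P ->
  trace_rate E r X P A x y = strace s r inA x y.
Proof.
move=> [Z [S mc]]; rewrite /trace_rate (hitting_eq_return_prob mc) /=.
by rewrite holdE.
Qed.

End TraceRate.

(** * Geometry of the state space *)

Section StateSpaceGeometry.
Context {R : realType} {d : nat}.
Local Notation V := 'rV[R]_d.

Definition circle_dist (a b : R) : R := Num.min `|a - b| (1 - `|a - b|).

Lemma sum_sqr_lt (a : 'I_d -> R) (e : R) : 0 < e ->
  (forall j, `|a j| <= e / d.+1%:R) -> Num.sqrt (\sum_j a j ^+ 2) < e.
Proof.
move=> e0 ae; rewrite -(ltr_pXn2r (n := 2)) ?nnegrE ?sqrtr_ge0 ?ltW //.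
rewrite sqr_sqrtr ?sumr_ge0 // => [|j _]; last exact: sqr_ge0.
apply: (@le_lt_trans _ _ (\sum_(j < d) (e / d.+1%:R) ^+ 2)).
  apply: ler_sum => j _; rewrite -real_normK ?num_real //.
  by rewrite lerXn2r ?nnegrE ?divr_ge0 ?(ltW e0).
have -> : \sum_(j < d) (e / d.+1%:R) ^+ 2 = d%:R * e ^+ 2 / d.+1%:R ^+ 2.
  by rewrite sumr_const card_ord -(mulr_natl ((e / d.+1%:R) ^+ 2)) expr_div_n mulrA.
rewrite ltr_pdivrMr ?exprn_gt0 //.
rewrite mulrC ltr_pM2l ?exprn_gt0 // -natrX ltr_nat.
by rewrite expnS expn1; nia.
Qed.

Lemma coord_le_norm (a : 'I_d -> R) j : `|a j| <= Num.sqrt (\sum_i a i ^+ 2).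
Proof.
rewrite -sqrtr_sqr ler_wsqrtr // (bigD1 j) //= lerDl sumr_ge0 // => i _.
exact: sqr_ge0.
Qed.

Lemma coord_cvg_ball (I : Type) (F : set_system I) {FF : Filter F} (u : I -> V) (x : V) :
  (forall j, u i 0 j @[i --> F] --> x 0 j) -> u @ F --> x.
Proof.
move=> ux; apply/cvg_ballP => e e0; rewrite /ball /= /mx_ball.
have h : \forall i \near F, forall j, ball (x 0 j) e (u i 0 j).
  by apply: filter_forall => j; move/cvg_ballP : (ux j); exact.
by apply: filterS h => i h; split=> // k j; rewrite ord1.
Qed.

Lemma circle_ge0 a b : 0 <= a < 1 -> 0 <= b < 1 -> 0 <= circle_dist a b.
Proof.
move=> ha hb; rewrite le_min normr_ge0 /= subr_ge0 ler_norml; lra.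
Qed.

Lemma circle_sym a b : circle_dist a b = circle_dist b a.
Proof. by rewrite /circle_dist distrC. Qed.

Lemma three_dist_le2 (a b c : R) : 0 <= a < 1 -> 0 <= b < 1 -> 0 <= c < 1 ->
  `|a - b| + `|b - c| + `|a - c| <= 2.
Proof.
have key (x y : R) : `|x - y| = x - y \/ `|x - y| = y - x.
  by have [h|h] := lerP 0 (x - y); [left; rewrite ger0_norm|right; rewrite ltr0_norm ?opprB].
move=> /andP[a0 a1] /andP[b0 b1] /andP[c0 c1].
by case: (key a b) => ->; case: (key b c) => ->;
  case: (key a c) => ->; move: {key} a0 a1 b0 b1 c0 c1; lra.
Qed.

(** Besides the triangle inequality of the line, going around the circle uses
    that three points of [[0, 1)] have mutual distances of total at most 2. *)
Lemma circle_triangle a b c : 0 <= a < 1 -> 0 <= b < 1 -> 0 <= c < 1 ->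
  circle_dist a c <= circle_dist a b + circle_dist b c.
Proof.
move=> ha hb hc; rewrite /circle_dist.
have t1 : `|a - c| <= `|a - b| + `|b - c| by apply: ler_distD.
have t2 : `|a - b| <= `|a - c| + `|b - c| by rewrite (distrC b c); apply: ler_distD.
have t3 : `|b - c| <= `|a - b| + `|a - c| by rewrite (distrC a b); apply: ler_distD.
have h4 : `|a - b| + `|b - c| + `|a - c| <= 2 by exact: three_dist_le2.
move: ha hb hc => _ _ _.
move: t1 t2 t3 h4; set u := `|a - c|; set v := `|a - b|; set w := `|b - c|.
move=> t1 t2 t3 t4; case: (leP v (1 - v)) => _; case: (leP w (1 - w)) => _;
rewrite ge_min; apply/orP; [left|right|right|left]; lra.
Qed.

(** The fundamental domain of the torus is half open: a coordinate that converges
    to 1 converges to 0 on the torus. *)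
Definition wrap (t : R) : R := if 1 <= t then 0 else t.

Lemma wrap_cvg (I : Type) (F : set_system I) {FF : ProperFilter F} (u : I -> R) (t e : R) :
  0 < e -> (\forall i \near F, 0 <= u i < 1) -> u i @[i --> F] --> t ->
  0 <= wrap t < 1 /\ \forall i \near F, `|circle_dist (wrap t) (u i)| <= e.
Proof.
move=> e0 u01 ut.
have t0 : 0 <= t by apply: (cvg_limit_ge ut); apply: filterS u01 => i /andP[].
have t1 : t <= 1 by apply: (cvg_limit_le ut); apply: filterS u01 => i /andP[_ /ltW].
have wt : 0 <= wrap t < 1 by rewrite /wrap; case: (lerP 1 t) => h; lra.
split=> //.
have near_t : \forall i \near F, `|t - u i| < e by move/cvgrPdist_lt : ut; exact.
near=> i.
have ui : 0 <= u i < 1 by near: i.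
have dti : `|t - u i| < e by near: i.
rewrite ger0_norm ?circle_ge0 //.
move: dti; rewrite /circle_dist /wrap ltr_norml => /andP[h1 h2].
case: (lerP 1 t) => ht; rewrite ge_min; apply/orP; [right|left].
  rewrite sub0r normrN ger0_norm; lra.
by rewrite ler_norml; lra.
Unshelve. all: by end_near. Qed.

Lemma measurable_wrap : measurable_fun [set: R] wrap.
Proof.
apply: measurable_fun_ifT.
- apply: measurable_realfun.measurable_fun_ler; [exact: measurable_cst|exact: measurable_id].
- exact: measurable_cst.
- exact: measurable_id.
Qed.

(** A common form of closedness for the two kinds of state space.  On the torus the
    limit point is obtained from the coordinatewise limit by wrapping, on a closed
    domain it is the coordinatewise limit itself; the map is measurable in both
    cases. *)
Lemma space_limit (Xi : space R d) : is_state_space Xi ->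
  exists2 k : R -> R, measurable_fun [set: R] k &
  forall (I : Type) (F : set_system I) (FF : ProperFilter F) (u : I -> V) (x : V),
    (\forall i \near F, carrier Xi (u i)) ->
    (forall j, u i 0 j @[i --> F] --> x 0 j) ->
    carrier Xi (\row_j k (x 0 j)) /\
    forall e, 0 < e -> \forall i \near F, sdist Xi (\row_j k (x 0 j)) (u i) < e.
Proof.
case=> [->|[U [oU bU ->]]].
  exists wrap; first exact: measurable_wrap.
  move=> I F FF u x cu ux; split=> [j|e e0] /=.
    rewrite mxE; apply: proj1 (wrap_cvg (e := 1) _ _ (ux j)) => //.
    by apply: filterS cu => i; exact.
  have h : \forall i \near F, forall j,
      `|circle_dist (wrap (x 0 j)) (u i 0 j)| <= e / d.+1%:R.
    apply: filter_forall => j; apply: proj2 (wrap_cvg _ _ (ux j)).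
      by rewrite divr_gt0.
    by apply: filterS cu => i; exact.
  apply: filterS h => i h; rewrite /torus_dist.
  by apply: sum_sqr_lt => // j; rewrite mxE; exact: h.
exists id; first exact: measurable_id.
move=> I F FF u x cu ux /=; have -> : \row_j x 0 j = x by apply/rowP => j; rewrite mxE.
split.
  apply: (closed_cvg (closure U) (@closed_closure _ U) cu).
  exact: coord_cvg_ball.
move=> e e0.
have h : \forall i \near F, forall j, `|x 0 j - u i 0 j| <= e / d.+1%:R.
  apply: filter_forall => j.
  have ed : 0 < e / d.+1%:R by rewrite divr_gt0.
  by move/cvgrPdist_le : (ux j); apply.
by apply: filterS h => i h; apply: sum_sqr_lt.
Qed.

Lemma space_bounded (Xi : space R d) : is_state_space Xi ->
  exists2 B : R, 0 < B & forall x, carrier Xi x -> forall j, `|x 0 j| <= B.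
Proof.
case=> [->|[U [oU bU ->]]] /=.
  by exists 1 => // x x01 j; have := x01 j; rewrite ler_norml; lra.
have [M [_ hM]] := bU.
exists (`|M| + 1); first by rewrite ltr_wpDl.
have hU : U `<=` [set x | `|x| <= `|M| + 1].
  by move=> x Ux; apply: hM => //; rewrite (le_lt_trans (ler_norm _)) ?ltrDl.
have cl : closed [set x : V | `|x| <= `|M| + 1].
  apply: (closed_comp (f := fun x : V => `|x|) (D := [set y | y <= `|M| + 1])).
    by move=> x _; exact: norm_continuous.
  exact: closed_le.
move=> x Ux j; apply: le_trans (_ : `|x| <= _).
  rewrite /Num.norm /= mx_normrE.
  by apply: le_trans (le_bigmax _ _ (0, j)) => //=.
by apply: cl; exact: (closure_subset hU Ux).
Qed.

End StateSpaceGeometry.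

(** * Weak convergence by test functions *)

Lemma cvg_initialP (S : choiceType) (T : topologicalType) (f : S -> T)
    (I : Type) (F : set_system I) {FF : Filter F} (u : I -> S) (s : S) :
  (u @ F --> (s : initial_topology f)) <-> (f \o u @ F --> f s).
Proof.
split=> [us|fus].
  apply: cvg_comp us _; exact: initial_continuous.
move=> A; rewrite nbhsE => -[_ [[C oC <-] Cs] CA].
apply: filterS CA _; apply: fus; rewrite nbhsE; exists C => //; split.
Qed.

Lemma cvg_ptwsP (U : eqType) (V : topologicalType) (I : Type)
    (F : set_system I) {FF : Filter F} (u : I -> {ptws U -> V})
    (v : {ptws U -> V}) :
  (u @ F --> v) <-> (forall t, u i t @[i --> F] --> v t).
Proof.
split=> [uv t|uv].
  by move/cvg_sup/(_ t)/cvg_initialP : uv.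
apply/cvg_sup => t; apply/cvg_initialP; exact: uv.
Qed.

Lemma cvg_probP (R : realType) (d : nat) (Xi : space R d) (I : Type)
    (F : set_system I) {FF : Filter F} (u : I -> prob Xi) (mu : prob Xi) :
  (u @ F --> mu) <->
  (forall f : test_fun Xi, test_integrals (u i) f @[i --> F] --> test_integrals mu f).
Proof.
split=> [/cvg_initialP/cvg_ptwsP//|h].
by apply/cvg_initialP/cvg_ptwsP.
Qed.

(** * Integrals of functions of finitely many values *)

Section FiniteRange.
Context {d : measure_display} {T : measurableType d} {R : realType}.
Variables (mu : probability T R) (D : set T) (S : finType) (c : T -> S).
Hypotheses (mD : measurable D)
  (mc : forall v, measurable (D `&` c @^-1` [set v])).

Lemma measurable_finite_range (g : S -> R) : measurable_fun D (g \o c).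
Proof.
move=> _ Y mY; have -> : D `&` (g \o c) @^-1` Y =
    \bigcup_(v in [set v | Y (g v)]) (D `&` c @^-1` [set v]).
  apply/seteqP; split=> [ x [Dx Yx]|x [v /= Yv [Dx cv]]].
    by exists (c x).
  by split=> //=; rewrite cv.
apply: fin_bigcup_measurable => [|v _]; last exact: mc.
exact: finite_finset.
Qed.

Lemma bounded_finite_range (g : S -> R) : [bounded (g \o c) x | x in D].
Proof.
exists (\sum_v `|g v|); split; first exact: num_real.
move=> M hM x Dx /=; apply: le_trans (ltW hM).
rewrite (bigD1 (c x)) //= lerDl sumr_ge0 // => v _; exact: normr_ge0.
Qed.

Lemma integrable_finite_range (g : S -> R) :
  mu.-integrable D (EFin \o (g \o c)).
Proof.
apply: measurable_bounded_integrable => //.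
- by rewrite (le_lt_trans (probability_le1 mu mD)) ?ltry.
- exact: measurable_finite_range.
- exact: bounded_finite_range.
Qed.

Lemma integral_finite_range (g : S -> R) :
  Rintegral mu D (g \o c) =
  \sum_v g v * fine (mu (D `&` c @^-1` [set v])).
Proof.
rewrite /Rintegral.
transitivity (fine (\sum_(v : S) (g v)%:E * mu (D `&` c @^-1` [set v]))%E).
  congr fine.
  have -> : (\int[mu]_(x in D) ((g \o c) x)%:E)%E =
     (\int[mu]_(x in D) (\sum_(v : S) (fun x => (g v)%:E * (\1_(D `&` c @^-1` [set v]) x)%:E) x))%E.
    apply: eq_integral => x /set_mem Dx.
    rewrite (bigD1 (c x)) //= big1 ?adde0.
      by rewrite indicE mem_set ?mule1.
    move=> v vc; rewrite indicE memNset ?mule0 // => -[_ /= cv].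
    by rewrite cv eqxx in vc.
  have int1 v : mu.-integrable D (fun x => (\1_(D `&` c @^-1` [set v]) x)%:E).
    apply: (@measurable_bounded_integrable _ _ _ mu (\1_(D `&` c @^-1` [set v]) : T -> R)) => //.
    - by rewrite (le_lt_trans (probability_le1 mu mD)) ?ltry.
    - exists 1; split; first exact: num_real.
      move=> M hM x _ /=; rewrite indicE; case: (_ \in _) => /=;
      by rewrite ?normr1 ?normr0 ltW // (lt_trans ltr01).
  rewrite integral_sum //; last by move=> v; exact: integrableZl.
  apply: eq_bigr => v _; rewrite integralZl // integral_indic //.
  by rewrite -setIA [X in _ `&` X]setIC setIA setIid.
rewrite (eq_bigr (fun v => (g v * fine (mu (D `&` c @^-1` [set v])))%:E)).
  by rewrite sumEFin.
by move=> v _; rewrite EFinM fineK // fin_num_measure.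
Qed.

(** Comparing with a function of finitely many values reduces an integral to finitely
    many masses. *)
Lemma integral_approx (f : T -> R) (g : S -> R) (e : R) :
  mu D = 1%E -> measurable_fun D f -> [bounded f x | x in D] ->
  (forall x, D x -> `|f x - g (c x)| <= e) ->
  `|Rintegral mu D f - \sum_v g v * fine (mu (D `&` c @^-1` [set v]))| <= e.
Proof.
move=> muD mf bf fg; rewrite -integral_finite_range.
have foo : (mu D < +oo)%E by rewrite muD ltry.
have If : mu.-integrable D (EFin \o f) by exact: measurable_bounded_integrable.
have Ig := integrable_finite_range g.
rewrite /= -RintegralB //.
apply: le_trans (le_normr_Rintegral _ _) _ => //.
  have := integrableB mD If Ig.
  by apply: eq_integrable => // x _; rewrite /= EFinB.
have -> : e = Rintegral mu D (fun=> e).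
  rewrite Rintegral_cst // [X in fine X](_ : _ = 1%E); last exact: muD.
  by rewrite mulr1.
apply: le_Rintegral => //.
- have := integrable_norm (integrableB mD If Ig).
  by apply: eq_integrable => // x _; rewrite /= EFinB.
- apply: measurable_bounded_integrable => //.
  exists `|e|; split; first exact: num_real.
  by move=> M hM x _; exact: ltW.
Qed.

End FiniteRange.

(** * Coding points by bits *)

Section BorelSets.
Context {R : realType} {d : nat}.
Local Notation V := 'rV[R]_d.

Lemma open_borel (A : set V) : open A -> measurable (A : set (borelV R d)).
Proof. by move=> oA; exact: sub_sigma_algebra. Qed.

Lemma closed_borel (A : set V) : closed A -> measurable (A : set (borelV R d)).
Proof.
move=> cA; rewrite -[A]setCK; apply: measurableC; apply: open_borel.
exact: closed_openC.
Qed.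

Lemma set1_borel (x : V) : measurable ([set x] : set (borelV R d)).
Proof.
apply: closed_borel; apply: accessible_closed_set1; apply: hausdorff_accessible.
exact: norm_hausdorff.
Qed.

Lemma coord_lt_borel j (q : R) :
  measurable ([set x | x 0 j < q] : set (borelV R d)).
Proof.
apply: open_borel; apply: (@open_comp _ _ (fun x : V => x 0 j) [set y | y < q]).
  by move=> x _; exact: coord_continuous.
exact: open_lt.
Qed.

(** Open sets are countable unions of boxes with rational centres, and boxes are
    finite intersections of coordinate conditions. *)
Lemma measurable_borelV (disp : measure_display) (Y : measurableType disp)
    (f : Y -> borelV R d) :
  (forall j, measurable_fun [set: Y] (fun y => (f y : V) 0 j)) ->
  measurable_fun [set: Y] f.
Proof.
move=> mf; apply: (measurability (fun A : set (borelV R d) => @open V A)) => //.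
move=> _ [W0 oW <-].
rewrite setTI.
pose box (c : 'rV[rat]_d * nat) : set V :=
  [set x : V | forall j, `|x 0 j - ratr (c.1 0 j)| < c.2.+1%:R^-1].
have -> : f @^-1` W0 =
    \bigcup_c (f @^-1` (if `[< box c `<=` W0 >] then box c else set0)).
  apply/seteqP; split=> y /=; last first.
    by move=> [c _] /=; case: asboolP => // cO /cO.
  move=> Oy; have := oW; rewrite openE => /(_ _ Oy).
  rewrite /interior => /nbhs_ballP[e /= e0 eO].
  have [n ne] : exists n : nat, 2 * n.+1%:R^-1 < e.
    have [n _ /(_ n (leqnn n)) /= hn] := near_infty_natSinv_lt (PosNum (divr_gt0 e0 (ltr0n R 2))).
    by exists n; move: hn => /=; rewrite ltr_pdivlMr // mulrC.
  have n0 : 0 < n.+1%:R^-1 :> R by rewrite invr_gt0.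
  have hc j : {q : rat | `|(f y : V) 0 j - ratr q| < n.+1%:R^-1}.
    apply: cid; have : (f y : V) 0 j - n.+1%:R^-1 < (f y : V) 0 j by rewrite ltrBlDr ltrDl.
    move=> /rat_in_itvoo [q]; rewrite in_itv /= => /andP[q1 q2]; exists q.
    move: q1 q2 n0; move: ((f y : V) 0 j) (n.+1%:R^-1) (ratr q) => t u w q1 q2 u0.
    rewrite ltr_norml; apply/andP; split; lra.
  pose c := (\row_j sval (hc j), n).
  have By : box c (f y) by move=> j; rewrite /= mxE; exact: svalP (hc j).
  exists c => //=; case: asboolP => // cO; exfalso; apply: cO => z Bz; apply: eO.
  rewrite /ball /= /mx_ball; split=> // i j; rewrite ord1 /ball /=.
  have := By j; have := Bz j; rewrite /= => h1 h2.
  apply: le_lt_trans (ler_distD (ratr (c.1 0 j)) _ _) _.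
  apply: lt_trans (_ : _ < n.+1%:R^-1 + n.+1%:R^-1) _; first by rewrite ltrD // distrC.
  by rewrite -mulr2n -(mulr_natl (n.+1%:R^-1)).
apply: countable_bigcupT_measurable => [|c]; first exact: countableP.
case: asboolP => _; last by rewrite preimage_set0.
have -> : f @^-1` (box c) = \bigcap_(j in [set: 'I_d])
   ((fun y => (f y : V) 0 j) @^-1` [set t | `|t - ratr (c.1 0 j)| < c.2.+1%:R^-1]).
  by apply/seteqP; split=> y h j; [move=> _|]; exact: h.
apply: fin_bigcap_measurable => // j _; rewrite -[X in measurable X]setTI.
apply: mf => //.
have -> : [set t : R | `|t - ratr (c.1 0 j)| < c.2.+1%:R^-1] =
   ball (ratr (c.1 0 j) : R) (c.2.+1%:R^-1).
  by apply/seteqP; split=> t /=; rewrite /ball /= distrC.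
exact: measurable_realfun.measurable_ball.
Qed.

Lemma carrier_borel (Xi : space R d) : is_state_space Xi ->
  measurable (carrier Xi : set (borelV R d)).
Proof.
case=> [->|[U [oU bU ->]]] /=; last by apply: closed_borel; exact: closed_closure.
have -> : [set x : V | forall i, 0 <= x 0 i < 1] =
   \bigcap_(i in [set: 'I_d]) (~` [set x : V | x 0 i < 0] `&` [set x : V | x 0 i < 1]).
  apply/seteqP; split=> x h i.
    by move=> _; have /andP[h1 h2] := h i; split=> //=; apply/negP; rewrite -leNgt.
  by have [//= /negP] := h i I; rewrite -leNgt => -> ->.
apply: fin_bigcap_measurable => // i _; apply: measurableI; last exact: coord_lt_borel.
by apply: measurableC; exact: coord_lt_borel.
Qed.

(** The bits of a point compare its coordinates with all rational numbers. *)
Definition bit (j : nat) (x : V) : bool :=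
  if unpickle j is Some (i, q) then x 0 (i : 'I_d) < ratr (q : rat) else false.

Definition code (k : nat) (x : V) : k.-tuple bool := [tuple bit j x | j < k].

Lemma bit_borel j (b : bool) : measurable ([set x | bit j x = b] : set (borelV R d)).
Proof.
have mt : measurable ([set x | bit j x] : set (borelV R d)).
  rewrite /bit; case: unpickle => [[i q]|]; first exact: coord_lt_borel.
  by rewrite (_ : [set x | _] = set0) //; apply/seteqP; split.
case: b => //; have -> : [set x | bit j x = false] = ~` [set x | bit j x].
  by apply/seteqP; split=> x /=; [move=> ->|move/negP/negbTE].
exact: measurableC.
Qed.

Lemma code_borel k (v : k.-tuple bool) :
  measurable (code k @^-1` [set v] : set (borelV R d)).
Proof.
have -> : code k @^-1` [set v] =
   \bigcap_(j in [set: 'I_k]) [set x | bit j x = tnth v j].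
  apply/seteqP; split=> x /=.
    by move=> <- j _ /=; rewrite tnth_mktuple.
  by move=> h; apply/eq_from_tnth => j; rewrite tnth_mktuple; exact: h.
by apply: fin_bigcap_measurable => // j _; exact: bit_borel.
Qed.

Lemma code_eq k x y : code k x = code k y ->
  forall j, (j < k)%N -> bit j x = bit j y.
Proof.
move=> xy j jk; have := congr1 (fun v => tnth v (Ordinal jk)) xy.
by rewrite !tnth_mktuple.
Qed.

(** A rational number between the two limits would give a bit on which the sequences
    eventually differ. *)
Lemma bits_lt_limit (F : set_system nat) {FF : ProperFilter F} (u v : nat -> V)
    (j : 'I_d) (a b : R) :
  (forall m, \forall k \near F, bit m (u k) = bit m (v k)) ->
  u k 0 j @[k --> F] --> a -> v k 0 j @[k --> F] --> b -> b <= a.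
Proof.
move=> uv ua vb; rewrite leNgt; apply/negP => /rat_in_itvoo[q].
rewrite in_itv /= => /andP[aq qb].
have h1 : \forall k \near F, u k 0 j < ratr q by exact: (cvgr_lt _ ua).
have h2 : \forall k \near F, ratr q < v k 0 j by exact: (cvgr_gt _ vb).
have [k [[h3 h4] h5]] := filter_ex (filterI (filterI h1 h2) (uv (pickle (j, q)))).
by move: h5; rewrite /bit pickleK h3 => /esym; rewrite ltNge (ltW h4).
Qed.

Lemma ultra_bounded_cvg (U : set_system nat) (UU : UltraFilter U) (a : nat -> R) B :
  (forall k, `|a k| <= B) -> exists l : R, a k @[k --> U] --> l.
Proof.
move=> aB.
have cl := @segment_compact R (- B) B.
have [|l [_ hl]] := cl (a @ U) _.
  apply: nearW => k; rewrite /= in_itv /= -ler_norml; exact: aB.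
exists l; move=> A Al.
have [//|UA] := in_ultra_setVsetC (a @^-1` A) UU.
have [t [/= nAt At]] := hl (~` A) A UA Al.
by [].
Qed.

(** Rational thresholds on both sides of an ultrafilter limit confine the sequence,
    because its bits are eventually constant. *)
Lemma bits_cvg (u : nat -> V) B :
  (forall k j, `|u k 0 j| <= B) ->
  (forall m, \forall k \near \oo, forall k', (k <= k')%N -> bit m (u k') = bit m (u k)) ->
  exists x : V, forall j, u k 0 j @[k --> \oo] --> x 0 j.
Proof.
move=> uB ub.
have [U [UU oU]] := ultraFilterLemma (eventually_filter : ProperFilter \oo).
have h j : {a : R | u k 0 j @[k --> U] --> a}.
  by apply: cid; apply: ultra_bounded_cvg => k; exact: uB.
exists (\row_j sval (h j)) => j; rewrite mxE; case: (h j) => a ua /=.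
apply/cvgrPdist_lt => e e0.
have [q1] : exists q : rat, ratr q \in `]a - e, a[ by apply: rat_in_itvoo; rewrite ltrBlDr ltrDl.
have [q2] : exists q : rat, ratr q \in `]a, a + e[ by apply: rat_in_itvoo; rewrite ltrDl.
rewrite !in_itv /= => /andP[aq2 q2e] /andP[eq1 q1a].
have [k1 _ hk1] := ub (pickle (j, q1)); have [k2 _ hk2] := ub (pickle (j, q2)).
pose K := maxn k1 k2.
have h1 : \forall k \near U, u k 0 j < ratr q2 by exact: (cvgr_lt _ ua).
have h2 : \forall k \near U, ratr q1 < u k 0 j by exact: (cvgr_gt _ ua).
have hK : \forall k \near U, (K <= k)%N by apply: oU; exists K.
have [k0 [[g1 g2] gK]] := filter_ex (filterI (filterI h1 h2) hK).
exists K => // k /= Kk.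
have b2 : bit (pickle (j, q2)) (u k) = bit (pickle (j, q2)) (u k0).
  have hh k' : (K <= k')%N -> bit (pickle (j, q2)) (u k') = bit (pickle (j, q2)) (u k2).
    by move=> Kk'; apply: (hk2 k2) => //=; rewrite (leq_trans _ Kk') ?leq_maxr.
  by rewrite hh // [RHS]hh.
have b1 : bit (pickle (j, q1)) (u k) = bit (pickle (j, q1)) (u k0).
  have hh k' : (K <= k')%N -> bit (pickle (j, q1)) (u k') = bit (pickle (j, q1)) (u k1).
    by move=> Kk'; apply: (hk1 k1) => //=; rewrite (leq_trans _ Kk') ?leq_maxl.
  by rewrite hh // [RHS]hh.
have c2 : u k 0 j < ratr q2 by move: b2; rewrite /bit pickleK g1.
have c1 : ratr q1 <= u k 0 j.
  by rewrite leNgt; move: b1; rewrite /bit pickleK (lt_gtF g2) => ->.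
move: c1 c2 aq2 q2e eq1 q1a; move: (u k 0 j) (ratr q1) (ratr q2) => b c c' *.
by rewrite ltr_norml; apply/andP; split; lra.
Qed.

Section TestFunctions.
Variable Xi : space R d.
Hypothesis Xi_ok : is_state_space Xi.

(** Compactness of the state space in disguise: points that agree on more and
    more bits have a common limit point, at which a test function is continuous. *)
Lemma test_fun_bits (f : test_fun Xi) e : 0 < e -> exists k, forall x y,
  carrier Xi x -> carrier Xi y -> code k x = code k y -> `|sval f x - sval f y| < e.
Proof.
move=> e0; apply: contrapT => nk.
have bad k : {xy : V * V | [/\ carrier Xi xy.1, carrier Xi xy.2, code k xy.1 = code k xy.2
     & e <= `|sval f xy.1 - sval f xy.2|]}.
  apply: cid; apply: contrapT => h; apply: nk; exists k => x y cx cy xy.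
  by rewrite ltNge; apply/negP => ef; apply: h; exists (x, y).
pose u k := (sval (bad k)).1; pose v k := (sval (bad k)).2.
have [U [UU oU]] := ultraFilterLemma (eventually_filter : ProperFilter \oo).
have [B B0 cB] := space_bounded Xi_ok.
have hu j : {a : R | u k 0 j @[k --> U] --> a}.
  apply: cid; apply: (@ultra_bounded_cvg U UU _ B) => k; apply: cB.
  by rewrite /u; case: (bad k) => xy [].
have hv j : {a : R | v k 0 j @[k --> U] --> a}.
  apply: cid; apply: (@ultra_bounded_cvg U UU _ B) => k; apply: cB.
  by rewrite /v; case: (bad k) => xy [].
have uvb m : \forall k \near U, bit m (u k) = bit m (v k).
  apply: oU; exists m.+1 => // k /= mk.
  by rewrite /u /v; case: (bad k) => xy [_ _ /code_eq h _] /=; exact: h.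
have huv j : sval (hu j) = sval (hv j).
  case: (hu j) => a ua; case: (hv j) => b vb /=.
  apply/eqP; rewrite eq_le; apply/andP; split.
    apply: (bits_lt_limit _ vb ua) => m.
    by apply: filterS (uvb m) => k ->.
  exact: (bits_lt_limit _ ua vb).
have [k _ klim] := space_limit Xi_ok.
pose x : V := \row_j sval (hu j).
have cu : \forall k \near U, carrier Xi (u k).
  by apply: nearW => i; rewrite /u; case: (bad i) => xy [].
have cv : \forall k \near U, carrier Xi (v k).
  by apply: nearW => i; rewrite /v; case: (bad i) => xy [].
have hux j : u i 0 j @[i --> U] --> x 0 j by rewrite mxE; exact: svalP (hu j).
have hvx j : v i 0 j @[i --> U] --> x 0 j by rewrite mxE huv; exact: svalP (hv j).
have [cx ux] := klim _ U _ u x cu hux.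
have [_ vx] := klim _ U _ v x cv hvx.
have [_ fc] := svalP f.
have e2 : 0 < e / 2 by rewrite divr_gt0.
have [dl dl0 hd] := fc _ cx _ e2.
have [i [[[h1 h2] h3] h4]] := filter_ex (filterI (filterI (filterI cu cv) (ux _ dl0)) (vx _ dl0)).
have f1 := hd _ h1 h3; have f2 := hd _ h2 h4.
have : e <= `|sval f (u i) - sval f (v i)| by rewrite /u /v; case: (bad i) => xy [].
rewrite leNgt => /negP; apply.
apply: le_lt_trans (ler_distD (sval f (\row_j k (x 0 j))) _ _) _.
rewrite [X in _ + X]distrC (splitr e); exact: ltrD.
Qed.

Lemma test_fun_bounded (f : test_fun Xi) :
  [bounded sval f x | x in (carrier Xi : set (borelV R d))].
Proof.
have [[K hK] _] := svalP f.
exists K; split; first exact: num_real.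
by move=> M KM x cx; exact: le_trans (hK _ cx) (ltW KM).
Qed.

Lemma test_fun_rep (f : test_fun Xi) e : 0 < e ->
  exists k (g : k.-tuple bool -> R), forall x, carrier Xi x ->
  `|sval f x - g (code k x)| <= e.
Proof.
move=> /(test_fun_bits f) [k hk].
pose g (v : k.-tuple bool) : R :=
  if pselect (exists2 x, carrier Xi x & code k x = v) is left h
  then sval f (sval (cid2 h)) else 0.
exists k, g => x cx; rewrite /g; case: pselect => [h|[]]; last by exists x.
by case: (cid2 h) => y cy cyx /=; apply/ltW/hk.
Qed.

Lemma test_fun_measurable (f : test_fun Xi) :
  measurable_fun (carrier Xi : set (borelV R d)) (sval f).
Proof.
have h n : {kg : {k & k.-tuple bool -> R} | forall x, carrier Xi x ->
    `|sval f x - projT2 kg (code (projT1 kg) x)| <= n.+1%:R^-1}.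
  apply: cid; have [|k [g kg]] := @test_fun_rep f n.+1%:R^-1; first by rewrite invr_gt0.
  by exists (existT _ k g).
apply: (@measurable_realfun.measurable_fun_cvg _ _ R (carrier Xi : set (borelV R d))
  (fun n (x : borelV R d) => projT2 (sval (h n)) (code (projT1 (sval (h n))) x))).
  move=> n; have mcode v : measurable ((carrier Xi : set (borelV R d)) `&`
      code (projT1 (sval (h n))) @^-1` [set v]).
    by apply: measurableI; [exact: carrier_borel|exact: code_borel].
  exact: (measurable_finite_range mcode (projT2 (sval (h n)))).
move=> x cx; apply/cvgrPdist_le => e e0.
have [N _ hN] := near_infty_natSinv_lt (PosNum e0).
exists N => // n /hN /= ne; apply: le_trans (ltW ne).
by case: (h n) => kg /= hkg; exact: hkg.
Qed.

End TestFunctions.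
End BorelSets.

(** * Splitting the unit interval according to prescribed masses *)

Section UnitMeasure.
Context {R : realType}.

(** Lebesgue measure on [[0, 1)], regarded as a probability on the line. *)
Definition unit_measure : set (measurableTypeR R) -> \bar R :=
  mrestr (@lebesgue_measure R) (measurable_itv `[(0 : R), 1[).

HB.instance Definition _ := Measure.on unit_measure.

Lemma unit_measureT : unit_measure [set: _] = 1%E.
Proof.
by rewrite /unit_measure /mrestr setTI lebesgue_measure_itv /= lte01 oppr0 adde0.
Qed.

HB.instance Definition _ :=
  Measure_isProbability.Build _ _ _ unit_measure unit_measureT.

Lemma unit_measure_itv (a b : R) : 0 <= a -> a <= b -> b <= 1 ->
  unit_measure `[a, b[ = (b - a)%:E.
Proof.
move=> a0 ab b1; rewrite /unit_measure /mrestr.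
have -> : `[a, b[ `&` `[0, 1[ = `[a, b[%classic :> set R.
  apply/seteqP; split=> [ x []//|x h]; split=> //; move: h.
  rewrite /= !in_itv /= => /andP[h1 h2].
  by rewrite (le_trans a0 h1) (lt_le_trans h2 b1).
rewrite lebesgue_measure_itv /= lte_fin EFinB; case: ltP => // ba.
by have -> : a = b; [apply/eqP; rewrite eq_le ab|rewrite subee].
Qed.

End UnitMeasure.

Section Walk.
Context {R : realType}.
Variable m : seq bool -> R.
Hypotheses (m_ge0 : forall v, 0 <= m v) (m_nil : m [::] = 1)
  (m_split : forall v, m v = m (rcons v false) + m (rcons v true)).

(** The unit interval is split successively in proportion to the masses [m] of the
    binary words; [walk k u] is the word of length [k] whose interval contains [u],
    together with the left end of this interval. *)
Fixpoint walk (k : nat) (u : R) : seq bool * R :=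
  if k is k'.+1 then
    let: (v, a) := walk k' u in
    if u < a + m (rcons v false) then (rcons v false, a)
    else (rcons v true, a + m (rcons v false))
  else ([::], 0).

Fixpoint left_rec (p : seq bool) (a : R) (l : seq bool) : R :=
  if l is b :: l' then
    left_rec (rcons p b) (if b then a + m (rcons p false) else a) l'
  else a.

Definition left_end l := left_rec [::] 0 l.

Lemma left_rec_rcons l p a b : left_rec p a (rcons l b) =
  if b then left_rec p a l + m (rcons (p ++ l) false) else left_rec p a l.
Proof.
elim: l p a => [|c l IH] p a /=; first by rewrite cats0.
by rewrite IH cat_rcons.
Qed.

Lemma left_end_rcons l b :
  left_end (rcons l b) = left_end l + (if b then m (rcons l false) else 0).
Proof. by rewrite /left_end left_rec_rcons; case: b; rewrite ?addr0. Qed.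

Lemma size_walk k u : size (walk k u).1 = k.
Proof.
by elim: k => //= k; case: walk => v a /= sv; case: ifP => _; rewrite size_rcons sv.
Qed.

Lemma walk_take k j u : (walk k u).1 = take k (walk (k + j) u).1.
Proof.
elim: j => [|j IH]; first by rewrite addn0 -{2}(size_walk k u) take_size.
rewrite addnS /= IH; have := size_walk (k + j) u.
by case: walk => v a /= sv; case: ifP => _ /=; rewrite -cats1 takel_cat // sv leq_addr.
Qed.

Lemma walk_left k u : 0 <= u < 1 ->
  (walk k u).2 = left_end (walk k u).1 /\
  (walk k u).2 <= u < (walk k u).2 + m (walk k u).1.
Proof.
move=> u01; elim: k => [|k] /=; first by rewrite m_nil add0r.
case: walk => v a /= [-> /andP[h1 h2]].
case: ltP => h /=; rewrite left_end_rcons ?addr0; split=> //; apply/andP; split=> //.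
by rewrite -addrA -m_split.
Qed.

Lemma left_end_bounds v : 0 <= left_end v /\ left_end v + m v <= 1.
Proof.
elim/last_ind: v => [|v b [IH1 IH2]]; first by rewrite m_nil add0r.
rewrite left_end_rcons; have := m_ge0 (rcons v false); have := m_ge0 (rcons v true).
by move: IH2; rewrite (m_split v); case: b => *; split; lra.
Qed.

Lemma interval_walk u v : left_end v <= u < left_end v + m v ->
  walk (size v) u = (v, left_end v).
Proof.
elim/last_ind: v => // v b IH.
rewrite left_end_rcons size_rcons /= => /andP[h1 h2].
have hv : left_end v <= u < left_end v + m v.
  have := m_ge0 (rcons v false); have := m_ge0 (rcons v true).
  move: h1 h2; rewrite (m_split v); case: b => *; apply/andP; lra.
rewrite IH //; case: b h1 h2 => h1 h2; first by rewrite ltNge h1.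
by move: h2; rewrite addr0 => ->.
Qed.

Lemma walk_preimage k v : size v = k ->
  [set u | 0 <= u < 1 /\ (walk k u).1 = v] =
  `[left_end v, left_end v + m v[%classic.
Proof.
move=> sv; apply/seteqP; split=> u /=; rewrite in_itv /=.
  by move=> [u01 <-]; have [<-] := walk_left k u01.
move=> h; have [h0 h1] := left_end_bounds v.
split; last by rewrite -sv interval_walk.
by move: h => /andP[h2 h3]; rewrite (le_trans h0) //= (lt_le_trans h3).
Qed.

End Walk.

(** * Sequential compactness of the probability measures *)

Section Compactness.
Context {R : realType} {d : nat}.
Local Notation V := 'rV[R]_d.
Variable Xi : space R d.
Hypothesis Xi_ok : is_state_space Xi.

Definition cell (v : seq bool) : set (borelV R d) :=
  carrier Xi `&` code (size v) @^-1` [set in_tuple v].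

Lemma cell_borel v : measurable (cell v).
Proof. by apply: measurableI; [exact: carrier_borel|exact: code_borel]. Qed.

Lemma cellE v x : cell v x <-> carrier Xi x /\
  forall j, (j < size v)%N -> bit j x = nth false v j.
Proof.
split=> [[cx /= xv]|[cx h]]; split=> //.
  move=> j jv; have := congr1 (fun t => tnth t (Ordinal jv)) xv.
  by rewrite tnth_mktuple (tnth_nth false).
by apply/eq_from_tnth => j; rewrite tnth_mktuple (tnth_nth false) h.
Qed.

Lemma cell_rcons v b : cell (rcons v b) = cell v `&` [set x | bit (size v) x = b].
Proof.
apply/seteqP; split=> x.
  move=> /cellE[cx h]; split.
    apply/cellE; split=> // j jv; rewrite h ?size_rcons 1?ltnW ?ltnS //.
    by rewrite nth_rcons jv.
  by rewrite /= h ?size_rcons // nth_rcons ltnn eqxx.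
move=> [/cellE[cx h] /= hb]; apply/cellE; split=> // j.
rewrite size_rcons ltnS leq_eqVlt nth_rcons => /predU1P[->|jv].
  by rewrite ltnn eqxx.
by rewrite jv h.
Qed.

Definition cell_mass (mu : prob Xi) v : R := fine (prob_measure mu (cell v)).

Lemma cell_mass_nil mu : cell_mass mu [::] = 1.
Proof.
rewrite /cell_mass /prob_measure (_ : cell [::] = carrier Xi) ?(svalP mu) //.
by apply/seteqP; split=> x; [move=> /cellE[]|move=> cx; apply/cellE; split].
Qed.

Lemma cell_mass_ge0 mu v : 0 <= cell_mass mu v.
Proof. by rewrite fine_ge0. Qed.

Lemma cell_mass_le1 mu v : cell_mass mu v <= 1.
Proof.
rewrite -lee_fin fineK; last by apply: fin_num_measure; exact: cell_borel.
by apply: probability_le1; exact: cell_borel.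
Qed.

Lemma cell_mass_split mu v :
  cell_mass mu v = cell_mass mu (rcons v false) + cell_mass mu (rcons v true).
Proof.
rewrite /cell_mass -fineD; try (apply: fin_num_measure; exact: cell_borel).
congr fine; rewrite -measureU; try exact: cell_borel.
  congr (sval mu _); rewrite !cell_rcons -setIUr.
  apply/seteqP; split=> x; last by case.
  by move=> cx; split=> //=; case: (bit _ _); [right|left].
by apply/seteqP; split=> x //; rewrite !cell_rcons => -[[_ /= ->] [_]].
Qed.

Variable mu_ : nat -> prob Xi.

(** The limits of the cell masses are taken along an ultrafilter, so that they exist
    for all words at once; finitely many words are then approximated by a common
    index [n]. *)
Lemma limit_masses : exists m : seq bool -> R,
  forall K e, 0 < e -> exists n, (K <= n)%N /\
    forall v, (size v <= K)%N -> `|cell_mass (mu_ n) v - m v| < e.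
Proof.
have [U [UU oU]] := ultraFilterLemma (eventually_filter : ProperFilter \oo).
have hm v : {a : R | cell_mass (mu_ n) v @[n --> U] --> a}.
  apply: cid; apply: (@ultra_bounded_cvg R U UU _ 1) => n.
  by rewrite ger0_norm ?cell_mass_ge0 ?cell_mass_le1.
exists (fun v => sval (hm v)) => K e e0.
have near1 k : \forall n \near U, forall v : k.-tuple bool,
    `|cell_mass (mu_ n) v - sval (hm v)| < e.
  apply: filter_forall => v; have := svalP (hm v).
  by move/cvgrPdist_lt/(_ _ e0); apply: filterS => n; rewrite distrC.
have near2 : \forall n \near U, forall k : 'I_K.+1, forall v : k.-tuple bool,
    `|cell_mass (mu_ n) v - sval (hm v)| < e.
  by apply: filter_forall => k; exact: near1.
have nearK : \forall n \near U, (K <= n)%N by apply: oU; exists K.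
have [n [h Kn]] := filter_ex (filterI near2 nearK).
exists n; split=> // v vK.
exact: (h (Ordinal (vK : (size v < K.+1)%N)) (in_tuple v)).
Qed.

Section Limit.
Variable m : seq bool -> R.
Hypothesis m_lim : forall K e, 0 < e -> exists n, (K <= n)%N /\
    forall v, (size v <= K)%N -> `|cell_mass (mu_ n) v - m v| < e.

(** Linear inequalities between cell masses pass to the limit; this gives positivity,
    total mass and additivity of [m]. *)
Lemma m_le (a : R) K (c : seq bool -> R) (vs : seq (seq bool)) :
  all (fun v => size v <= K)%N vs ->
  (forall n, a <= \sum_(v <- vs) c v * cell_mass (mu_ n) v) ->
  a <= \sum_(v <- vs) c v * m v.
Proof.
move=> /allP vsK h; apply/ler_addgt0Pr => e e0.
set C := \sum_(v <- vs) `|c v|.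
have C0 : 0 <= C by rewrite sumr_ge0.
have [|n [_ hn]] := m_lim K (e := e / (C + 1)); first by rewrite divr_gt0 // ltr_wpDl.
apply: le_trans (h n) _; rewrite -lerBlDl -sumrB.
apply: (@le_trans _ _ (\sum_(v <- vs) `|c v| * (e / (C + 1)))).
  rewrite big_seq [leRHS]big_seq ler_sum // => v /vsK vK; rewrite -mulrBr.
  apply: le_trans (ler_norm _) _; rewrite normrM ler_wpM2l // ltW //; exact: hn.
rewrite -mulr_suml -/C mulrA ler_pdivrMr ?ltr_wpDl // mulrC ler_wpM2l ?(ltW e0) //.
by rewrite lerDl.
Qed.

Lemma m_ge0 v : 0 <= m v.
Proof.
have := @m_le 0 (size v) (fun=> 1) [:: v]; rewrite /= leqnn big_seq1 mul1r.
by apply=> // n; rewrite big_seq1 mul1r cell_mass_ge0.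
Qed.

Lemma m_nil : m [::] = 1.
Proof.
apply/eqP; rewrite eq_le; apply/andP; split.
  have := @m_le (- 1) 0 (fun=> - 1) [:: [::]]; rewrite /= big_seq1 mulN1r lerN2.
  by apply=> // n; rewrite big_seq1 cell_mass_nil mulr1.
have := @m_le 1 0 (fun=> 1) [:: [::]]; rewrite /= big_seq1 mul1r.
by apply=> // n; rewrite big_seq1 cell_mass_nil mulr1.
Qed.

Lemma m_split v : m v = m (rcons v false) + m (rcons v true).
Proof.
pose vs := [:: v; rcons v false; rcons v true].
have vsK : all (fun w => size w <= (size v).+1)%N vs.
  by rewrite /= !size_rcons leqnn leqnSn.
have ne1 : rcons v false == v = false.
  by apply/eqP => /(congr1 size)/eqP; rewrite size_rcons gtn_eqF.
have ne2 : rcons v true == v = false.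
  by apply/eqP => /(congr1 size)/eqP; rewrite size_rcons gtn_eqF.
have key (s : R) : 0 <= s * m v - s * m (rcons v false) - s * m (rcons v true).
  have := @m_le 0 (size v).+1 (fun w => if w == v then s else - s) vs vsK.
  rewrite !big_cons !big_nil eqxx ne1 ne2 addr0 !mulNr -addrA; apply=> n.
  rewrite !big_cons !big_nil eqxx ne1 ne2 (cell_mass_split _ v); lra.
by have := key 1; have := key (- 1); lra.
Qed.

Lemma m_cell v : 0 < m v -> cell v !=set0.
Proof.
move=> mv; have [n [_ /(_ v (leqnn _))]] := m_lim (size v) mv.
rewrite ltr_norml => /andP[h _]; apply/set0P/eqP => c0.
by move: h; rewrite /cell_mass /prob_measure c0 measure0 /= sub0r ltxx.
Qed.

(** A point of the cell, chosen once and for all; 0 if the cell is empty, which has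
    limit mass 0 ([m_cell]). *)
Definition cell_point v : V := xget 0 (cell v).

Lemma cell_pointP v : 0 < m v -> cell v (cell_point v).
Proof. by move=> /m_cell[x cx]; apply: (xgetPex 0); exists x. Qed.

Definition clamp (u : R) : R := if 0 <= u < 1 then u else 0.

Lemma clamp01 u : 0 <= clamp u < 1.
Proof. by rewrite /clamp; case: ifP => //; rewrite lexx ltr01. Qed.

Lemma measurable_clamp : measurable_fun [set: measurableTypeR R] clamp.
Proof.
apply: measurable_fun_ifT; [|exact: measurable_id|exact: measurable_cst].
apply: measurable_and.
  by apply: measurable_realfun.measurable_fun_ler; [exact: measurable_cst|exact: measurable_id].
by apply: measurable_realfun.measurable_fun_ltr; [exact: measurable_id|exact: measurable_cst].
Qed.

Definition walk_cell k (u : R) : k.-tuple bool :=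
  Tuple (introT eqP (size_walk m k (clamp u))).

Lemma walk_cell_meas k (v : k.-tuple bool) :
  measurable (walk_cell k @^-1` [set v] : set (measurableTypeR R)).
Proof.
have -> : walk_cell k @^-1` [set v] =
    clamp @^-1` `[left_end m v, left_end m v + m v[%classic.
  rewrite -(walk_preimage m_ge0 m_nil m_split (size_tuple v)).
  apply/seteqP; split=> u /=; first by move=> <-; split=> //; exact: clamp01.
  by move=> [_ h]; apply/val_inj.
rewrite -[X in measurable X]setTI; exact: measurable_clamp.
Qed.

Lemma walk_cell_mass k (v : k.-tuple bool) :
  unit_measure (walk_cell k @^-1` [set v] : set (measurableTypeR R)) = (m v)%:E.
Proof.
have [h0 h1] := left_end_bounds m_ge0 m_nil m_split v.
have <- : unit_measure `[left_end m v, left_end m v + m v[ = (m v)%:E.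
  by rewrite unit_measure_itv ?lerDl ?m_ge0 // addrAC subrr add0r.
rewrite /unit_measure /mrestr; congr (lebesgue_measure _).
rewrite -(walk_preimage m_ge0 m_nil m_split (size_tuple v)).
apply/seteqP; split=> u /= [h]; rewrite in_itv /= => u01; split=> //.
  by split=> //; move: h => /(congr1 val) /=; rewrite /clamp u01.
by apply/val_inj => /=; rewrite /clamp u01; case: h.
Qed.

Lemma walk_gt0 k u : 0 < m (walk_cell k u).
Proof.
have [_ /andP[h1 h2]] := walk_left m_nil m_split k (clamp01 u).
by have := le_lt_trans h1 h2; rewrite ltrDl.
Qed.

Definition walk_point k u : V := cell_point (walk_cell k u).

Lemma walk_pointP k u : cell (walk_cell k u) (walk_point k u).
Proof. exact/cell_pointP/walk_gt0. Qed.

Lemma walk_point_carrier k u : carrier Xi (walk_point k u).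
Proof. by have /cellE[] := walk_pointP k u. Qed.

Lemma walk_point_bit j k u : (j < k)%N ->
  bit j (walk_point k u) = nth false (walk m j.+1 (clamp u)).1 j.
Proof.
move=> jk; have /cellE[_ ->] := walk_pointP k u; last by rewrite size_tuple.
by rewrite (walk_take m j.+1 (k - j.+1)) nth_take // subnKC.
Qed.

Lemma walk_code k k' u : (k <= k')%N ->
  code k (walk_point k u) = code k (walk_point k' u).
Proof.
move=> kk'; apply/eq_from_tnth => j; rewrite !tnth_mktuple.
by rewrite !walk_point_bit // (leq_trans _ kk').
Qed.

Definition walk_limit u : V := \row_j limn (fun k => walk_point k u 0 j).

(** Consecutive points share their first bits, and all points are in a bounded set. *)
Lemma walk_cvg u j : walk_point k u 0 j @[k --> \oo] --> walk_limit u 0 j.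
Proof.
have [B B0 cB] := space_bounded Xi_ok.
have [|i|x hx] := @bits_cvg R d (walk_point ^~ u) B.
- by move=> k i; apply: cB; exact: walk_point_carrier.
- exists i.+1 => // k /= ik k' kk'.
  by rewrite !walk_point_bit // (leq_trans ik).
by rewrite mxE; apply: cvgP (hx j).
Qed.

End Limit.

Lemma cell_tuple k (v : k.-tuple bool) :
  cell v = (carrier Xi : set (borelV R d)) `&` code k @^-1` [set v].
Proof.
apply/seteqP; split=> x.
  move=> /cellE[cx h]; split=> //; apply/eq_from_tnth => j.
  by rewrite tnth_mktuple (tnth_nth false) h ?size_tuple.
move=> [cx /= xv]; apply/cellE; split=> // j; rewrite size_tuple => jk.
have := congr1 (fun t => tnth t (Ordinal jk)) xv.
by rewrite tnth_mktuple (tnth_nth false).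
Qed.

Lemma integral_cells (mu : prob Xi) (f : test_fun Xi) k e :
  (forall x y, carrier Xi x -> carrier Xi y -> code k x = code k y ->
     `|sval f x - sval f y| < e) ->
  `|test_integrals mu f - \sum_(v : k.-tuple bool) sval f (cell_point v) * cell_mass mu v| <= e.
Proof.
move=> hf.
have -> : \sum_(v : k.-tuple bool) sval f (cell_point v) * cell_mass mu v =
   \sum_(v : k.-tuple bool) sval f (cell_point v) *
     fine (sval mu ((carrier Xi : set (borelV R d)) `&` code k @^-1` [set v])).
  by apply: eq_bigr => v _; rewrite /cell_mass cell_tuple.
apply: (@integral_approx _ _ _ (sval mu) (carrier Xi : set (borelV R d)) _ (code k)
  (carrier_borel Xi_ok) _ (sval f) (fun v => sval f (cell_point v)) e).
- by move=> v; apply: measurableI; [exact: carrier_borel|exact: code_borel].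
- exact: (svalP mu).
- exact: test_fun_measurable.
- exact: test_fun_bounded.
move=> x cx.
have : cell (code k x) (cell_point (code k x)).
  by apply: (xgetPex 0); exists x; rewrite cell_tuple.
rewrite cell_tuple => -[cc /= ccode].
by apply/ltW/hf.
Qed.

Section LimitMeasure.
Variable m : seq bool -> R.
Hypothesis m_lim : forall K e, 0 < e -> exists n, (K <= n)%N /\
    forall v, (size v <= K)%N -> `|cell_mass (mu_ n) v - m v| < e.
Variable wr : R -> R.
Hypotheses (wr_meas : measurable_fun [set: R] wr)
 (wr_lim : forall (I : Type) (F : set_system I) (FF : ProperFilter F) (u : I -> V) (x : V),
    (\forall i \near F, carrier Xi (u i)) ->
    (forall j, u i 0 j @[i --> F] --> x 0 j) ->
    carrier Xi (\row_j wr (x 0 j)) /\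
    forall e, 0 < e -> \forall i \near F, sdist Xi (\row_j wr (x 0 j)) (u i) < e).

(** The limit of the representatives of the cells that contain [u]; under Lebesgue
    measure its law has the limit masses, hence is the limit measure. *)
Definition limit_point (u : measurableTypeR R) : borelV R d :=
  \row_j wr (walk_limit m u 0 j).

Lemma limit_point_lim u : carrier Xi (limit_point u) /\
  forall e, 0 < e -> \forall k \near \oo, sdist Xi (limit_point u) (walk_point m k u) < e.
Proof.
apply: wr_lim; last exact: (walk_cvg m_lim).
by apply: nearW => k; exact: (walk_point_carrier m_lim).
Qed.

Lemma limit_point_meas : measurable_fun [set: measurableTypeR R] limit_point.
Proof.
apply: measurable_borelV => j.
have -> : (fun u => (limit_point u : V) 0 j) = wr \o (fun u => walk_limit m u 0 j).
  by apply/funext => u /=; rewrite mxE.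
apply: measurableT_comp => //.
apply: (@measurable_realfun.measurable_fun_cvg _ _ R setT
  (fun k (u : measurableTypeR R) => walk_point m k u 0 j)).
  move=> k; apply: (@measurable_finite_range _ (measurableTypeR R) R setT _ (walk_cell m k) _
    (fun v => cell_point v 0 j)) => v.
  by rewrite setTI; exact: (walk_cell_meas m_lim).
by move=> u _; exact: (walk_cvg m_lim).
Qed.

Definition limit_rv : {mfun measurableTypeR R >-> borelV R d} :=
  HB.pack_for {mfun measurableTypeR R >-> borelV R d} limit_point
    (isMeasurableFun.Build _ _ _ _ limit_point limit_point_meas).

Definition limit_law : probability (borelV R d) R := distribution (@unit_measure R) limit_rv.

Lemma limit_law_carrier : limit_law (carrier Xi) = 1%E.
Proof.
rewrite /limit_law /distribution /pushforward /=.
have -> : limit_point @^-1` carrier Xi = [set: _].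
  by apply/seteqP; split=> u // _; have [] := limit_point_lim u.
exact: unit_measureT.
Qed.

Definition limit_prob : prob Xi := exist _ limit_law limit_law_carrier.

(** The image measure is compared with cell masses through the representatives, and
    not through its own mass of the cells: in the limit, mass may move to the boundary
    of a cell. *)
Lemma integral_limit (f : test_fun Xi) k e : 0 < e ->
  (forall x y, carrier Xi x -> carrier Xi y -> code k x = code k y ->
     `|sval f x - sval f y| < e) ->
  `|test_integrals limit_prob f - \sum_(v : k.-tuple bool) sval f (cell_point v) * m v| <= e.
Proof.
move=> e0 hf.
have mD := carrier_borel Xi_ok.
have mf := test_fun_measurable Xi_ok f.
have mfr : measurable_fun [set: borelV R d] (sval f \_ (carrier Xi : set (borelV R d))).
  by apply/(measurable_restrictT _ mD).
have [K' hK'] : exists K' : R, forall x, carrier Xi x -> `|sval f x| <= K'.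
  by have [[K' ?] _] := svalP f; exists K'.
have E u : (sval f \_ (carrier Xi : set (borelV R d))) (limit_point u) = sval f (limit_point u).
  by rewrite patchE mem_set //; have [] := limit_point_lim u.
have mcomp : measurable_fun [set: measurableTypeR R] (sval f \o limit_point).
  have -> : sval f \o limit_point = (sval f \_ (carrier Xi : set (borelV R d))) \o limit_point.
    by apply/funext => u /=; rewrite E.
  exact: measurableT_comp limit_point_meas.
have bcomp : [bounded (sval f \o limit_point) u | u in [set: measurableTypeR R]].
  exists K'; split; first exact: num_real.
  by move=> M KM u _ /=; apply: le_trans (ltW KM); apply: hK'; have [] := limit_point_lim u.
have -> : test_integrals limit_prob f =
    Rintegral (@unit_measure R) [set: measurableTypeR R] (sval f \o limit_point).
  rewrite /test_integrals Rintegral_mkcond /Rintegral; congr fine.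
  rewrite /= /limit_law.
  rewrite (integral_distribution (X := limit_rv) (f := EFin \o (sval f \_ (carrier Xi : set (borelV R d))))).
  - by apply: eq_integral => u _ /=; rewrite E.
  - exact/measurable_realfun.measurable_EFinP.
  have := @measurable_bounded_integrable _ _ _ (@unit_measure R) (sval f \o limit_point)
    setT measurableT.
  move=> H; have := H _ mcomp bcomp.
  have -> : EFin \o (sval f \o limit_point) =
    (EFin \o sval f \_ (carrier Xi : set (borelV R d))) \o limit_rv.
    by apply/funext => u /=; rewrite E.
  by apply; rewrite [X in (X < _)%E]unit_measureT ltry.
have -> : \sum_(v : k.-tuple bool) sval f (cell_point v) * m v =
   \sum_(v : k.-tuple bool) sval f (cell_point v) *
     fine (unit_measure ([set: measurableTypeR R] `&` walk_cell m k @^-1` [set v])).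
  by apply: eq_bigr => v _; rewrite setTI (walk_cell_mass m_lim).
apply: (@integral_approx _ (measurableTypeR R) R (@unit_measure R) setT _ (walk_cell m k)
  measurableT _ (sval f \o limit_point) (fun v => sval f (cell_point v)) e) => //.
- by move=> v; rewrite setTI; exact: (walk_cell_meas m_lim).
- exact: unit_measureT.
move=> u _ /=.
have [cl hl] := limit_point_lim u.
apply/ler_addgt0Pr => e' e'0.
have [_ fc] := svalP f.
have [dl dl0 hd] := fc _ cl _ e'0.
have [k' _ hk'] := hl _ dl0.
pose j := maxn k k'.
have c1 : carrier Xi (walk_point m j u) by exact: (walk_point_carrier m_lim).
have c2 : carrier Xi (walk_point m k u) by exact: (walk_point_carrier m_lim).
have f1 := hd _ c1 (hk' j (leq_maxr _ _)).
have f2 := hf _ _ c2 c1 (walk_code m_lim u (leq_maxl k k')).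
apply: le_trans (ler_distD (sval f (walk_point m j u)) _ _) _.
by rewrite addrC; apply: lerD; [rewrite distrC ltW|rewrite distrC ltW].
Qed.

End LimitMeasure.

(** Indices with cell masses within [1 / (k + 1)] of the limit masses are chosen
    recursively.  For a test function that oscillates little on the cells of depth
    [k], both integrals are close to the same finite sum over the cells. *)
Lemma prob_seq_compact : exists sigma nu,
  (forall k, (sigma k < sigma k.+1)%N) /\ (mu_ \o sigma @ \oo --> (nu : prob Xi)).
Proof.
have [m m_lim] := limit_masses.
have [wr wr_meas wr_lim] := space_limit Xi_ok.
pose nu := limit_prob m_lim wr_meas wr_lim.
have pick (kN : nat * nat) : {n : nat | (kN.2 < n)%N /\
   forall v, (size v <= kN.1)%N -> `|cell_mass (mu_ n) v - m v| < kN.1.+1%:R^-1}.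
  apply: cid; have [|n [hn h]] := m_lim (maxn kN.1 kN.2.+1) kN.1.+1%:R^-1.
    by rewrite invr_gt0.
  exists n; split; first by apply: leq_trans hn; exact: leq_maxr.
  by move=> v vk; apply: h; apply: leq_trans vk _; exact: leq_maxl.
pose sigma := fix sigma k := if k is k'.+1 then sval (pick (k, sigma k')) else sval (pick (0, 0)%N).
have sigmaS k : sigma k.+1 = sval (pick (k.+1, sigma k)) by [].
have smono k : (sigma k < sigma k.+1)%N by rewrite sigmaS; have [] := svalP (pick (k.+1, sigma k)).
have sapprox k v : (size v <= k)%N -> `|cell_mass (mu_ (sigma k)) v - m v| < k.+1%:R^-1.
  case: k => [|k] vk; first by have [_ h] := svalP (pick (0, 0)%N); exact: h.
  by rewrite sigmaS; have [_ h] := svalP (pick (k.+1, sigma k)); exact: h.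
exists sigma, nu; split=> //.
apply/cvg_probP => f; apply/cvgrPdist_le => e e0.
have e4 : 0 < e / 4 by rewrite divr_gt0.
have [k hk] := test_fun_bits Xi_ok f e4.
have i1 := integral_limit m_lim wr_meas wr_lim e4 hk.
have i2 n := integral_cells (mu_ (sigma n)) hk.
have i3 : \sum_(v : k.-tuple bool) sval f (cell_point v) * cell_mass (mu_ (sigma n)) v
   @[n --> \oo] --> \sum_(v : k.-tuple bool) sval f (cell_point v) * m v.
  apply: cvg_sum_seq => v _ _; apply: cvgM; first exact: cvg_cst.
  apply/cvgrPdist_lt => e' e'0.
  have [N _ hN] := near_infty_natSinv_lt (PosNum e'0).
  exists (maxn N k) => // n /=; rewrite geq_max => /andP[Nn kn].
  rewrite distrC; apply: lt_trans (hN n Nn); apply: sapprox.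
  by rewrite size_tuple.
have [N0 _ hN0] := (cvgrPdist_le _ _).1 i3 _ e4; exists N0 => // n /hN0 h.
move: i1 (i2 n) h => /=; rewrite -/nu.
set a := test_integrals nu f; set b := test_integrals _ f.
set s1 := \sum_v _; set s2 := \sum_v _ => h1 h2 h3.
apply: le_trans (ler_distD s1 _ _) _.
apply: (@le_trans _ _ (e / 4 + (e / 4 + e / 4))); last by lra.
apply: lerD => //; apply: le_trans (ler_distD s2 _ _) _.
by apply: lerD => //; rewrite distrC.
Qed.

End Compactness.

(** * Finitely supported measures *)

Section FiniteSupport.
Context {R : realType} {d : nat}.
Local Notation V := 'rV[R]_d.
Variable Xi : space R d.
Hypothesis Xi_ok : is_state_space Xi.

Lemma grid_finite n : (0 < n)%N -> finite_set (grid Xi n).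
Proof.
move=> n0; have [B B0 cB] := space_bounded Xi_ok.
pose M := Num.bound (n%:R * B).
pose g (f : {ffun 'I_d -> 'I_(M + M).+1}) : V := \row_i (((f i : nat)%:R - M%:R) / n%:R).
apply: (@sub_finite_set _ _ (range g)); last exact: finite_image.
move=> x [cx hx].
have n0R : 0 < n%:R :> R by rewrite ltr0n.
have hk i : {k : int | x 0 i = k%:~R / n%:R & (`|k| <= M%:Z)%R}.
  have [k xk] := cid (hx i); exists k => //.
  have := cB x cx i; rewrite xk normrM [`|n%:R^-1|]ger0_norm ?invr_ge0 // ler_pdivrMr //.
  rewrite mulrC -intr_norm => h.
  have hb : n%:R * B < M%:R by apply: archi_boundP; rewrite mulr_ge0 // ltW.
  by have := le_lt_trans h hb; rewrite -[M%:R]/((M%:Z)%:~R) ltr_int => /ltW.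
have hlt i : (absz (s2val (hk i) + M%:Z)%R < (M + M).+1)%N.
  case: (hk i) => k /= _; rewrite ler_norml => /andP[h1 h2]; lia.
exists [ffun i => Ordinal (hlt i)] => //.
apply/rowP => i; rewrite mxE ffunE /=; case: (hk i) => k /= xk kM.
rewrite xk; congr (_ / _).
have kM0 : 0 <= k + M%:Z by move: kM; rewrite ler_norml; lia.
rewrite -[X in X - _]/((Posz (absz (k + M%:Z)%R))%:~R : R) gez0_abs // intrD addrK //.
Qed.

Lemma finite_borel (G : set V) : finite_set G -> measurable (G : set (borelV R d)).
Proof.
move=> fG; have -> : G = \bigcup_(x in G) [set x].
  by apply/seteqP; split=> [ x Gx|x [y Gy /= ->]//]; exists x.
by apply: fin_bigcup_measurable => // x _; exact: set1_borel.
Qed.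

Lemma mass_enum (mu : probability (borelV R d) R) (G A : set V) :
  finite_set G -> mu G = 1%E -> measurable (A : set (borelV R d)) ->
  fine (mu A) = \sum_(x <- finmap.enum_fset (fset_set G) | x \in A) fine (mu [set x]).
Proof.
move=> fG muG mA; have mG := finite_borel fG.
have -> : mu A = mu (A `&` G).
  have <- : mu (A `&` G `|` A `&` ~` G) = mu A by rewrite -setIUr setUCr setIT.
  have z : mu (~` G) = 0%E by rewrite probability_setC // muG subee.
  have mAC : measurable (A `&` ~` G : set (borelV R d)).
    by apply: measurableI => //; exact: measurableC.
  rewrite measureU0 //; first exact: measurableI.
  by apply/eqP; rewrite eq_le measure_ge0 andbT -z; apply: le_measure;
    rewrite ?inE //; exact: measurableC.
have -> : A `&` G = \bigcup_(x in A `&` G) [set x].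
  by apply/seteqP; split=> [ x Gx|x [y Gy /= ->]//]; exists x.
rewrite measure_fin_bigcup; first last.
- by move=> x _; exact: set1_borel.
- by move=> x y _ _ [z [/= -> ->]].
- exact: finite_setIr.
rewrite fsbig_finite; last exact: finite_setIr.
transitivity (\sum_(x <- finmap.enum_fset (fset_set (A `&` G))) fine (mu [set x])).
  rewrite (eq_bigr (fun x => (fine (mu [set x]))%:E)) ?sumEFin // => x _.
  by rewrite fineK // fin_num_measure //; exact: set1_borel.
apply/esym; rewrite -big_filter; apply: perm_big; apply: uniq_perm.
- by apply: filter_uniq; exact: finmap.fset_uniq.
- exact: finmap.fset_uniq.
move=> x; rewrite mem_filter !in_enum //; last exact: finite_setIr.
by rewrite in_setI.
Qed.

Lemma test_integrals_enum (mu : prob Xi) (G : set V) (f : test_fun Xi) :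
  finite_set G -> G `<=` carrier Xi -> prob_measure mu G = 1%E ->
  test_integrals mu f =
  \sum_(x <- finmap.enum_fset (fset_set G)) sval f x * fine (prob_measure mu [set x]).
Proof.
move=> fG GX muG; apply/eqP; rewrite -subr_eq0 -normr_le0.
apply/ler_addgt0Pr => e e0; rewrite add0r.
have e2 : 0 < e / 2 by rewrite divr_gt0.
have [k [g hg]] := test_fun_rep Xi_ok f e2.
have mX := carrier_borel Xi_ok.
have mc (v : k.-tuple bool) :
    measurable ((carrier Xi : set (borelV R d)) `&` code k @^-1` [set v]).
  by apply: measurableI => //; exact: code_borel.
have := integral_approx (mu := sval mu) (e := e / 2) (g := g) mX mc (svalP mu)
   (test_fun_measurable Xi_ok f) (test_fun_bounded f) hg.
rewrite -/(test_integrals mu f).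
set s := finmap.enum_fset (fset_set G).
have -> : \sum_v g v * fine (sval mu ((carrier Xi : set (borelV R d)) `&` code k @^-1` [set v])) =
    \sum_(x <- s) g (code k x) * fine (prob_measure mu [set x]).
  under eq_bigr => v _ do rewrite (mass_enum fG muG) // mulr_sumr big_mkcond /=.
  rewrite exchange_big /= big_seq [RHS]big_seq; apply: eq_bigr => x.
  rewrite in_enum // => /set_mem Gx.
  rewrite (bigD1 (code k x)) //= mem_set; last by split=> //; exact: GX.
  rewrite big1 ?addr0 // => v vx; rewrite memNset // => -[_ /= xv].
  by rewrite xv eqxx in vx.
move=> h1.
have h2 : `|\sum_(x <- s) g (code k x) * fine (prob_measure mu [set x]) -
    \sum_(x <- s) sval f x * fine (prob_measure mu [set x])| <= e / 2.
  rewrite -sumrB; apply: le_trans (ler_norm_sum _ _ _) _.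
  have m1 : \sum_(x <- s) fine (prob_measure mu [set x]) = 1.
    rewrite -[RHS]/(fine (1%:E : \bar R)) -muG.
    rewrite [RHS](mass_enum fG muG (finite_borel fG)) big_seq [RHS]big_seq_cond.
    by apply: eq_bigl => x; rewrite in_enum // andbb.
  have -> : e / 2 = e / 2 * \sum_(x <- s) fine (prob_measure mu [set x]) by rewrite m1 mulr1.
  rewrite mulr_sumr big_seq [leRHS]big_seq ler_sum // => x.
  rewrite in_enum // => /set_mem Gx; rewrite -mulrBl normrM.
  rewrite [X in _ * X <= _]ger0_norm ?fine_ge0 // ler_wpM2r ?fine_ge0 //.
  by rewrite distrC; apply: hg; exact: GX.
rewrite (splitr e); apply: le_trans (ler_distD _ _ _) (lerD h1 h2).
Qed.

Lemma finite_prob (G : set V) (w : V -> R) : finite_set G -> G `<=` carrier Xi ->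
  (forall x, G x -> 0 <= w x) ->
  \sum_(x <- finmap.enum_fset (fset_set G)) w x = 1 ->
  exists mu : prob Xi, prob_measure mu G = 1%E /\
    forall x, G x -> prob_measure mu [set x] = (w x)%:E.
Proof.
move=> fG GX w0 w1; set s := finmap.enum_fset (fset_set G) in w1.
have [x0 x0G] : exists x, x \in s.
  case: (s) w1 => [|x l _]; last by exists x; rewrite inE eqxx.
  by rewrite big_nil => /esym/eqP; rewrite oner_eq0.
pose wn x : {nonneg R} := NngNum (normr_ge0 (w x)).
pose ms k : measure (borelV R d) R := mscale (wn (nth x0 s k)) (\d_(nth x0 s k : borelV R d)).
pose nu := msum ms (size s).
have nuE (A : set (borelV R d)) : measurable A -> nu A = (\sum_(x <- s | x \in A) w x)%:E.
  move=> mA; rewrite /nu /msum /= -sumEFin [RHS]big_mkcond (big_nth x0) big_mkord.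
  apply: eq_bigr => i _; rewrite /ms /= /mscale /= diracE.
  have : nth x0 s i \in s by rewrite mem_nth.
  rewrite in_enum // => /set_mem Gi; rewrite ger0_norm ?w0 //.
  by case: (_ \in A); rewrite ?mule1 ?mule0.
have nuG : nu G = 1%E.
  rewrite nuE; last exact: finite_borel.
  congr EFin; rewrite -[RHS]w1 big_seq_cond [RHS]big_seq; apply: eq_bigl => x.
  by rewrite in_enum // andbb.
have nuT : nu [set: borelV R d] = 1%E.
  rewrite nuE // -[RHS]/(1%:E) -w1; congr EFin; apply: eq_bigl => x.
  by rewrite in_setT.
pose P : probability (borelV R d) R :=
  HB.pack_for (probability (borelV R d) R) (msum ms (size s))
    (Measure_isProbability.Build _ _ _ (msum ms (size s)) nuT).
have PX : P (carrier Xi) = 1%E.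
  apply/eqP; rewrite eq_le; apply/andP; split.
    by apply: probability_le1; exact: carrier_borel.
  rewrite -nuG; apply: (le_measure nu); rewrite ?inE //.
    exact: finite_borel.
  exact: carrier_borel.
exists (exist _ P PX); split=> // x Gx; rewrite /prob_measure /=.
rewrite -[LHS]/(nu [set x]) nuE; last exact: set1_borel.
congr EFin; have xs : x \in s by rewrite in_enum //; exact: mem_set.
rewrite (bigD1_seq_cond _ xs) ?finmap.fset_uniq //=; last exact: mem_set.
rewrite big1 ?addr0 // => y /andP[/set_mem /= ->]; by rewrite eqxx.
Qed.

End FiniteSupport.

(** * Bump functions *)

Section Bump.
Context {R : realType} {d : nat}.
Local Notation V := 'rV[R]_d.

(** The function [max 0 (1 - rho / e ^ 2)] with [rho] the squared distance to [a].  The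
    function [c] is the signed distance of two coordinates; it covers the Euclidean and
    the torus metric. *)
Lemma bump_gen (Xi : space R d) (c : R -> R -> R) (K : R) (a : V) (e : R) :
  (forall x y, sdist Xi x y = Num.sqrt (\sum_j c (x 0 j) (y 0 j) ^+ 2)) ->
  (forall x y z : V, carrier Xi x -> carrier Xi y -> carrier Xi z -> forall j,
     `| `|c (x 0 j) (y 0 j)| - `|c (x 0 j) (z 0 j)| | <= `|c (y 0 j) (z 0 j)|) ->
  (forall x y : V, carrier Xi x -> carrier Xi y -> forall j, `|c (x 0 j) (y 0 j)| <= K) ->
  (forall x : V, carrier Xi x -> forall j, c (x 0 j) (x 0 j) = 0) ->
  0 <= K -> carrier Xi a -> 0 < e ->
  exists f : test_fun Xi, [/\ forall x, carrier Xi x -> 0 <= sval f x <= 1, sval f a = 1 &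
     forall x, carrier Xi x -> sval f x <> 0 -> sdist Xi a x < e].
Proof.
move=> dE tri cK c0 K0 ca e0.
pose rho (y : V) := \sum_j c (a 0 j) (y 0 j) ^+ 2.
pose f y := Num.max 0 (1 - rho y / e ^+ 2).
have rho0 y : 0 <= rho y by rewrite sumr_ge0 // => j _; exact: sqr_ge0.
have e20 : 0 < e ^+ 2 by rewrite exprn_gt0.
have f01 y : 0 <= f y <= 1.
  rewrite /f le_max lexx /= ge_max ler01 /= lerBlDr lerDl.
  by rewrite divr_ge0 ?rho0 ?ltW.
have fb : bounded_on Xi f.
  by exists 1 => x _; have /andP[h1 h2] := f01 x; rewrite ger0_norm.
have fc : continuous_on Xi f.
  move=> y cy e' e'0.
  pose C := d%:R * (2 * K) + 1.
  have C0 : 0 < C by rewrite ltr_wpDl // mulr_ge0 // mulr_ge0.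
  exists (e' * e ^+ 2 / C) => [|z cz yz]; first by rewrite divr_gt0 // mulr_gt0.
  have rl : `|rho z - rho y| <= C * sdist Xi y z.
    rewrite -sumrB; apply: le_trans (ler_norm_sum _ _ _) _.
    apply: (@le_trans _ _ (\sum_(j < d) 2 * K * sdist Xi y z)); last first.
      rewrite sumr_const card_ord -(mulr_natl (2 * K * _)) mulrA.
      by rewrite ler_wpM2r ?dE ?sqrtr_ge0 // lerDl.
    apply: ler_sum => j _.
    rewrite -(real_normK (num_real (c _ (z 0 j)))) -(real_normK (num_real (c _ (y 0 j)))).
    rewrite subr_sqr normrM mulrC.
    apply: ler_pM => //.
      rewrite ger0_norm ?addr_ge0 // (_ : 2 * K = K + K); last by lra.
      by apply: lerD; exact: cK.
    rewrite distrC; apply: le_trans (tri _ _ _ ca cy cz j) _.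
    by rewrite dE; exact: (coord_le_norm (fun i => c (y 0 i) (z 0 i))).
  have fl : `|f z - f y| <= `|rho z - rho y| / e ^+ 2.
    have -> : `|rho z - rho y| / e ^+ 2 =
        `|(1 - rho z / e ^+ 2) - (1 - rho y / e ^+ 2)|.
      rewrite (_ : _ - _ - _ = - ((rho z - rho y) / e ^+ 2)); last by lra.
      by rewrite normrN normrM [`|_^-1|]ger0_norm // invr_ge0 ltW.
    rewrite /f; move: (1 - rho z / _) (1 - rho y / _) => p q.
    rewrite ler_norml; apply/andP.
    have h := ler_norm (p - q); have := ler_norm (q - p); rewrite distrC => h'.
    by case: (leP 0 p) => hp; case: (leP 0 q) => hq; split; lra.
  apply: le_lt_trans fl _; rewrite ltr_pdivrMr //.
  apply: le_lt_trans rl _; rewrite mulrC -ltr_pdivlMr //.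
exists (exist _ f (conj fb fc)); split=> //=.
  rewrite /f /rho big1 ?mul0r ?subr0; first by rewrite max_r ?ler01.
  by move=> j _; rewrite c0 // expr0n.
move=> x cx fx; rewrite dE -/(rho x) ltNge; apply/negP => ex; apply: fx.
rewrite /f max_l // subr_le0 ler_pdivlMr // mul1r.
rewrite -[leRHS]sqr_sqrtr ?rho0 // lerXn2r ?nnegrE ?sqrtr_ge0 ?(ltW e0) //.
Qed.

Lemma bump (Xi : space R d) (a : V) (e : R) : is_state_space Xi ->
  carrier Xi a -> 0 < e ->
  exists f : test_fun Xi, [/\ forall x, carrier Xi x -> 0 <= sval f x <= 1, sval f a = 1 &
     forall x, carrier Xi x -> sval f x <> 0 -> sdist Xi a x < e].
Proof.
move=> Xi_ok; have [B B0 cB] := space_bounded Xi_ok; case: Xi_ok cB => [->|[U [oU bU ->]]] cB.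
  apply: (@bump_gen _ circle_dist 1) => //.
  - move=> x y z cx cy cz j.
    have [hx hy hz] : [/\ 0 <= x 0 j < 1, 0 <= y 0 j < 1 & 0 <= z 0 j < 1] by [].
    rewrite (ger0_norm (circle_ge0 hx hy)) (ger0_norm (circle_ge0 hx hz)).
    rewrite (ger0_norm (circle_ge0 hy hz)) ler_norml.
    have := circle_triangle hx hy hz; have := circle_triangle hx hz hy.
    by rewrite (circle_sym (z 0 j)); move=> *; apply/andP; split; lra.
  - move=> x y cx cy j; rewrite ger0_norm ?circle_ge0 //.
    rewrite /circle_dist ge_min; apply/orP; right.
    by rewrite lerBlDr lerDl.
  - move=> x cx j; rewrite /circle_dist subrr normr0 subr0.
    by rewrite min_l ?ler01.
apply: (@bump_gen _ (fun s t => s - t) (B + B)) => //.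
- move=> x y z _ _ _ j; apply: le_trans (ler_dist_dist _ _) _.
  have -> : x 0 j - y 0 j - (x 0 j - z 0 j) = - (y 0 j - z 0 j) by ring.
  by rewrite normrN.
- move=> x y cx cy j; apply: le_trans (ler_normB _ _) _; apply: lerD; exact: cB.
- by move=> x _ j; rewrite subrr.
by rewrite addr_ge0 // ltW.
Qed.

End Bump.

(** * Inferior and superior limits *)

Section LimInf.
Context {R : realType}.
Implicit Types (u : nat -> \bar R) (L : \bar R).

Lemma lee_real_below (L l : \bar R) :
  (forall c : R, (c%:E < L)%E -> (c%:E <= l)%E) -> (L <= l)%E.
Proof.
move=> h; case: l h => [r| |] h; [|exact: leey|].
  rewrite leNgt; apply/negP; case: L h => [s| |] h //.
    rewrite lte_fin => rs; have := h ((r + s) / 2); rewrite lte_fin lee_fin => H.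
    have h1 : (r + s) / 2 < s by lra.
    have := H h1; lra.
  by move=> _; have := h (r + 1) (ltry _); rewrite lee_fin; lra.
case: L h => [s| |] h //.
  have h1 : s - 1 < s by lra.
  by have := h (s - 1); rewrite lte_fin => /(_ h1).
by have := h 0 (ltry _).
Qed.

Lemma le_limn_einf u L :
  (forall c : R, (c%:E < L)%E -> \forall n \near \oo, (c%:E <= u n)%E) ->
  (L <= limn_einf u)%E.
Proof.
move=> h; apply: lee_real_below => c /h [N _ hN].
have := @cvg_lim _ (@ereal_hausdorff R) _ _ _ _ _ (@cvg_einfs_sup R u).
rewrite -limn_einf_lim => ->.
apply: le_trans (_ : einfs u N <= _)%E; last by apply: ereal_sup_ubound; exists N.
by apply/ereal_infP => _ [n /= Nn <-]; exact: hN.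
Qed.

Lemma limn_einf_gt u L (c : R) : (L <= limn_einf u)%E -> (c%:E < L)%E ->
  \forall n \near \oo, (c%:E < u n)%E.
Proof.
have := @cvg_lim _ (@ereal_hausdorff R) _ _ _ _ _ (@cvg_einfs_sup R u).
rewrite -limn_einf_lim => -> Lu cL.
have /ereal_sup_gt[_ [N _ <-] cN] := lt_le_trans cL Lu.
exists N => // n /= Nn; apply: lt_le_trans cN _.
by apply: ereal_inf_lbound; exists n.
Qed.

Lemma limn_esup_le u L :
  (forall e : R, 0 < e -> \forall n \near \oo, (u n <= L + e%:E)%E) ->
  (limn_esup u <= L)%E.
Proof.
move=> h.
have := @cvg_lim _ (@ereal_hausdorff R) _ _ _ _ _ (@cvg_esups_inf R u).
rewrite -limn_esup_lim => ->.
apply/lee_addgt0Pr => e /h [N _ hN].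
apply: le_trans (_ : _ <= esups u N)%E _; first by apply: ereal_inf_lbound; exists N.
by apply: ge_ereal_sup => _ [n /= Nn <-]; exact: hN.
Qed.

End LimInf.

(** * The rate functional of a reduced chain *)

Lemma cvg_near_eq (R : realType) (I : Type) (F : set_system I) {FF : Filter F}
    (f g : I -> R) (l : R) : (\forall i \near F, f i = g i) ->
  g i @[i --> F] --> l -> f i @[i --> F] --> l.
Proof.
move=> fg gl; apply: cvg_trans gl; apply: near_eq_cvg.
by apply: filterS fg => i ->.
Qed.

Lemma cvg_sqrt (R : realType) (I : Type) (F : set_system I) {FF : Filter F}
    (f : I -> R) (l : R) :
  f i @[i --> F] --> l -> Num.sqrt (f i) @[i --> F] --> Num.sqrt l.
Proof. by move=> fl; apply: (cvg_comp f Num.sqrt fl); exact: sqrt_continuous. Qed.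

Lemma fsum_fin (R : nmodType) (I : finType) (C : set I) (F : I -> R) :
  \sum_(i \in C) F i = \sum_(i | i \in C) F i.
Proof.
rewrite fsbig_finite; last exact: finite_finset.
rewrite -[RHS]big_filter; apply: perm_big; apply: uniq_perm.
- exact: finmap.fset_uniq.
- by apply: filter_uniq; exact: index_enum_uniq.
move=> x; rewrite in_enum; last exact: finite_finset.
by rewrite mem_filter mem_index_enum andbT.
Qed.

Lemma fsumT (R : nmodType) (I : finType) (F : I -> R) :
  \sum_(i \in [set: I]) F i = \sum_i F i.
Proof. by rewrite fsum_fin; apply: eq_bigl => i; rewrite in_setT. Qed.

Section ReducedChain.
Context {R : realType} {N : nat}.
Implicit Types (r : 'I_N -> 'I_N -> R) (w u : 'I_N -> R).

(** The diagonal rates of a reduced chain are arbitrary, and the generator does not see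
    them. *)
Definition offdiag r i j : R := if i == j then 0 else r i j.

Lemma reduced_rateE r w u :
  - \sum_(x \in [set: 'I_N]) generator [set: 'I_N] r u x / u x * w x =
  - \sum_i \sum_j offdiag r i j * (u j - u i) / u i * w i.
Proof.
rewrite fsumT; congr (- _); apply: eq_bigr => i _.
rewrite /generator fsumT !mulr_suml; apply: eq_bigr => j _.
by rewrite /offdiag; case: eqP => [->|//]; rewrite subrr !mulr0 !mul0r.
Qed.

Definition reduced_rate r w := rate_functional [set: 'I_N] r w.

Lemma reduced_rate_ub r w u : (forall i, 0 < u i) ->
  ((- \sum_i \sum_j offdiag r i j * (u j - u i) / u i * w i)%:E <= reduced_rate r w)%E.
Proof.
move=> u0; apply: ereal_sup_ubound; exists u; first by move=> i _; exact: u0.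
by rewrite reduced_rateE.
Qed.

Lemma reduced_rate_le r w (b : \bar R) :
  (forall u, (forall i, 0 < u i) ->
    ((- \sum_i \sum_j offdiag r i j * (u j - u i) / u i * w i)%:E <= b)%E) ->
  (reduced_rate r w <= b)%E.
Proof.
move=> h; apply: ge_ereal_sup => _ [u u0 <-]; rewrite reduced_rateE.
by apply: h => i; exact: u0.
Qed.

Lemma reduced_rate_ge0 r w : (0 <= reduced_rate r w)%E.
Proof.
have := @reduced_rate_ub r w (fun=> 1) (fun=> ltr01).
rewrite big1 ?oppr0 // => i _; rewrite big1 // => j _.
by rewrite subrr mulr0 !mul0r.
Qed.

Section LimitReversible.
Variable r : 'I_N -> 'I_N -> R.
Local Notation r' := (offdiag r).
Variables (a : nat -> 'I_N -> R) (rn : nat -> 'I_N -> 'I_N -> R).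
Hypotheses (a_gt0 : \forall n \near \oo, forall i, 0 < a n i)
  (rn_ge0 : \forall n \near \oo, forall i j, 0 <= rn n i j)
  (rn_balance : \forall n \near \oo, forall i j, a n i * rn n i j = a n j * rn n j i)
  (rn_cvg : forall i j, i != j -> rn n i j @[n --> \oo] --> r i j).

Lemma offdiag_ge0 i j : 0 <= r' i j.
Proof.
rewrite /offdiag; case: eqVneq => // ij; apply: (cvg_limit_ge (rn_cvg ij)).
by apply: filterS rn_ge0 => n; exact.
Qed.

Lemma reduced_rate_fin w : (forall i, 0 <= w i) -> (reduced_rate r w < +oo)%E.
Proof.
move=> w0; apply: (@le_lt_trans _ _ (\sum_i \sum_j r' i j * w i)%:E); last exact: ltry.
apply: reduced_rate_le => u u0; rewrite lee_fin -sumrN ler_sum // => i _.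
rewrite -sumrN ler_sum // => j _.
have -> : - (r' i j * (u j - u i) / u i * w i) = r' i j * w i * (1 - u j / u i).
  by field; rewrite gt_eqF.
rewrite ler_piMr ?mulr_ge0 ?offdiag_ge0 // lerBlDr lerDl.
by rewrite divr_ge0 ?ltW.
Qed.

Lemma reduced_rate_balance0 w : (forall i, 0 <= w i) ->
  (forall i j, w i * r' i j = w j * r' j i) -> reduced_rate r w = 0%E.
Proof.
move=> w0 bal; apply/eqP; rewrite eq_le reduced_rate_ge0 andbT.
apply: reduced_rate_le => u u0; rewrite lee_fin.
have := @rate_le_energy _ _ (index_enum 'I_N) r' w (fun i j _ _ => bal i j)
  (fun i j _ _ => offdiag_ge0 i j) (fun i _ => w0 i) (fun=> 1) u (fun i _ => u0 i).
have -> : energy (index_enum 'I_N) r' w (fun=> 1) = 0.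
  rewrite /energy big1 ?mulr0 // => i _; rewrite big1 // => j _.
  by rewrite subrr expr0n mulr0.
congr (- _ <= _); apply: eq_bigr => i _; rewrite expr1n mulr1 /sgen !mulr_suml.
by apply: eq_bigr.
Qed.

(** The energy of [w] when [r] is reversible; it makes sense for all rates, and for
    limits of reversible rates it is still a lower bound of the functional. *)
Definition sqrt_form w : R :=
  2^-1 * \sum_i \sum_j (Num.sqrt (w i * r' i j) - Num.sqrt (w j * r' j i)) ^+ 2.

Lemma sqrt_formE w : (forall i, 0 <= w i) ->
  sqrt_form w = \sum_i \sum_j (w i * r' i j - Num.sqrt (w i * w j) * Num.sqrt (r' i j * r' j i)).
Proof.
move=> w0.
have E : \sum_i \sum_j w i * r' i j = \sum_i \sum_j w j * r' j i by rewrite exchange_big.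
have -> : \sum_i \sum_j (w i * r' i j - Num.sqrt (w i * w j) * Num.sqrt (r' i j * r' j i)) =
  2^-1 * (\sum_i \sum_j w i * r' i j + \sum_i \sum_j w j * r' j i -
     2 * \sum_i \sum_j Num.sqrt (w i * w j) * Num.sqrt (r' i j * r' j i)).
  rewrite -E; under eq_bigr do rewrite sumrB.
  rewrite sumrB; lra.
rewrite /sqrt_form; congr (_ * _); rewrite mulr_sumr -big_split /= -sumrB.
apply: eq_bigr => i _; rewrite mulr_sumr -big_split /= -sumrB; apply: eq_bigr => j _.
rewrite sqrrB !sqr_sqrtr ?mulr_ge0 ?offdiag_ge0 // addrAC; congr (_ - _).
by rewrite -mulr_natl !sqrtrM ?w0 ?offdiag_ge0 //; ring.
Qed.

(** If [r i j] is positive then [a n i / a n j = rn n j i / rn n i j] converges to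
    [r j i / r i j]; if it is 0 both sides vanish. *)
Lemma ratio_sqrt_cvg i j :
  r' i j * Num.sqrt (a n i / a n j) @[n --> \oo] --> Num.sqrt (r' i j * r' j i).
Proof.
rewrite /offdiag; have [ij|ij] := eqVneq i j.
  by under eq_fun do rewrite mul0r; rewrite !mul0r sqrtr0; exact: cvg_cst.
have := offdiag_ge0 i j; have := offdiag_ge0 j i.
rewrite /offdiag [j == i]eq_sym (negbTE ij) => rji0 rij0.
have [r0|rij] := eqVneq (r i j) 0.
  by rewrite r0; under eq_fun do rewrite mul0r; rewrite !mul0r sqrtr0; exact: cvg_cst.
have rp : 0 < r i j by rewrite lt_neqAle eq_sym rij.
have -> : Num.sqrt (r i j * r j i) = r i j * Num.sqrt (r j i / r i j).
  rewrite -{2}(sqr_sqrtr rij0) sqrtrM // sqrtrM ?rji0 // sqrtrV //.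
  by field; rewrite gt_eqF // sqrtr_gt0.
apply: cvgM; first exact: cvg_cst.
have c1 : Num.sqrt (rn n j i / rn n i j) @[n --> \oo] --> Num.sqrt (r j i / r i j).
  apply: cvg_sqrt.
  apply: cvgM; first by apply: rn_cvg; rewrite eq_sym.
  by apply: cvgV => //; exact: rn_cvg.
apply: (cvg_near_eq _ c1).
have pos : \forall n \near \oo, 0 < rn n i j.
  by apply: (cvgr_gt _ (rn_cvg ij)).
near=> n; apply/esym; congr Num.sqrt.
have an : forall i, 0 < a n i by near: n.
have b : forall i j, a n i * rn n i j = a n j * rn n j i by near: n.
have p : 0 < rn n i j by near: n.
apply: (mulIf (lt0r_neq0 p)); rewrite divfK ?lt0r_neq0 //.
by rewrite mulrAC b mulrAC divff ?mul1r // lt0r_neq0.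
Unshelve. all: by end_near. Qed.

(** The near-maximiser [sqrt ((w i + e) / a n i)] of the chain with [n]
    fixed is inserted in the supremum that belongs to the limit rates. *)
Lemma sqrt_form_le w : (forall i, 0 <= w i) ->
  ((sqrt_form w)%:E <= reduced_rate r w)%E.
Proof.
move=> w0; have fin := reduced_rate_fin w0; have ge0 := reduced_rate_ge0 r w.
have : reduced_rate r w \is a fin_num by rewrite ge0_fin_numE.
move=> /fineK <-; rewrite lee_fin; set s := fine _.
have step e : 0 < e -> \sum_i \sum_j (w i * r' i j -
    Num.sqrt (w i * (w j + e)) * Num.sqrt (r' i j * r' j i)) <= s.
  move=> e0.
  have we i : 0 < w i + e by rewrite ltr_wpDl.
  have c : \sum_i \sum_j (w i * r' i j - (w i * (Num.sqrt (w j + e) / Num.sqrt (w i + e))) *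
     (r' i j * Num.sqrt (a n i / a n j))) @[n --> \oo] -->
     \sum_i \sum_j (w i * r' i j - (w i * (Num.sqrt (w j + e) / Num.sqrt (w i + e))) *
      Num.sqrt (r' i j * r' j i)).
    apply: cvg_sum_seq => i _ _; apply: cvg_sum_seq => j _ _.
    apply: cvgB; first exact: cvg_cst.
    by apply: cvgM; [exact: cvg_cst|exact: ratio_sqrt_cvg].
  apply: (@le_trans _ _ (\sum_i \sum_j (w i * r' i j -
     (w i * (Num.sqrt (w j + e) / Num.sqrt (w i + e))) * Num.sqrt (r' i j * r' j i)))).
    apply: ler_sum => i _; apply: ler_sum => j _; rewrite lerD2l lerN2.
    rewrite ler_wpM2r ?sqrtr_ge0 // sqrtrM // mulrCA [leRHS]mulrC ler_wpM2l ?sqrtr_ge0 //.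
    rewrite ler_pdivrMr ?sqrtr_gt0 // -{1}(sqr_sqrtr (w0 i)) expr2.
    by rewrite ler_wpM2l ?sqrtr_ge0 // ler_wsqrtr // lerDl ltW.
  apply: (cvg_limit_le c); near=> n.
  have an : forall i, 0 < a n i by near: n.
  have u0 i : 0 < Num.sqrt ((w i + e) / a n i) by rewrite sqrtr_gt0 divr_gt0.
  have := reduced_rate_ub r w u0.
  rewrite -[X in (_ <= X)%E](@fineK _ (reduced_rate r w)) ?ge0_fin_numE // lee_fin -/s.
  apply: le_trans; rewrite -sumrN ler_sum // => i _; rewrite -sumrN ler_sum // => j _.
  rewrite le_eqVlt; apply/orP; left; apply/eqP.
  have si : Num.sqrt (w i + e) != 0 by rewrite gt_eqF // sqrtr_gt0.
  have sai : Num.sqrt (a n i) != 0 by rewrite gt_eqF // sqrtr_gt0.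
  have saj : Num.sqrt (a n j) != 0 by rewrite gt_eqF // sqrtr_gt0.
  rewrite !sqrtrM ?(ltW (we _)) ?(ltW (an _)) // !sqrtrV ?(ltW (an _)) //.
  by field; rewrite si sai saj.
rewrite sqrt_formE //.
have c : \sum_i \sum_j (w i * r' i j - Num.sqrt (w i * (w j + k.+1%:R^-1)) *
    Num.sqrt (r' i j * r' j i)) @[k --> \oo] -->
  \sum_i \sum_j (w i * r' i j - Num.sqrt (w i * w j) * Num.sqrt (r' i j * r' j i)).
  apply: cvg_sum_seq => i _ _; apply: cvg_sum_seq => j _ _.
  apply: cvgB; first exact: cvg_cst.
  apply: cvgM; last exact: cvg_cst.
  apply: cvg_sqrt.
  apply: cvgM; first exact: cvg_cst.
  have h : w j + k.+1%:R^-1 @[k --> \oo] --> w j + 0.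
    by apply: cvgD; [exact: cvg_cst|exact: cvg_harmonic].
  by rewrite addr0 in h.
apply: (cvg_limit_le c); apply: nearW => k; apply: step.
by rewrite invr_gt0.
Unshelve. all: by end_near. Qed.

Lemma reduced_rate0_balance w : (forall i, 0 <= w i) -> reduced_rate r w = 0%E ->
  forall i j, w i * r' i j = w j * r' j i.
Proof.
move=> w0 I0 i j.
have : sqrt_form w <= 0 by have := sqrt_form_le w0; rewrite I0 lee_fin.
rewrite /sqrt_form pmulr_rle0 ?invr_gt0 // => h.
have nn k l : 0 <= (Num.sqrt (w k * r' k l) - Num.sqrt (w l * r' l k)) ^+ 2 by exact: sqr_ge0.
have : (Num.sqrt (w i * r' i j) - Num.sqrt (w j * r' j i)) ^+ 2 <= 0.
  apply: le_trans h; rewrite (bigD1 i) //= (bigD1 j) //= -addrA lerDl.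
  rewrite addr_ge0 ?sumr_ge0 // => k _; exact: sumr_ge0.
move=> h2; have : (Num.sqrt (w i * r' i j) - Num.sqrt (w j * r' j i)) ^+ 2 == 0.
  by rewrite eq_le h2 nn.
rewrite sqrf_eq0 subr_eq0 => /eqP /(congr1 (fun x => x ^+ 2)).
by rewrite !sqr_sqrtr ?mulr_ge0 ?offdiag_ge0.
Qed.

End LimitReversible.
End ReducedChain.

(** * Closed irreducible classes *)

Section ClosedClasses.
Context {R : realType} {N : nat}.
Variable r : 'I_N -> 'I_N -> R.
Local Notation r' := (offdiag r).
Hypothesis r_ge0 : forall i j, 0 <= r' i j.

Lemma offdiagE i j : i != j -> r' i j = r i j.
Proof. by rewrite /offdiag => /negbTE ->. Qed.

Lemma class_disjoint (C D : set 'I_N) k : closed_irreducible_class r C ->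
  closed_irreducible_class r D -> C k -> D k -> C = D.
Proof.
have sub (C' D' : set 'I_N) : closed_irreducible_class r C' ->
    closed_irreducible_class r D' -> C' k -> D' k -> C' `<=` D'.
  move=> [_ _ irr] [_ cl _] Ck Dk l Cl; have [s ps <-] := irr k l Ck Cl.
  elim: s k Dk {Ck Cl} ps => //= x s IH k Dk /andP[/and3P[_ _ rkx] ps].
  apply: IH ps; apply: contrapT => nD.
  by move: rkx; rewrite (cl _ _ Dk nD) ltxx.
by move=> cC cD Ck Dk; apply/seteqP; split; exact: sub.
Qed.

(** By balance, jumps with positive rate from the support of [w] can be reversed, so the
    states reachable from [i] form a closed class. *)
Lemma class_of_support (w : 'I_N -> R) i : (forall j, 0 <= w j) ->
  (forall i j, w i * r' i j = w j * r' j i) -> 0 < w i ->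
  exists2 C, closed_irreducible_class r C & C i.
Proof.
move=> w0 bal wi.
pose e : rel 'I_N := fun x y => [&& x != y, 0 < r x y & 0 < w x].
have e_sym : symmetric e.
  suff half x y : e x y -> e y x by move=> x y; apply/idP/idP; exact: half.
  move=> /and3P[xy rxy wx]; rewrite /e eq_sym xy /=.
  have : 0 < w y * r' y x by rewrite -bal mulr_gt0 ?offdiagE.
  have := w0 y; rewrite le_eqVlt => /predU1P[<-|wy]; first by rewrite mul0r ltxx.
  by rewrite pmulr_rgt0 // offdiagE 1?eq_sym // => ->.
have csym : connect_sym e by exact: sym_connect_sym.
have supp j : connect e i j -> 0 < w j.
  move=> /connectP[p pp ->]; elim: p i wi pp => //= x p IH k wk /andP[ekx pp].
  apply: IH pp; have : e x k by rewrite e_sym.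
  by case/and3P.
exists [set j | connect e i j]; last exact: connect0.
split; first by exists i; exact: connect0.
  move=> x y Cx nCy; have xy : x != y by apply/eqP => xy; apply: nCy; rewrite -xy.
  have := r_ge0 x y; rewrite offdiagE // le_eqVlt => /predU1P[//|rxy].
  exfalso; apply: nCy; apply: (connect_trans Cx (connect1 _)).
  by rewrite /e xy rxy supp.
move=> x y Cx Cy.
have /connectP[p pp lp] : connect e x y by apply: connect_trans Cy; rewrite csym.
exists p => //; elim: p x Cx pp {lp} => //= z p IH x Cx /andP[exz pp].
have Cz : connect e i z by exact: (connect_trans Cx (connect1 exz)).
rewrite IH // andbT /jump_rel.
case/and3P: exz => xz rxz _; rewrite xz rxz !andbT; exact: mem_set.
Qed.

Section OneClass.
Variable C : set 'I_N.
Hypothesis C_class : closed_irreducible_class r C.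

(** The density of [w] with respect to [rho] is harmonic on the class, hence constant
    by the maximum principle. *)
Lemma balance_proportional (rho w : 'I_N -> R) :
  (forall i, C i -> 0 < rho i) ->
  (forall i j, C i -> C j -> rho i * r' i j = rho j * r' j i) ->
  \sum_(i | i \in C) rho i = 1 ->
  (forall j, C j -> \sum_(i | i \in C) w i * r' i j = w j * \sum_(i | i \in C) r' j i) ->
  forall i, C i -> w i = (\sum_(j | j \in C) w j) * rho i.
Proof.
move=> rho0 rbal rho1 wst.
pose s := enum C.
have sC i : (i \in s) = (i \in C) by rewrite mem_enum.
have big_s (F : 'I_N -> R) : \sum_(i <- s) F i = \sum_(i | i \in C) F i by rewrite /s big_enum.
have [[c0 Cc0] _ irr] := C_class.
pose g i := w i / rho i.
have gw i : C i -> w i = rho i * g i.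
  by move=> Ci; rewrite /g mulrC divfK // gt_eqF // rho0.
have s_irr : sirr s r'.
  move=> x y; rewrite !sC => /set_mem Cx /set_mem Cy.
  have [p pp lp] := irr x y Cx Cy; exists p => //.
  elim: p x Cx pp {lp} => //= z p IH x Cx /andP[/and3P[Cz xz rxz] pp].
  by rewrite /sjump sC Cz xz offdiagE // rxz IH //; exact/set_mem.
have g_harm j : j \in s -> sgen s r' g j = 0.
  rewrite sC => /set_mem Cj.
  have : rho j * sgen s r' g j = 0.
    rewrite /sgen mulr_sumr big_s.
    transitivity (\sum_(i | i \in C) w i * r' i j - w j * \sum_(i | i \in C) r' j i).
      rewrite mulr_sumr -sumrB; apply: eq_bigr => i /set_mem Ci.
      by rewrite (gw i) // (gw j) // mulrBr mulrBr mulrA rbal //; ring.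
    by rewrite wst // subrr.
  by move/eqP; rewrite mulf_eq0 gt_eqF ?rho0 //= => /eqP.
(* [max_principle] compares with 0, so the value at [c0] is subtracted *)
have shift (h : 'I_N -> R) b j : sgen s r' (fun i => h i + b) j = sgen s r' h j.
  by apply: eq_bigr => i _; congr (_ * _); ring.
have c0s : c0 \in s by rewrite sC; exact: mem_set.
have r_ge0s x y : x \in s -> y \in s -> 0 <= r' x y by [].
have g_const i : C i -> g i = g c0.
  move=> Ci; have si : i \in s by rewrite sC; exact: mem_set.
  apply/eqP; rewrite eq_le; apply/andP; split; rewrite -subr_le0.
    have := max_principle r_ge0s (A := pred1 c0) (c := fun i => g i - g c0) s_irr c0s (eqxx _).
    apply=> //; first by move=> z zs _; rewrite shift g_harm.
    by move=> z zs /eqP ->; rewrite subrr.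
  have := max_principle r_ge0s (A := pred1 c0) (c := fun i => g c0 - g i) s_irr c0s (eqxx _).
  apply=> //; last by move=> z zs /eqP ->; rewrite subrr.
  move=> z zs _; have -> : sgen s r' (fun i => g c0 - g i) z = - sgen s r' g z.
    by rewrite -sumrN; apply: eq_bigr => i' _; ring.
  by rewrite g_harm // oppr0.
have wE i : C i -> w i = g c0 * rho i by move=> Ci; rewrite gw // g_const // mulrC.
move=> i Ci; rewrite wE //; congr (_ * _).
rewrite (eq_bigr (fun j => g c0 * rho j)); last by move=> j /set_mem; exact: wE.
by rewrite -mulr_sumr rho1 mulr1.
Qed.

Lemma stationary_proportional (rho w : 'I_N -> R) :
  (forall i, C i -> 0 < rho i) ->
  (forall i j, C i -> C j -> rho i * r' i j = rho j * r' j i) ->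
  \sum_(i | i \in C) rho i = 1 -> is_stationary C r w ->
  forall i, C i -> w i = rho i.
Proof.
move=> rho0 rbal rho1 [[_ w1] wst] i Ci.
rewrite fsum_fin in w1.
rewrite -[RHS]mul1r -w1; apply: (balance_proportional rho0 rbal rho1) Ci.
move=> j Cj; have := wst j Cj; rewrite fsum_fin /holding_rate fsum_fin.
have jC : j \in C by exact: mem_set.
have split1 (F G : 'I_N -> R) : (forall i, i != j -> F i = G i) ->
    \sum_(i | i \in C) F i = F j - G j + \sum_(i | i \in C) G i.
  move=> FG; rewrite (bigD1 j) //= [in RHS](bigD1 j) //= addrA subrK; congr (_ + _).
  by apply: eq_bigr => k /andP[_ kj]; exact: FG.
have -> : \sum_(i | i \in C) w i * r i j =
    w j * r j j - w j * r' j j + \sum_(i | i \in C) w i * r' i j.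
  by apply: (split1 (fun i => w i * r i j)) => k kj; rewrite (offdiagE kj).
have -> : \sum_(i | i \in C) r j i = r j j - r' j j + \sum_(i | i \in C) r' j i.
  by apply: split1 => k kj; rewrite offdiagE // eq_sym.
by rewrite mulrDr mulrBr; exact: addrI.
Qed.

Variables (a : nat -> 'I_N -> R) (rn : nat -> 'I_N -> 'I_N -> R).
Hypotheses (a_gt0 : \forall n \near \oo, forall i, 0 < a n i)
  (rn_balance : \forall n \near \oo, forall i j, a n i * rn n i j = a n j * rn n j i)
  (rn_cvg : forall i j, i != j -> rn n i j @[n --> \oo] --> r i j).

Lemma class_ratio_cvg i j : C i -> C j ->
  exists l : R, a n i / a n j @[n --> \oo] --> l.
Proof.
move=> Ci Cj; have [_ _ irr] := C_class; have [p pp lp] := irr i j Ci Cj.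
elim: p i Ci pp lp => [|k p IH] i Ci /=.
  move=> _ ->; exists 1; apply: (cvg_near_eq (g := fun=> 1) _ (cvg_cst _)).
  by apply: filterS a_gt0 => n an; rewrite divff // gt_eqF.
move=> /andP[/and3P[Ck ik rik] pp] lp.
have [l hl] := IH k (set_mem Ck) pp lp.
exists ((r k i / r i k) * l).
have c1 : (rn n k i / rn n i k) * (a n k / a n j) @[n --> \oo] --> (r k i / r i k) * l.
  apply: cvgM => //; apply: cvgM; first by apply: rn_cvg; rewrite eq_sym.
  by apply: cvgV; [rewrite gt_eqF|exact: rn_cvg].
apply: (cvg_near_eq _ c1).
have pos : \forall n \near \oo, 0 < rn n i k by apply: (cvgr_gt _ (rn_cvg ik)).
near=> n.
have an : forall i, 0 < a n i by near: n.
have b : forall i j, a n i * rn n i j = a n j * rn n j i by near: n.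
have q : 0 < rn n i k by near: n.
have h : rn n k i = a n i * rn n i k / a n k.
  by rewrite b mulrAC divff ?mul1r // gt_eqF.
by rewrite h; field; rewrite !gt_eqF.
Unshelve. all: by end_near. Qed.

Lemma balance_stationary (rho : 'I_N -> R) :
  (forall i, C i -> 0 < rho i) ->
  (forall i j, C i -> C j -> rho i * r' i j = rho j * r' j i) ->
  \sum_(i | i \in C) rho i = 1 -> is_stationary C r rho.
Proof.
move=> rho0 bal rho1; split; first by split=> [i Ci|]; [exact/ltW/rho0|rewrite fsum_fin].
move=> j Cj; rewrite /holding_rate !fsum_fin mulr_sumr; apply: eq_bigr => i /set_mem Ci.
have [->//|ij] := eqVneq i j.
by have := bal i j Ci Cj; rewrite !offdiagE // eq_sym.
Qed.

(** The ratios [a n i / a n j] converge along jumps with positive rate, hence along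
    paths, hence within the class. *)
Lemma class_limit : exists rho : 'I_N -> R,
  [/\ forall i, C i -> 0 < rho i,
      forall i j, C i -> C j -> rho i * r' i j = rho j * r' j i,
      \sum_(i | i \in C) rho i = 1 &
      forall i, C i -> a n i / (\sum_(j | j \in C) a n j) @[n --> \oo] --> rho i].
Proof.
have Tex i j : {l : R | C i -> C j -> a n i / a n j @[n --> \oo] --> l}.
  apply: cid; have [Ci|] := pselect (C i); have [Cj|] := pselect (C j); try by exists 0.
  by have [l] := class_ratio_cvg Ci Cj; exists l.
pose L i j := sval (Tex i j).
have Lc i j : C i -> C j -> a n i / a n j @[n --> \oo] --> L i j by exact: svalP (Tex i j).
pose S i := \sum_(j | j \in C) L j i.
have Lge0 i j : C i -> C j -> 0 <= L i j.
  move=> Ci Cj; apply: (cvg_limit_ge (Lc _ _ Ci Cj)); apply: filterS a_gt0 => n h.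
  by rewrite divr_ge0 ?ltW.
have Lii i : C i -> L i i = 1.
  move=> Ci; have h := Lc _ _ Ci Ci.
  rewrite -(cvg_lim _ h) //; apply/cvg_lim => //.
  apply: (cvg_near_eq (g := fun=> 1) _ (cvg_cst _)); apply: filterS a_gt0 => n an.
  by rewrite divff // gt_eqF.
have S1 i : C i -> 1 <= S i.
  move=> Ci; rewrite /S (bigD1 i) /=; last exact: mem_set.
  by rewrite Lii // lerDl sumr_ge0 // => j /andP[/set_mem Cj _]; exact: Lge0.
have S0 i : C i -> 0 < S i by move=> Ci; apply: lt_le_trans (S1 i Ci).
have cS i : C i -> a n i / (\sum_(j | j \in C) a n j) @[n --> \oo] --> (S i)^-1.
  move=> Ci.
  have c : (\sum_(j | j \in C) a n j / a n i)^-1 @[n --> \oo] --> (S i)^-1.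
    apply: cvgV; first by rewrite gt_eqF ?S0.
    by apply: cvg_sum_seq => j _ /set_mem Cj; exact: Lc.
  apply: (cvg_near_eq _ c); apply: filterS a_gt0 => n an.
  by rewrite -mulr_suml invfM invrK mulrC.
exists (fun i => (S i)^-1); split=> //.
- by move=> i Ci; rewrite invr_gt0 S0.
- move=> i j Ci Cj; rewrite /offdiag; case: eqVneq => [-> //|ij]; rewrite ?[j == i]eq_sym ?(negbTE ij).
  have h1 : a n i / (\sum_(j | j \in C) a n j) * rn n i j @[n --> \oo] --> (S i)^-1 * r i j.
    by apply: cvgM; [exact: cS|exact: rn_cvg].
  have h2 : a n j / (\sum_(j | j \in C) a n j) * rn n j i @[n --> \oo] --> (S j)^-1 * r j i.
    by apply: cvgM; [exact: cS|apply: rn_cvg; rewrite eq_sym].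
  rewrite -(cvg_lim _ h1) //; apply/cvg_lim => //.
  apply: (cvg_near_eq _ h2); apply: filterS rn_balance => n b.
  by rewrite mulrAC -b mulrAC.
have [[c0 Cc0] _ _] := C_class.
have h : \sum_(i | i \in C) (a n i / (\sum_(j | j \in C) a n j)) @[n --> \oo] -->
    \sum_(i | i \in C) (S i)^-1.
  by apply: cvg_sum_seq => i _ /set_mem Ci; exact: cS.
rewrite -(cvg_lim _ h) //; apply/cvg_lim => //.
apply: (cvg_near_eq (g := fun=> 1) _ (cvg_cst _)); apply: filterS a_gt0 => n an.
rewrite -mulr_suml divff // gt_eqF // (bigD1 c0) /=; last exact: mem_set.
by rewrite ltr_wpDr // sumr_ge0 // => i _; exact: ltW.
Qed.

End OneClass.
End ClosedClasses.

(** * One reversible chain with wells *)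

Section OneChain.
Context {R : realType} {T : choiceType}.
Variables (E : set T) (r : T -> T -> R) (w : T -> R).
Hypothesis finE : finite_set E.
Local Notation s := (finmap.enum_fset (fset_set E)).
Hypotheses (r_ok : is_jump_rate E r) (r_irr : irreducible E r)
  (w_st : is_stationary E r w) (w_bal : detailed_balance E r w).

Let us : uniq s. Proof. exact: finmap.fset_uniq. Qed.

Lemma enumP x : reflect (E x) (x \in s).
Proof. by rewrite in_enum //; apply: (iffP idP) => [/set_mem|/mem_set]. Qed.

Lemma sum_sub (F : T -> R) (A : set T) : A `<=` E ->
  \sum_(x \in A) F x = \sum_(x <- s | x \in A) F x.
Proof.
move=> AE; rewrite fsbig_finite; last exact: sub_finite_set finE.
rewrite -[RHS]big_filter; apply: perm_big; apply: uniq_perm.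
- exact: finmap.fset_uniq.
- exact: filter_uniq.
move=> x; rewrite in_enum; last exact: sub_finite_set finE.
rewrite mem_filter; apply/idP/andP => [xA|[]//]; split=> //.
by apply/enumP/AE/set_mem.
Qed.

Lemma sum_all (F : T -> R) : \sum_(x \in E) F x = \sum_(x <- s) F x.
Proof. by rewrite fsbig_finite. Qed.

Lemma chain_rate_ge0 x y : x \in s -> y \in s -> 0 <= r x y.
Proof. by move=> /enumP xE /enumP yE; exact: r_ok.1. Qed.

Lemma chain_sirr : sirr s r.
Proof.
move=> x y /enumP Ex /enumP Ey; have [p pp lp] := r_irr Ex Ey; exists p => //.
by apply: sub_path pp => a b /and3P[bE ab rab]; rewrite /sjump in_enum // bE ab.
Qed.

Lemma pi_bal x y : x \in s -> y \in s -> w x * r x y = w y * r y x.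
Proof. by move=> /enumP Ex /enumP Ey; exact: w_bal. Qed.

Lemma pi_ge0 x : x \in s -> 0 <= w x.
Proof. by move=> /enumP Ex; exact: w_st.1.1. Qed.

Lemma pi_sum1 : \sum_(x <- s) w x = 1.
Proof. by rewrite -sum_all; exact: w_st.1.2. Qed.

Lemma pi_gt0 x : x \in s -> 0 < w x.
Proof.
move=> xs.
have [x0 x0s w0] : exists2 x0, x0 \in s & 0 < w x0.
  apply: contrapT => h; have : \sum_(x <- s) w x = 0.
    rewrite big_seq big1 // => y ys; apply/eqP; rewrite eq_le pi_ge0 // andbT leNgt.
    by apply/negP => wy; apply: h; exists y.
  by rewrite pi_sum1 => /eqP; rewrite oner_eq0.
have [p pp <-] := chain_sirr x0s xs.
elim: p x0 x0s w0 pp => //= z p IH y ys wy /andP[/and3P[zs yz ryz] pp].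
apply: IH pp => //; have : 0 < w z * r z y by rewrite -pi_bal // mulr_gt0.
have := pi_ge0 zs; rewrite le_eqVlt => /predU1P[<-|//].
by rewrite mul0r ltxx.
Qed.

Lemma rate_functionalE (v : T -> R) : rate_functional E r v =
  ereal_sup [set (- \sum_(x <- s) sgen s r u x / u x * v x)%:E |
    u in [set u | forall x, x \in s -> 0 < u x]].
Proof.
congr ereal_sup; apply/seteqP; split=> _ [u u0 <-]; exists u.
- by move=> x /enumP; exact: u0.
- rewrite sum_all; congr (- _)%:E; apply: eq_bigr => x _.
  by rewrite /generator sum_all.
- by move=> x Ex; apply: u0; exact/enumP.
rewrite sum_all; congr (- _)%:E; apply: eq_bigr => x _.
by rewrite /generator sum_all.
Qed.

Lemma rate_functional_ub (v u : T -> R) : (forall x, x \in s -> 0 < u x) ->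
  ((- \sum_(x <- s) sgen s r u x / u x * v x)%:E <= rate_functional E r v)%E.
Proof. by move=> u0; rewrite rate_functionalE; apply: ereal_sup_ubound; exists u. Qed.

Lemma rate_functional_le_energy (v f : T -> R) :
  (forall x, x \in s -> v x = w x * f x ^+ 2) ->
  (rate_functional E r v <= (energy s r w f)%:E)%E.
Proof.
move=> vf; rewrite rate_functionalE; apply: ge_ereal_sup => _ [u u0 <-].
rewrite lee_fin; apply: le_trans (rate_le_energy pi_bal chain_rate_ge0 pi_ge0 f u0).
rewrite lerN2 big_seq [leRHS]big_seq le_eqVlt; apply/orP; left; apply/eqP.
by apply: eq_bigr => x xs; rewrite vf.
Qed.

Definition density (v : T -> R) x : R := Num.sqrt (v x / w x).

Lemma densityE v x : x \in s -> 0 <= v x -> v x = w x * density v x ^+ 2.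
Proof.
move=> xs v0; rewrite /density sqr_sqrtr ?divr_ge0 ?pi_ge0 //.
by rewrite mulrC divfK // gt_eqF // pi_gt0.
Qed.

Lemma energy_density_le (v : T -> R) : (forall x, x \in s -> 0 <= v x) ->
  ((energy s r w (density v))%:E <= rate_functional E r v)%E.
Proof.
move=> v0; apply/lee_addgt0Pr => e e0; rewrite -leeBlDr // -EFinB.
have [u u0 h] := energy_le_rate pi_bal pi_ge0 e0 (fun x _ => sqrtr_ge0 _ : 0 <= density v x).
apply: le_trans (rate_functional_ub v u0); rewrite lee_fin; apply: le_trans h _.
rewrite lerN2 big_seq [leRHS]big_seq le_eqVlt; apply/orP; left; apply/eqP.
by apply: eq_bigr => x xs; rewrite -densityE // v0.
Qed.

Lemma massE (A : set T) : A `<=` E -> mass w A = \sum_(x <- s | x \in A) w x.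
Proof. exact: sum_sub. Qed.

Lemma mass_gt0 (A : set T) x : A `<=` E -> A x -> 0 < mass w A.
Proof.
move=> AE Ax; have xs : x \in s by apply/enumP/AE.
rewrite massE // (bigD1_seq_cond _ xs) //=; last exact: mem_set.
rewrite ltr_pwDl ?pi_gt0 // big_seq_cond sumr_ge0 // => y /and3P[ys _ _].
exact: pi_ge0.
Qed.

(** The Dirichlet form of a well keeps only the jumps inside the well. *)
Lemma dirichlet_le_energy (A : set T) (f : T -> R) : A `<=` E -> 0 < mass w A ->
  mass w A * dirichlet r w A f <= energy s r w f.
Proof.
move=> AE A0; rewrite /dirichlet mulrA mulrCA mulrA mulfK ?gt_eqF // /energy.
rewrite ler_pM2l ?invr_gt0 // sum_sub //.
have term x y : x \in s -> y \in s -> 0 <= w x * r x y * (f y - f x) ^+ 2.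
  move=> xs ys; apply: mulr_ge0; last exact: sqr_ge0.
  by apply: mulr_ge0; [exact: pi_ge0|exact: chain_rate_ge0].
rewrite big_mkcond big_seq [leRHS]big_seq ler_sum // => x xs.
case: ifP => _; last by rewrite big_seq sumr_ge0 // => y ys; exact: term.
rewrite sum_sub; last by move=> y [Ay _]; exact: AE.
rewrite big_mkcond big_seq [leRHS]big_seq ler_sum // => y ys.
by case: ifP => _ //; exact: term.
Qed.

Section Wells.
Variables (m : nat) (W : 'I_m -> set T).
Hypotheses (W_sub : forall i, W i `<=` E) (W_triv : trivIset [set: 'I_m] W)
  (W_neq0 : forall i, W i !=set0) (m_gt1 : exists i j : 'I_m, i != j).

Local Notation inA := (fun z => `[< (\bigcup_k W k) z >]).
Local Notation tr := (strace s r inA).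

Lemma W_disj i j x : W i x -> W j x -> i = j.
Proof. by move=> Wi Wj; apply: W_triv => //; exists x. Qed.

Lemma hold_gt0 x : x \in s -> 0 < \sum_(y <- s) r x y.
Proof.
move=> xs.
have [y ys xy] : exists2 y, y \in s & y != x.
  have [i [j ij]] := m_gt1; have [y Wy] := W_neq0 i; have [z Wz] := W_neq0 j.
  have [yx|yx] := eqVneq y x; last by exists y => //; apply/enumP/(W_sub Wy).
  exists z; first exact/enumP/(W_sub Wz).
  apply/eqP => zx; move: ij; rewrite (@W_disj i j x) ?eqxx //; first by rewrite -yx.
  by rewrite -zx.
have [[|z p] /=] := chain_sirr xs ys; first by move=> _ yx; rewrite yx eqxx in xy.
move=> /andP[/and3P[zs xz rxz] _] _.
rewrite (bigD1_seq z) //= ltr_pwDl // big_seq_cond sumr_ge0 // => u /andP[u_s _].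
exact: chain_rate_ge0.
Qed.

Lemma wells_neq0 : exists2 a, a \in s & inA a.
Proof.
have [i _] := m_gt1; have [y Wy] := W_neq0 i; exists y; first exact/enumP/(W_sub Wy).
by apply/asboolP; exists i.
Qed.

Lemma in_wells i x : W i x -> inA x.
Proof. by move=> Wx; apply/asboolP; exists i. Qed.

Let trace0 x y : x \in s -> y \in s -> inA y -> 0 <= tr x y.
Proof. exact: (strace_ge0 us chain_rate_ge0 hold_gt0). Qed.

(** The stationary flow of the trace chain from one well to another. *)
Definition flow i j :=
  \sum_(x <- s | x \in W i) w x * \sum_(y <- s | y \in W j) tr x y.

Lemma jump_out_ge0 j x : x \in s -> 0 <= \sum_(y <- s | y \in W j) tr x y.
Proof.
move=> xs; rewrite big_seq_cond sumr_ge0 // => y /andP[ys /set_mem Wy].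
by rewrite trace0 // (in_wells Wy).
Qed.

Lemma flow_ge0 i j : 0 <= flow i j.
Proof.
rewrite /flow big_seq_cond sumr_ge0 // => x /andP[xs _].
by rewrite mulr_ge0 ?pi_ge0 // jump_out_ge0.
Qed.

Lemma flow_sym i j : flow i j = flow j i.
Proof.
rewrite /flow; under eq_bigr do rewrite mulr_sumr.
rewrite exchange_big /= big_seq_cond [RHS]big_seq_cond.
apply: eq_bigr => y /andP[ys /set_mem Wy]; rewrite mulr_sumr.
rewrite big_seq_cond [RHS]big_seq_cond; apply: eq_bigr => x /andP[xs /set_mem Wx].
apply: (strace_balance us chain_rate_ge0 hold_gt0 wells_neq0 pi_bal) => //.
  exact: in_wells Wx.
exact: in_wells Wy.
Qed.

Lemma sum_wells (F : T -> R) :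
  \sum_(x <- s | inA x) F x = \sum_i \sum_(x <- s | x \in W i) F x.
Proof.
under [RHS]eq_bigr do rewrite big_mkcond /=.
rewrite exchange_big /= big_mkcond /=; apply: eq_bigr => x _.
case: asboolP => [[i _ Wi]|nA].
  rewrite (bigD1 i) //= mem_set // big1 ?addr0 // => j ji.
  by rewrite memNset // => Wj; move: ji; rewrite (W_disj Wi Wj) eqxx.
rewrite big1 // => i _; rewrite memNset // => Wi; apply: nA; by exists i.
Qed.

Definition well_fun (h : 'I_m -> R) x := \sum_i (x \in W i)%:R * h i.

Lemma well_funE h i x : W i x -> well_fun h x = h i.
Proof.
move=> Wi; rewrite /well_fun (bigD1 i) //= mem_set // mul1r big1 ?addr0 // => j ji.
by rewrite memNset ?mul0r // => Wj; move: ji; rewrite (W_disj Wi Wj) eqxx.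
Qed.

Definition well_ext h := hext s r inA (well_fun h).

Lemma well_extE h i x : W i x -> well_ext h x = h i.
Proof.
move=> Wx; have xs : x \in s by apply/enumP/(W_sub Wx).
by rewrite /well_ext hext_in ?(in_wells Wx) // (well_funE _ Wx).
Qed.

Lemma well_ext_ge h c x : (forall i, c <= h i) -> x \in s -> c <= well_ext h x.
Proof.
move=> ch xs; apply: (hext_ge us chain_rate_ge0 chain_sirr hold_gt0 wells_neq0) => //.
by move=> y ys /asboolP[i _ Wy]; rewrite (well_funE _ Wy).
Qed.

Lemma energy_well_ext h : energy s r w (well_ext h) =
  2^-1 * \sum_i \sum_j flow i j * (h j - h i) ^+ 2.
Proof.
rewrite (energy_hext us chain_rate_ge0 chain_sirr hold_gt0 wells_neq0 pi_bal).
congr (_ * _); rewrite sum_wells; apply: eq_bigr => i _.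
under eq_bigr do rewrite sum_wells.
rewrite exchange_big /=; apply: eq_bigr => j _.
rewrite /flow mulr_suml; apply: eq_bigr => x /set_mem Wx.
rewrite mulr_sumr mulr_suml; apply: eq_bigr => y /set_mem Wy.
by rewrite !(well_funE _ Wx) !(well_funE _ Wy).
Qed.

(** The harmonic extension of [h] as test function: its generator vanishes off the
    wells. *)
Lemma rate_ge_wells (v : T -> R) h : (forall i, 0 < h i) ->
  ((- \sum_i \sum_j (\sum_(x <- s | x \in W i) v x * \sum_(y <- s | y \in W j) tr x y)
     * ((h j - h i) / h i))%:E <= rate_functional E r v)%E.
Proof.
move=> h0.
have [i0 _] := m_gt1.
have [c c0 ch] : exists2 c : R, 0 < c & forall i, c <= h i.
  have [i _ hi] : exists2 i, i \in enum 'I_m & forall j, j \in enum 'I_m -> - h j <= - h i.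
    apply: (seq_argmax (fun i => - h i)); apply/eqP => e0.
    by have := mem_enum 'I_m i0; rewrite e0.
  by exists (h i) => // j; rewrite -lerN2; apply: hi; rewrite mem_enum.
have u0 x : x \in s -> 0 < well_ext h x.
  by move=> xs; apply: lt_le_trans c0 _; exact: well_ext_ge.
apply: le_trans (rate_functional_ub v u0); rewrite lee_fin lerN2 le_eqVlt.
apply/orP; left; apply/eqP.
rewrite (bigID inA) /= [X in _ + X]big_seq_cond [X in _ + X]big1 ?addr0; last first.
  move=> x /andP[xs nA].
  by rewrite (sgen_hext_out us chain_rate_ge0 hold_gt0 wells_neq0) // !mul0r.
rewrite sum_wells; apply: eq_bigr => i _.
rewrite [LHS]big_seq_cond.
rewrite [LHS](eq_bigr (fun x => \sum_j (v x * \sum_(y <- s | y \in W j) tr x y) *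
   ((h j - h i) / h i))); last first.
  move=> x /andP[xs /set_mem Wx].
  rewrite (sgen_hext_in us chain_rate_ge0 chain_sirr hold_gt0 wells_neq0) //; last exact: in_wells Wx.
  rewrite (well_extE _ Wx) sum_wells.
  have -> : \sum_j \sum_(y <- s | y \in W j) tr x y * (well_fun h y - well_fun h x) =
      \sum_j (\sum_(y <- s | y \in W j) tr x y) * (h j - h i).
    apply: eq_bigr => j _; rewrite mulr_suml; apply: eq_bigr => y /set_mem Wy.
    by rewrite (well_funE _ Wx) (well_funE _ Wy).
  rewrite !mulr_suml; apply: eq_bigr => j _; ring.
rewrite -[LHS]big_seq_cond exchange_big /=; apply: eq_bigr => j _.
by rewrite -mulr_suml.
Qed.

Variables (disp : measure_display) (Omega : measurableType disp)
  (X : R -> Omega -> T) (P : T -> probability Omega R).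
Hypothesis mc : is_markov_chain E r X P.

Lemma mean_jump_rateE i j : i != j ->
  mean_jump_rate E r X P w W i j = (mass w (W i))^-1 * flow i j.
Proof.
move=> ij; rewrite /mean_jump_rate; congr (_ * _); rewrite sum_sub //.
rewrite /flow big_seq_cond [RHS]big_seq_cond; apply: eq_bigr => x /andP[xs /set_mem Wx].
congr (_ * _); rewrite sum_sub //.
apply: eq_bigr => y /set_mem Wy.
apply: trace_rateE => //.
- exact: chain_rate_ge0.
- exact: chain_sirr.
- exact: hold_gt0.
- by move=> z [k _ Wz]; exact: W_sub Wz.
- exact/enumP.
- by exists j.
by move=> xy; move: ij; rewrite (@W_disj i j x) ?eqxx // xy.
Qed.

End Wells.
End OneChain.

(** * Subsequences *)

Section Subsequences.

Lemma subseq_ge (phi : nat -> nat) : (forall k, (phi k < phi k.+1)%N) ->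
  forall k, (k <= phi k)%N.
Proof. by move=> h; elim=> // k IH; exact: leq_ltn_trans IH (h k). Qed.

Lemma subseq_mono (phi : nat -> nat) : (forall k, (phi k < phi k.+1)%N) ->
  forall j k, (j <= k)%N -> (phi j <= phi k)%N.
Proof.
move=> h j; elim=> [|k IH]; first by rewrite leqn0 => /eqP ->.
rewrite leq_eqVlt => /predU1P[->//|]; rewrite ltnS => /IH jk.
exact: leq_trans jk (ltnW (h k)).
Qed.

Lemma subseq_oo (phi : nat -> nat) : (forall k, (phi k < phi k.+1)%N) ->
  forall A : set nat, \oo A -> (phi @ \oo) A.
Proof.
move=> h A [N _ hN]; exists N => // k /= Nk; apply: hN => /=.
exact: leq_trans Nk (subseq_ge h k).
Qed.

(** Negated eventual statements are used through subsequences. *)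
Lemma frequently_subseq (A : set nat) : ~ (\forall n \near \oo, A n) ->
  exists2 phi : nat -> nat, (forall k, (phi k < phi k.+1)%N) & forall k, ~ A (phi k).
Proof.
move=> nA.
have pick N : {n | (N < n)%N /\ ~ A n}.
  apply: cid; apply: contrapT => h; apply: nA; exists N.+1 => // n /= Nn.
  by apply: contrapT => An; apply: h; exists n.
pose phi := fix phi k := if k is k'.+1 then sval (pick (phi k')) else sval (pick 0%N).
exists phi => [k|[|k]] /=.
- by have [] := svalP (pick (phi k)).
- by have [] := svalP (pick 0%N).
by have [] := svalP (pick (phi k)).
Qed.

Lemma cvg_finer (T : Type) (X : nat -> T) (F G : set_system nat) (l : set_system T) :
  (forall A, G A -> F A) -> X @ G --> l -> X @ F --> l.
Proof. by move=> GF XG A lA; apply: GF; exact: XG. Qed.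

(** To apply the inequality for full sequences, the subsequence is filled up with the
    constant [x]. *)
Lemma subseq_liminf (R : realType) (T : topologicalType)
    (U_ : nat -> T -> \bar R) (U : T -> \bar R) :
  (forall (x_ : nat -> T) x, x_ @ \oo --> x ->
     (U x <= limn_einf (fun n => U_ n (x_ n)))%E) ->
  forall (phi : nat -> nat) (x_ : nat -> T) x (c : R),
    (forall k, (phi k < phi k.+1)%N) -> x_ (phi k) @[k --> \oo] --> x ->
    (\forall k \near \oo, (U_ (phi k) (x_ (phi k)) <= c%:E)%E) -> (U x <= c%:E)%E.
Proof.
move=> liminf phi x_ x c phi_incr xx Uc.
pose y n := if `[< exists k, phi k = n >] then x_ n else x.
have yx : y @ \oo --> x.
  move=> A xA; have [K _ hK] := xx A xA; exists (phi K) => // n /= Kn.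
  rewrite /y; case: asboolP => [[k kn]|_]; last exact: nbhs_singleton xA.
  rewrite -kn; apply: hK => /=; rewrite leqNgt; apply/negP => kK.
  have := leq_trans (phi_incr k) (subseq_mono phi_incr kK).
  by rewrite kn ltnNge Kn.
have yphi k : y (phi k) = x_ (phi k).
  by rewrite /y; case: asboolP => // -[]; exists k.
apply: (@lee_real_below R) => b bU.
have [N _ hN] := limn_einf_gt (liminf y x yx) bU.
have [K _ hK] := Uc.
pose k := maxn N K.
have /ltW := hN (phi k) (leq_trans (leq_maxl N K) (subseq_ge phi_incr k)).
by rewrite yphi => h; apply: le_trans h (hK k (leq_maxr _ _)).
Qed.

End Subsequences.

(** * Rates between the wells of one level *)

Section Expansion.
Context {R : realType} {d : nat}.
Local Notation V := 'rV[R]_d.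
Variables (Xi : space R d) (rate : nat -> V -> V -> R) (pi : nat -> V -> R).
Hypotheses (Xi_ok : is_state_space Xi)
  (rate_ok : forall n, (0 < n)%N -> is_jump_rate (grid Xi n) (rate n))
  (chain_irr : forall n, (0 < n)%N -> irreducible (grid Xi n) (rate n))
  (pi_stationary : forall n, (0 < n)%N -> is_stationary (grid Xi n) (rate n) (pi n))
  (pi_reversible : forall n, (0 < n)%N -> detailed_balance (grid Xi n) (rate n) (pi n)).

Local Notation grid_seq n := (finmap.enum_fset (fset_set (grid Xi n))).

Lemma grid_carrier n : grid Xi n `<=` carrier Xi.
Proof. by move=> x []. Qed.

Lemma grid_seqP n x : (0 < n)%N -> reflect (grid Xi n x) (x \in grid_seq n).
Proof. by move=> n0; apply: enumP; exact: grid_finite. Qed.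

Section Level.
Variables (m : nat) (W : 'I_m -> nat -> set V) (Delta : nat -> set V)
  (theta : nat -> R) (r : 'I_m -> 'I_m -> R)
  (disp : measure_display) (Omega : nat -> measurableType disp)
  (X : forall n, R -> Omega n -> V) (P : forall n, V -> probability (Omega n) R).
Hypotheses (chain_X : forall n, (0 < n)%N ->
      is_markov_chain (grid Xi n) (rate n) (@X n) (@P n))
  (W_partition : forall n, (0 < n)%N ->
      is_partition (grid Xi n) (fun j => W j n) (Delta n))
  (theta_gt0 : forall n, (0 < n)%N -> 0 < theta n)
  (r_lim : forall i j, i != j ->
     theta n * mean_jump_rate (grid Xi n) (rate n) (@X n) (@P n) (pi n)
          (fun k => W k n) i j @[n --> \oo] --> r i j)
  (m_gt1 : exists i j : 'I_m, i != j)
  (W_neq0 : \forall n \near \oo, forall j, W j n !=set0).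

Local Notation wells n := (fun k => W k n).
Local Notation fl n := (flow (grid Xi n) (rate n) (pi n) (wells n)).

Definition well_mass n j := mass (pi n) (W j n).

Definition scaled_rate n i j := theta n * ((well_mass n i)^-1 * fl n i j).

Lemma scaled_rateE n i j : well_mass n i != 0 ->
  well_mass n i * scaled_rate n i j = theta n * fl n i j.
Proof. by move=> a0; rewrite /scaled_rate; field. Qed.

Lemma W_grid j n : (0 < n)%N -> W j n `<=` grid Xi n.
Proof. by move=> /W_partition[_ _ <-] x Wx; left; exists j. Qed.

Lemma W_disjoint n i j x : (0 < n)%N -> W i n x -> W j n x -> i = j.
Proof. by move=> /W_partition[tW _ _] Wi Wj; apply: tW => //; exists x. Qed.

Lemma well_mass_gt0 : \forall n \near \oo, forall j, 0 < well_mass n j.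
Proof.
near=> n => j.
have n0 : (0 < n)%N by near: n; exists 1%N.
have W0 : forall j, W j n !=set0 by near: n.
have [x Wx] := W0 j.
have h := mass_gt0 (grid_finite Xi_ok n0) (chain_irr n0)
  (pi_stationary n0) (pi_reversible n0) (W_grid (j := j) n0) Wx.
exact: h.
Unshelve. all: by end_near. Qed.

Lemma scaled_rate_ge0 : \forall n \near \oo, forall i j, 0 <= scaled_rate n i j.
Proof.
near=> n => i j.
have n0 : (0 < n)%N by near: n; exists 1%N.
have W0 : forall j, W j n !=set0 by near: n.
have a0 : forall j, 0 < well_mass n j by near: n; exact: well_mass_gt0.
have [tW _ _] := W_partition n0.
have h := flow_ge0 (W := wells n) (grid_finite Xi_ok n0) (rate_ok n0) (chain_irr n0)
  (pi_stationary n0) (fun k => @W_grid k n n0) tW W0 m_gt1 i j.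
apply: mulr_ge0; first exact: ltW (theta_gt0 n0).
by apply: mulr_ge0 => //; rewrite invr_ge0 ltW.
Unshelve. all: by end_near. Qed.

Lemma scaled_rate_balance : \forall n \near \oo, forall i j,
  well_mass n i * scaled_rate n i j = well_mass n j * scaled_rate n j i.
Proof.
near=> n => i j.
have n0 : (0 < n)%N by near: n; exists 1%N.
have W0 : forall j, W j n !=set0 by near: n.
have a0 : forall j, 0 < well_mass n j by near: n; exact: well_mass_gt0.
have [tW _ _] := W_partition n0.
have S := flow_sym (W := wells n) (grid_finite Xi_ok n0) (rate_ok n0) (chain_irr n0)
  (pi_reversible n0) (fun k => @W_grid k n n0) tW W0 m_gt1 i j.
by rewrite !scaled_rateE ?gt_eqF // S.
Unshelve. all: by end_near. Qed.

Lemma scaled_rate_cvg i j : i != j -> scaled_rate n i j @[n --> \oo] --> r i j.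
Proof.
move=> ij; apply: (cvg_near_eq _ (r_lim ij)); near=> n.
have n0 : (0 < n)%N by near: n; exists 1%N.
have W0 : forall j, W j n !=set0 by near: n.
have [tW _ _] := W_partition n0.
have h := mean_jump_rateE (W := wells n) (pi n) (grid_finite Xi_ok n0) (rate_ok n0)
  (chain_irr n0) (fun k => @W_grid k n n0) tW W0 m_gt1 (chain_X n0) ij.
by rewrite /scaled_rate h.
Unshelve. all: by end_near. Qed.

End Level.

(** * The base wells *)

Lemma mass_set0 (w : V -> R) : mass w set0 = 0.
Proof. exact: fsbig_set0. Qed.

Section BaseWells.
Variables (N1 : nat) (x : 'I_N1 -> V) (W1 : 'I_N1 -> nat -> set V) (beta : nat -> R).
Hypotheses (x_Xi : forall j, carrier Xi (x j))
  (W1_sub : forall j n, (0 < n)%N -> W1 j n `<=` grid Xi n)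
  (W1_disj : forall i j n y, (0 < n)%N -> W1 i n y -> W1 j n y -> i = j)
  (W1_weak : forall j : 'I_N1,
      weak_cvg Xi (fun n => cond_measure (pi n) (W1 j n))
        (fun A => \d_(x j : borelV R d) A))
  (W1_ball : exists2 eps : R, 0 < eps &
      forall j n, (0 < n)%N -> sball Xi (x j) eps `&` grid Xi n `<=` W1 j n)
  (beta_gt0 : forall n, (0 < n)%N -> 0 < beta n)
  (W1_gap : forall n (j : 'I_N1) (h : V -> R), (0 < n)%N ->
     forall z, W1 j n z ->
            \sum_(y \in W1 j n)
              pi n y / mass (pi n) (W1 j n) * (h y - h z) ^+ 2
            <= beta n * dirichlet (rate n) (pi n) (W1 j n) h).

Local Notation a1 n i := (mass (pi n) (W1 i n)).

(** The measure with mass [b i] at [x i], seen by test functions. *)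
Definition atomic (mu : prob Xi) (b : 'I_N1 -> R) :=
  forall f : test_fun Xi, test_integrals mu f = \sum_i b i * sval f (x i).

Lemma mass_W1E n i : (0 < n)%N -> a1 n i = \sum_(y <- grid_seq n | y \in W1 i n) pi n y.
Proof. by move=> n0; apply: massE; [exact: grid_finite|exact: W1_sub]. Qed.

Lemma a1_gt0_near i : \forall n \near \oo, 0 < a1 n i.
Proof.
have [mu_ [mu [mu_eq _ _]]] := W1_weak i; near=> n.
have n0 : (0 < n)%N by near: n; exists 1%N.
have h : meas_eq (prob_measure (mu_ n)) (cond_measure (pi n) (W1 i n)) by near: n.
have := h setT measurableT; rewrite /cond_measure setIT /prob_measure probability_setT.
move=> /esym/eqP; rewrite eqe => /eqP m1.
have : a1 n i != 0.
  by apply/eqP => a0; move: m1 => /eqP; rewrite a0 mul0r eq_sym oner_eq0.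
rewrite lt_neqAle eq_sym => -> /=.
rewrite mass_W1E // big_seq_cond sumr_ge0 // => y /andP[ys _].
exact: (pi_ge0 (grid_finite Xi_ok n0) (pi_stationary n0)).
Unshelve. all: by end_near. Qed.

Definition point_mass (mu : prob Xi) y : R := fine (prob_measure mu [set y]).

Lemma point_mass_ge0 mu y : 0 <= point_mass mu y.
Proof. by rewrite fine_ge0. Qed.

Lemma point_mass_sum mu n : (0 < n)%N -> prob_measure mu (grid Xi n) = 1%E ->
  \sum_(y <- grid_seq n) point_mass mu y = 1.
Proof.
move=> n0 mu1; have fG := grid_finite Xi_ok n0.
have := mass_enum fG mu1 (finite_borel fG).
have -> : fine (sval mu (grid Xi n)) = 1 by exact: (congr1 fine mu1).
move=> ->; rewrite big_seq [RHS]big_seq_cond; apply: eq_bigl => y.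
by rewrite in_enum // andbb.
Qed.

Definition well_prob mu n i := \sum_(y <- grid_seq n | y \in W1 i n) point_mass mu y.

Lemma sum_disjoint_wells (D : pred 'I_N1) n (F : V -> R) : (0 < n)%N ->
  \sum_(i | D i) \sum_(y <- grid_seq n | y \in W1 i n) F y =
  \sum_(y <- grid_seq n | y \in \bigcup_(i in [set i | D i]) W1 i n) F y.
Proof.
move=> n0; under eq_bigr do rewrite big_mkcond /=.
rewrite exchange_big /= [RHS]big_mkcond /=; apply: eq_bigr => y _.
case: ifPn => [/set_mem[i Di Wi]|/negP nW].
  rewrite (bigD1 i) //= mem_set // big1 ?addr0 // => j /andP[_ ji].
  by rewrite memNset // => Wj; move: ji; rewrite (W1_disj n0 Wi Wj) eqxx.
rewrite big1 // => i Di; rewrite memNset // => Wi; apply: nW.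
by apply: mem_set; exists i.
Qed.

Lemma well_prob_sum mu n : (0 < n)%N -> prob_measure mu (grid Xi n) = 1%E ->
  \sum_i well_prob mu n i <= 1.
Proof.
move=> n0 mu1; rewrite /well_prob sum_disjoint_wells // -(point_mass_sum n0 mu1).
rewrite big_mkcond ler_sum // => y _.
by case: ifP => // _; exact: point_mass_ge0.
Qed.

(** A bump function at [x i] supported in the ball that belongs to the [i]-th well gives
    a lower bound; since the weights [b] have total mass 1, the lower bounds for all
    wells also give the upper bounds. *)
Lemma well_prob_cvg (F : set_system nat) {FF : ProperFilter F}
    (mu_ : nat -> prob Xi) mu b :
  (forall A, \oo A -> F A) -> mu_ @ F --> mu -> atomic mu b ->
  (forall i, 0 <= b i) -> \sum_i b i = 1 ->
  (\forall n \near F, prob_measure (mu_ n) (grid Xi n) = 1%E) ->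
  forall i, well_prob (mu_ n) n i @[n --> F] --> b i.
Proof.
move=> oF mu_cvg mub b0 b1 mu1.
have [eps eps0 ball_sub] := W1_ball.
have lb i e : 0 < e -> \forall n \near F, b i - e <= well_prob (mu_ n) n i.
  move=> e0; have [f [f01 fx fsupp]] := bump Xi_ok (x_Xi i) eps0.
  have c : test_integrals (mu_ n) f @[n --> F] --> \sum_k b k * sval f (x k).
    by rewrite -mub; move/cvg_probP : mu_cvg; exact.
  have bf : b i <= \sum_k b k * sval f (x k).
    rewrite (bigD1 i) //= fx mulr1 lerDl sumr_ge0 // => k _.
    by rewrite mulr_ge0 //; have /andP[] := f01 _ (x_Xi k).
  have h : \forall n \near F, b i - e <= test_integrals (mu_ n) f.
    by apply: (cvgr_ge _ c); rewrite ltrBlDr (le_lt_trans bf) ?ltrDl.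
  near=> n.
  have n0 : (0 < n)%N by near: n; apply: oF; exists 1%N.
  have mun : prob_measure (mu_ n) (grid Xi n) = 1%E by near: n.
  apply: (@le_trans _ _ (test_integrals (mu_ n) f)); first by near: n.
  rewrite (test_integrals_enum Xi_ok f (grid_finite Xi_ok n0) (@grid_carrier n) mun).
  rewrite /well_prob [leRHS]big_mkcond big_seq [leRHS]big_seq ler_sum // => y.
  move=> /(grid_seqP _ n0) gy; have /andP[f0 f1] := f01 y gy.1.
  case: ifPn => [_|/negP nW]; first by rewrite ler_piMl ?point_mass_ge0.
  have [->|/eqP fy] := eqVneq (sval f y) 0; first by rewrite mul0r.
  exfalso; apply: nW; apply: mem_set; apply: (ball_sub i n n0); split=> //.
  by split; [exact: gy.1|exact: fsupp gy.1 fy].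
move=> i; apply/cvgrPdist_le => e e0.
have e'0 : 0 < e / N1.+1%:R by rewrite divr_gt0.
have all_lb : \forall n \near F, forall k, b k - e / N1.+1%:R <= well_prob (mu_ n) n k.
  by apply: filter_forall => k; exact: lb.
near=> n.
have n0 : (0 < n)%N by near: n; apply: oF; exists 1%N.
have mun : prob_measure (mu_ n) (grid Xi n) = 1%E by near: n.
have hl : forall k, b k - e / N1.+1%:R <= well_prob (mu_ n) n k by near: n.
have hu := well_prob_sum n0 mun.
have eN : e / N1.+1%:R <= e by rewrite ler_pdivrMr // ler_peMr ?(ltW e0) // ler1n.
have hu' : well_prob (mu_ n) n i <= b i + e.
  move: hu; rewrite (bigD1 i) //= -lerBrDr => hu; apply: le_trans hu _.
  rewrite lerBlDr -b1 (bigD1 i) //= -addrA lerD2l -lerBlDr.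
  apply: (@le_trans _ _ (\sum_(k < N1 | k != i) (b k - well_prob (mu_ n) n k))).
    by rewrite sumrB.
  apply: (@le_trans _ _ (\sum_(k < N1 | k != i) e / N1.+1%:R)).
    by apply: ler_sum => k _; rewrite lerBlDr -lerBlDl; exact: hl.
  apply: (@le_trans _ _ (\sum_(k < N1) e / N1.+1%:R)).
    by rewrite [leRHS](bigD1 i) //= lerDr ltW.
  rewrite sumr_const card_ord -(mulr_natr (e / _)) mulrAC ler_pdivrMr //.
  by rewrite ler_wpM2l ?(ltW e0) // ler_nat.
have hli := hl i; rewrite distrC ler_distl hu' andbT.
exact: le_trans (lerB (lexx _) eN) hli.
Unshelve. all: by end_near. Qed.

(** The spectral-gap inequality bounds the integral of [(f y - f z) ^ 2] over the
    well by [beta n * K], where [f] is the square root of the density.  The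
    difference [f y ^ 2 - f z ^ 2] follows by Young's inequality with parameter
    [dl]. *)
Lemma near_constant n i (v : V -> R) (K dl : R) z : (0 < n)%N -> 0 < a1 n i ->
  (forall y, y \in grid_seq n -> 0 <= v y) -> \sum_(y <- grid_seq n) v y = 1 ->
  energy (grid_seq n) (rate n) (pi n) (density (pi n) v) <= K -> 0 < dl -> W1 i n z ->
  `|a1 n i * density (pi n) v z ^+ 2 - \sum_(y <- grid_seq n | y \in W1 i n) v y|
    <= beta n * K + beta n * K / dl + dl.
Proof.
move=> n0 a0 v0 v1 enK dl0 Wz.
have fG := grid_finite Xi_ok n0.
set f := density (pi n) v in enK *.
have f0 y : 0 <= f y by exact: sqrtr_ge0.
have vE y : y \in grid_seq n -> v y = pi n y * f y ^+ 2.
  move=> ys; apply: (densityE fG (chain_irr n0) (pi_stationary n0) (pi_reversible n0) ys).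
  exact: v0.
have p0 y : y \in grid_seq n -> 0 <= pi n y by exact: (pi_ge0 fG (pi_stationary n0)).
set S := \sum_(y <- grid_seq n | y \in W1 i n) pi n y * (f y - f z) ^+ 2.
have SK : S <= beta n * K.
  have := W1_gap f n0 Wz; rewrite (sum_sub fG _ (W1_sub (j := i) n0)) => h.
  have -> : S = a1 n i * \sum_(y <- grid_seq n | y \in W1 i n) pi n y / a1 n i * (f y - f z) ^+ 2.
    by rewrite mulr_sumr; apply: eq_bigr => y _; field; rewrite gt_eqF.
  apply: le_trans (ler_wpM2l (ltW a0) h) _; rewrite mulrCA ler_wpM2l ?(ltW (beta_gt0 n0)) //.
  apply: le_trans enK.
  exact: (dirichlet_le_energy fG (rate_ok n0) (pi_stationary n0) f (W1_sub (j := i) n0) a0).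
have -> : a1 n i * f z ^+ 2 - \sum_(y <- grid_seq n | y \in W1 i n) v y =
    \sum_(y <- grid_seq n | y \in W1 i n) pi n y * (f z ^+ 2 - f y ^+ 2).
  rewrite mass_W1E // mulr_suml -sumrB big_seq_cond [RHS]big_seq_cond.
  by apply: eq_bigr => y /andP[ys _]; rewrite vE // mulrBr.
apply: le_trans (ler_norm_sum _ _ _) _.
apply: (@le_trans _ _ (S + S / dl + dl * \sum_(y <- grid_seq n | y \in W1 i n) v y)).
  rewrite /S mulr_suml mulr_sumr -!big_split /= big_seq_cond [leRHS]big_seq_cond.
  apply: ler_sum => y /andP[ys _]; rewrite vE // normrM ger0_norm ?p0 //.
  have -> : pi n y * (f y - f z) ^+ 2 + pi n y * (f y - f z) ^+ 2 / dl +
    dl * (pi n y * f y ^+ 2) = pi n y * ((f y - f z) ^+ 2 + (f y - f z) ^+ 2 / dl + dl * f y ^+ 2).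
    ring.
  rewrite ler_wpM2l ?p0 //.
  have key : forall sg : R, sg = 1 \/ sg = -1 ->
     sg * (f z ^+ 2 - f y ^+ 2) <= (f y - f z) ^+ 2 + (f y - f z) ^+ 2 / dl + dl * f y ^+ 2.
    move=> sg sg1.
    have h1 : 0 <= (sg * (f y - f z) + dl * f y) ^+ 2 / dl by rewrite divr_ge0 ?sqr_ge0 ?ltW.
    have sg2 : sg ^+ 2 = 1 by case: sg1 => ->; rewrite ?expr1n ?sqrrN ?expr1n.
    have h2 : (sg * (f y - f z) + dl * f y) ^+ 2 / dl =
       (f y - f z) ^+ 2 / dl + 2 * (sg * (f y - f z) * f y) + dl * f y ^+ 2.
      rewrite sqrrD exprMn sg2; field; rewrite gt_eqF //.
    have h3 := sqr_ge0 (f y - f z).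
    have h4 : sg * (f z ^+ 2 - f y ^+ 2) = sg * (f y - f z) ^+ 2 - 2 * (sg * (f y - f z) * f y) by ring.
    have h5 : sg * (f y - f z) ^+ 2 <= (f y - f z) ^+ 2.
      by case: sg1 => ->; rewrite ?mul1r // mulN1r (le_trans _ h3) // oppr_le0.
    move: h1 h5; rewrite h2 h4; lra.
  rewrite ler_norml; have k1 := key 1 (or_introl erefl); have k2 := key (-1) (or_intror erefl).
  by apply/andP; split; lra.
have V1 : \sum_(y <- grid_seq n | y \in W1 i n) v y <= 1.
  rewrite -v1 big_mkcond big_seq [leRHS]big_seq ler_sum // => y ys.
  by case: ifP => // _; exact: v0.
apply: lerD; last by rewrite ler_piMr // ltW.
by apply: lerD => //; rewrite ler_wpM2r // invr_ge0 ltW.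
Qed.

(** * Wells as weighted unions of base wells *)

Section WeightedLevel.
Variables (m : nat) (W : 'I_m -> nat -> set V) (Delta : nat -> set V)
  (theta : nat -> R) (r : 'I_m -> 'I_m -> R)
  (disp : measure_display) (Omega : nat -> measurableType disp)
  (X : forall n, R -> Omega n -> V) (P : forall n, V -> probability (Omega n) R).
Hypotheses (chain_X : forall n, (0 < n)%N ->
      is_markov_chain (grid Xi n) (rate n) (@X n) (@P n))
  (W_partition : forall n, (0 < n)%N ->
      is_partition (grid Xi n) (fun j => W j n) (Delta n))
  (theta_gt0 : forall n, (0 < n)%N -> 0 < theta n)
  (r_lim : forall i j, i != j ->
     theta n * mean_jump_rate (grid Xi n) (rate n) (@X n) (@P n) (pi n)
          (fun k => W k n) i j @[n --> \oo] --> r i j)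
  (m_gt1 : exists i j : 'I_m, i != j)
  (beta_theta : prec beta theta).
Variable wt : 'I_m -> 'I_N1 -> R.
Hypotheses (wt_ge0 : forall j i, 0 <= wt j i) (wt_sum : forall j, \sum_i wt j i = 1)
  (wt_disj : forall j j' i, 0 < wt j i -> 0 < wt j' i -> j = j')
  (W_union : forall n j, (0 < n)%N -> W j n = \bigcup_(i in [set i | 0 < wt j i]) W1 i n)
  (wt_lim : forall j i, 0 < wt j i -> a1 n i / well_mass W n j @[n --> \oo] --> wt j i).

Local Notation wells n := (fun k => W k n).
Local Notation wm := (well_mass W).

Lemma a1_gt0 : \forall n \near \oo, forall i, 0 < a1 n i.
Proof. by apply: filter_forall => i; exact: a1_gt0_near. Qed.

Lemma wt_supp j : exists i, 0 < wt j i.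
Proof.
apply: contrapT => h; have := wt_sum j; rewrite big1 => [/esym/eqP|i _].
  by rewrite oner_eq0.
apply/eqP; rewrite eq_le wt_ge0 andbT leNgt; apply/negP => wi; apply: h; by exists i.
Qed.

Lemma W_neq0 : \forall n \near \oo, forall j, W j n !=set0.
Proof.
near=> n => j.
have n0 : (0 < n)%N by near: n; exists 1%N.
have a0 : forall i, 0 < a1 n i by near: n; exact: a1_gt0.
have [i wi] := wt_supp j.
have /set0P[y Wy] : W1 i n != set0.
  apply/eqP => W0; have := a0 i; rewrite W0 mass_set0 ltxx //.
by exists y; rewrite W_union //; exists i.
Unshelve. all: by end_near. Qed.

Lemma wm_gt0 : \forall n \near \oo, forall j, 0 < wm n j.
Proof. exact: (well_mass_gt0 W_partition W_neq0). Qed.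

Local Notation rn := (scaled_rate W theta).

Lemma rate_cvg j k : j != k -> rn n j k @[n --> \oo] --> r j k.
Proof. exact: (scaled_rate_cvg chain_X W_partition r_lim m_gt1 W_neq0). Qed.

Lemma rate_ge0 : \forall n \near \oo, forall j k, 0 <= rn n j k.
Proof. exact: (scaled_rate_ge0 W_partition theta_gt0 m_gt1 W_neq0). Qed.

Lemma rate_balance : \forall n \near \oo, forall j k, wm n j * rn n j k = wm n k * rn n k j.
Proof. exact: (scaled_rate_balance theta W_partition m_gt1 W_neq0). Qed.

(** The weights of the base points in the mixture [w] of the measures of the level. *)
Definition mix (w : 'I_m -> R) i : R := \sum_j w j * wt j i.

Lemma mix_supp w j i : 0 < wt j i -> mix w i = w j * wt j i.
Proof.
move=> wi; rewrite /mix (bigD1 j) //= big1 ?addr0 // => k kj.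
suff -> : wt k i = 0 by rewrite mulr0.
apply/eqP; rewrite eq_le wt_ge0 andbT leNgt; apply/negP => wk.
by move: kj; rewrite (wt_disj wk wi) eqxx.
Qed.

Lemma mix_ge0 w : (forall j, 0 <= w j) -> forall i, 0 <= mix w i.
Proof. by move=> w0 i; rewrite sumr_ge0 // => j _; rewrite mulr_ge0. Qed.

Lemma mix_sum w : \sum_j w j = 1 -> \sum_i mix w i = 1.
Proof.
move=> w1; rewrite /mix exchange_big /= -[RHS]w1; apply: eq_bigr => j _.
by rewrite -mulr_sumr wt_sum mulr1.
Qed.

Section LowerBound.
Variables (F : set_system nat) (FF : ProperFilter F) (oF : forall A, \oo A -> F A)
  (mu_ : nat -> prob Xi) (mu : prob Xi) (w : 'I_m -> R).
Hypotheses (mu_cvg : mu_ @ F --> mu) (mu_w : atomic mu (mix w))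
  (w_ge0 : forall j, 0 <= w j) (w_sum : \sum_j w j = 1).
Variable c : R.
Hypotheses (mu_c : \forall n \near F,
   ((theta n)%:E * level2_functional n (rate n) (mu_ n) <= c%:E)%E).

Local Notation v n := (point_mass (mu_ n)).

Lemma finite_level2 n : (0 < n)%N ->
  ((theta n)%:E * level2_functional n (rate n) (mu_ n) <= c%:E)%E ->
  prob_measure (mu_ n) (grid Xi n) = 1%E /\
  level2_functional n (rate n) (mu_ n) = rate_functional (grid Xi n) (rate n) (v n).
Proof.
move=> n0; rewrite /level2_functional; case: eqP => [h _|_]; first by split.
by rewrite gt0_muley ?lte_fin ?theta_gt0 // leye_eq.
Qed.

Lemma energy_bound n : (0 < n)%N ->
  ((theta n)%:E * level2_functional n (rate n) (mu_ n) <= c%:E)%E ->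
  energy (grid_seq n) (rate n) (pi n) (density (pi n) (v n)) <= c / theta n.
Proof.
move=> n0 h; have [g1 E] := finite_level2 n0 h; move: h; rewrite E => h.
have en := energy_density_le (grid_finite Xi_ok n0) (chain_irr n0)
  (pi_stationary n0) (pi_reversible n0) (fun y _ => point_mass_ge0 (mu_ n) y).
have th := theta_gt0 n0.
rewrite ler_pdivlMr // mulrC -lee_fin EFinM.
by apply: le_trans h; rewrite lee_pmul2l ?lte_fin.
Qed.

(** The density is nearly constant on each base well of [W j], with a constant
    given by the mass of this base well; both masses have the limiting ratio
    [wt j i], so the constants agree throughout [W j]. *)
Lemma density_cvg e : 0 < e -> \forall n \near F, forall j z, W j n z ->
  `|v n z * wm n j / pi n z - w j| <= e.
Proof.
move=> e0.
have mu1 : \forall n \near F, prob_measure (mu_ n) (grid Xi n) = 1%E.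
  near=> n; have n0 : (0 < n)%N by near: n; apply: oF; exists 1%N.
  have hc : ((theta n)%:E * level2_functional n (rate n) (mu_ n) <= c%:E)%E by near: n.
  by have [] := finite_level2 n0 hc.
have V_cvg i := well_prob_cvg oF mu_cvg mu_w (mix_ge0 w_ge0) (mix_sum w_sum) mu1 (i := i).
have one j i : 0 < wt j i -> \forall n \near F, forall z, W1 i n z ->
   `|wm n j / a1 n i * (a1 n i * density (pi n) (v n) z ^+ 2) - w j| <= e.
  move=> wi.
  have Ac : wm n j / a1 n i @[n --> F] --> (wt j i)^-1.
    have h : (a1 n i / wm n j)^-1 @[n --> \oo] --> (wt j i)^-1.
      by apply: cvgV; [exact: lt0r_neq0|exact: wt_lim].
    have h' : wm n j / a1 n i @[n --> \oo] --> (wt j i)^-1.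
      by apply: (cvg_near_eq _ h); apply: nearW => n; rewrite invf_div.
    exact: cvg_finer oF h'.
  have AVc : wm n j / a1 n i * well_prob (mu_ n) n i @[n --> F] --> w j.
    have -> : w j = (wt j i)^-1 * mix w i.
      by rewrite (mix_supp w wi) mulrCA mulVf ?mulr1 // lt0r_neq0.
    by apply: cvgM; [exact: Ac|exact: V_cvg].
  pose A := (wt j i)^-1 + 1.
  have A0 : 0 < A by rewrite ltr_wpDl // invr_ge0.
  pose e' := e / (2 * A); have e'0 : 0 < e' by rewrite divr_gt0 // mulr_gt0.
  (* [near_constant] has the errors [dl] and [O(beta / theta)], each at most [e' / 2];
     the factor [A] bounds the ratio of the masses of [W j] and its base well *)
  pose dl := e' / 2; have dl0 : 0 < dl by rewrite divr_gt0.
  have near_b : \forall n \near F, beta n / theta n * (c + c / dl) <= e' / 2.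
    have h : beta n / theta n * (c + c / dl) @[n --> \oo] --> 0 * (c + c / dl).
      by apply: cvgM; [exact: beta_theta|exact: cvg_cst].
    rewrite mul0r in h.
    by apply: oF; apply: (cvgr_le _ h); rewrite divr_gt0.
  near=> n => z Wz.
  have n0 : (0 < n)%N by near: n; apply: oF; exists 1%N.
  have a0 : forall i, 0 < a1 n i by near: n; apply: oF; exact: a1_gt0.
  have m0 : forall j, 0 < wm n j by near: n; apply: oF; exact: wm_gt0.
  have AA : wm n j / a1 n i <= A by near: n; apply: (cvgr_le _ Ac); rewrite ltrDl.
  have AV : `|w j - wm n j / a1 n i * well_prob (mu_ n) n i| <= e / 2.
    by near: n; move/cvgrPdist_le : AVc; apply; rewrite divr_gt0.
  have nb : beta n / theta n * (c + c / dl) <= e' / 2 by near: n.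
  have hc : ((theta n)%:E * level2_functional n (rate n) (mu_ n) <= c%:E)%E by near: n.
  have [g1 _] := finite_level2 n0 hc.
  have nc := near_constant n0 (a0 i) (fun y _ => point_mass_ge0 (mu_ n) y)
    (point_mass_sum n0 g1) (energy_bound n0 hc) dl0 Wz.
  have q : `|a1 n i * density (pi n) (v n) z ^+ 2 - well_prob (mu_ n) n i| <= e'.
    apply: le_trans nc _; rewrite [leRHS](splitr e'); apply: lerD => //.
    apply: le_trans nb; rewrite le_eqVlt; apply/orP; left; apply/eqP.
    by field; rewrite !lt0r_neq0 ?theta_gt0.
  set q1 := a1 n i * _ in q *; set A' := wm n j / a1 n i in AA AV *.
  have A'0 : 0 <= A' by rewrite divr_ge0 ?ltW.
  have -> : A' * q1 - w j = A' * (q1 - well_prob (mu_ n) n i) -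
     (w j - A' * well_prob (mu_ n) n i) by ring.
  apply: le_trans (ler_normB _ _) _; rewrite (splitr e); apply: lerD => //.
  rewrite normrM (ger0_norm A'0); apply: (@le_trans _ _ (A * e')).
    by apply: ler_pM.
  rewrite /e' le_eqVlt; apply/orP; left; apply/eqP; field.
  by rewrite gt_eqF.
have all1 : \forall n \near F, forall j i, 0 < wt j i -> forall z, W1 i n z ->
   `|wm n j / a1 n i * (a1 n i * density (pi n) (v n) z ^+ 2) - w j| <= e.
  apply: filter_forall => j; apply: filter_forall => i.
  have [wi|wi] := boolP (0 < wt j i); last by apply: nearW.
  by apply: filterS (one j i wi) => n h _.
near=> n => j z Wz.
have n0 : (0 < n)%N by near: n; apply: oF; exists 1%N.
have a0 : forall i, 0 < a1 n i by near: n; apply: oF; exact: a1_gt0.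
have h : forall j i, 0 < wt j i -> forall z, W1 i n z ->
   `|wm n j / a1 n i * (a1 n i * density (pi n) (v n) z ^+ 2) - w j| <= e by near: n.
move: (Wz); rewrite W_union // => -[i /= wi W1z].
have := h j i wi z W1z.
have zs : z \in grid_seq n by apply/(grid_seqP _ n0)/(W1_sub n0 W1z).
have pz : 0 < pi n z.
  exact: (pi_gt0 (grid_finite Xi_ok n0) (chain_irr n0) (pi_stationary n0) (pi_reversible n0) zs).
have -> : wm n j / a1 n i * (a1 n i * density (pi n) (v n) z ^+ 2) =
   wm n j * density (pi n) (v n) z ^+ 2 by field; rewrite gt_eqF.
have vE := densityE (grid_finite Xi_ok n0) (chain_irr n0) (pi_stationary n0)
   (pi_reversible n0) zs (point_mass_ge0 (mu_ n) z).
suff -> : v n z * wm n j / pi n z = wm n j * density (pi n) (v n) z ^+ 2 by [].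
by rewrite {1}vE; field; rewrite gt_eqF.
Unshelve. all: by end_near. Qed.

(** * The lower bound at one level *)

Local Notation trc n := (strace (grid_seq n) (rate n) (fun z => `[< (\bigcup_k W k n) z >])).

Definition law_flow n j k := \sum_(z <- grid_seq n | z \in W j n)
  v n z * \sum_(y <- grid_seq n | y \in W k n) trc n z y.

(** On the [j]-th well [mu_n] is nearly [w j] times the conditioned stationary
    measure, whose flow is the scaled mean jump rate. *)
Lemma law_flow_cvg j k : j != k ->
  theta n * law_flow n j k @[n --> F] --> w j * r j k.
Proof.
(* [B] bounds the scaled rates; [w j * rho n] mediates between flow and limit *)
move=> jk; pose rho n := scaled_rate W theta n j k.
have rho_cvg : rho n @[n --> F] --> r j k.
  apply: (cvg_finer oF).
  exact: (@rate_cvg j k jk).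
have r0 : 0 <= r j k.
  apply: (cvg_limit_ge rho_cvg); apply: oF.
  by apply: filterS rate_ge0 => n; exact.
pose B := r j k + 1; have B0 : 0 < B by rewrite ltr_wpDl.
have wrho_cvg : w j * rho n @[n --> F] --> w j * r j k.
  by apply: cvgM; [exact: cvg_cst|exact: rho_cvg].
apply/cvgrPdist_le => e e0.
pose e' := e / (2 * B); have e'0 : 0 < e' by rewrite divr_gt0 // mulr_gt0.
near=> n.
have n0 : (0 < n)%N by near: n; apply: oF; exists 1%N.
have m0 : forall j, 0 < wm n j by near: n; apply: oF; exact: wm_gt0.
have W0 : forall j, W j n !=set0 by near: n; apply: oF; exact: W_neq0.
have rhoB : rho n <= B by near: n; apply: (cvgr_le _ rho_cvg); rewrite ltrDl.
have h1 : `|w j * r j k - w j * rho n| <= e / 2.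
  by near: n; move/cvgrPdist_le : wrho_cvg; apply; rewrite divr_gt0.
have dn : forall j z, W j n z -> `|v n z * wm n j / pi n z - w j| <= e'.
  by near: n; exact: density_cvg.
have [tW _ _] := W_partition n0.
have T0 z : z \in grid_seq n -> 0 <= \sum_(y <- grid_seq n | y \in W k n) trc n z y.
  move=> zs.
  have h := jump_out_ge0 (W := wells n) (grid_finite Xi_ok n0) (rate_ok n0) (chain_irr n0)
    (fun i => W_grid W_partition (j := i) n0) tW W0 m_gt1 k zs.
  exact: h.
have rhoE : rho n = theta n * \sum_(z <- grid_seq n | z \in W j n)
   pi n z / wm n j * \sum_(y <- grid_seq n | y \in W k n) trc n z y.
  rewrite /rho /scaled_rate; congr (_ * _); rewrite /flow mulr_sumr; apply: eq_bigr => z _.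
  by rewrite mulrA [_^-1 * _]mulrC.
have h2 : `|w j * rho n - theta n * law_flow n j k| <= e' * rho n.
  rewrite rhoE [X in X - _]mulrCA -mulrBr normrM (ger0_norm (ltW (theta_gt0 n0))).
  rewrite mulrCA ler_wpM2l ?(ltW (theta_gt0 n0)) // mulr_sumr -sumrB.
  apply: le_trans (ler_norm_sum _ _ _) _; rewrite mulr_sumr.
  rewrite big_seq_cond [leRHS]big_seq_cond ler_sum // => z /andP[zs /set_mem Wz].
  rewrite mulrA -mulrBl normrM (ger0_norm (T0 z zs)) [leRHS]mulrA ler_wpM2r ?T0 //.
  have pz : 0 < pi n z.
    exact: (pi_gt0 (grid_finite Xi_ok n0) (chain_irr n0) (pi_stationary n0) (pi_reversible n0) zs).
  have -> : w j * (pi n z / wm n j) - v n z =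
     - (pi n z / wm n j * (v n z * wm n j / pi n z - w j)).
    by field; rewrite !gt_eqF // m0.
  rewrite normrN normrM ger0_norm ?divr_ge0 ?(ltW pz) ?(ltW (m0 j)) // mulrC.
  by rewrite ler_wpM2r ?dn // divr_ge0 ?(ltW pz) ?(ltW (m0 j)).
apply: le_trans (ler_distD (w j * rho n) _ _) _.
rewrite (splitr e); apply: lerD => //; apply: le_trans h2 _.
apply: (@le_trans _ _ (e' * B)); first by rewrite ler_wpM2l // ltW.
rewrite /e' le_eqVlt; apply/orP; left; apply/eqP; field.
by rewrite gt_eqF.
Unshelve. all: by end_near. Qed.

Lemma reduced_rate_le_liminf : (reduced_rate r w <= c%:E)%E.
Proof.
apply: reduced_rate_le => u u0; rewrite lee_fin.
have lim : - \sum_i \sum_j (if i == j then 0 else theta n * law_flow n i j) * ((u j - u i) / u i)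
    @[n --> F] --> - \sum_i \sum_j offdiag r i j * (u j - u i) / u i * w i.
  apply: cvgN; apply: cvg_sum_seq => i _ _; apply: cvg_sum_seq => j _ _.
  rewrite /offdiag; have [ij|ij] := eqVneq i j.
    by rewrite !mul0r; apply: (cvg_near_eq _ (cvg_cst _)); apply: nearW => n /=; rewrite ?mul0r.
  have -> : r i j * (u j - u i) / u i * w i = w i * r i j * ((u j - u i) / u i) by ring.
  by apply: cvgM; [exact: law_flow_cvg|exact: cvg_cst].
apply: (cvg_limit_le lim); near=> n.
have n0 : (0 < n)%N by near: n; apply: oF; exists 1%N.
have W0 : forall j, W j n !=set0 by near: n; apply: oF; exact: W_neq0.
have hc : ((theta n)%:E * level2_functional n (rate n) (mu_ n) <= c%:E)%E by near: n.
have [tW _ _] := W_partition n0.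
have [g1 E] := finite_level2 n0 hc; move: hc; rewrite E => hc.
have h := rate_ge_wells (W := wells n) (grid_finite Xi_ok n0) (rate_ok n0) (chain_irr n0)
    (fun i => W_grid W_partition (j := i) n0) tW W0 m_gt1 (v n) u0.
rewrite -lee_fin; apply: le_trans hc.
apply: le_trans (lee_wpmul2l _ h); last by rewrite lee_fin ltW // theta_gt0.
rewrite -EFinM lee_fin mulrN mulr_sumr lerN2 le_eqVlt; apply/orP; left; apply/eqP.
apply: eq_bigr => i _; rewrite mulr_sumr; apply: eq_bigr => j _.
case: eqVneq => [->|_]; first by rewrite subrr mul0r !mulr0.
by first [exact: mulrA | exact/esym/mulrA].
Unshelve. all: by end_near. Qed.

End LowerBound.

(** * Recovery sequences *)

(** Convergence at one level uses two properties of the limit functional [I]: it is the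
    reduced functional on mixtures and infinite elsewhere; and it is finite at all
    limit points of sequences with bounded scaled functional, which is what the
    previous level supplies. *)
Section LevelConvergence.
Variable I : prob Xi -> \bar R.
Hypotheses (I_dichotomy : forall nu, I nu = +oo%E \/
    exists w, [/\ forall j, 0 <= w j, \sum_j w j = 1, atomic nu (mix w)
      & I nu = reduced_rate r w])
  (I_limits : forall (phi : nat -> nat) (nu_ : nat -> prob Xi) nu (c : R),
     (forall k, (phi k < phi k.+1)%N) -> nu_ (phi k) @[k --> \oo] --> nu ->
     (\forall k \near \oo,
        ((theta (phi k))%:E * level2_functional (phi k) (rate (phi k)) (nu_ (phi k)) <= c%:E)%E) ->
     (I nu < +oo)%E).

Section Recovery.

Variables (mu : prob Xi) (w : 'I_m -> R).
Hypotheses (mu_w : atomic mu (mix w)) (w_ge0 : forall j, 0 <= w j) (w_sum : \sum_j w j = 1).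

Local Notation profile n := (well_ext (grid Xi n) (rate n) (wells n)
  (fun j => Num.sqrt (w j / wm n j))).

(** The harmonic profile takes the value [sqrt (w j / wm n j)] on the [j]-th well, so
    that the wells contribute exactly 1 to its norm; normalisation loses what lies
    off the wells. *)
Definition profile_norm n := \sum_(y <- grid_seq n) pi n y * profile n y ^+ 2.

Lemma sum_W1 n j (G : V -> R) : (0 < n)%N ->
  \sum_(i | 0 < wt j i) \sum_(y <- grid_seq n | y \in W1 i n) G y =
  \sum_(y <- grid_seq n | y \in W j n) G y.
Proof. by move=> n0; rewrite sum_disjoint_wells // W_union. Qed.

Lemma sum_a1 n j : (0 < n)%N -> \sum_(i | 0 < wt j i) a1 n i = wm n j.
Proof.
move=> n0; rewrite /well_mass (massE _ (grid_finite Xi_ok n0) (W_grid W_partition (j := j) n0)).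
rewrite -sum_W1 //; apply: eq_bigr => i _; exact: mass_W1E.
Qed.

Lemma profileE n j z : (0 < n)%N -> 0 < wm n j -> W j n z ->
  profile n z ^+ 2 = w j / wm n j.
Proof.
move=> n0 m0 Wz; have [tW _ _] := W_partition n0.
have h := well_extE (W := wells n) (rate n) (grid_finite Xi_ok n0)
  (fun i => W_grid W_partition (j := i) n0) tW (fun j => Num.sqrt (w j / wm n j)) Wz.
by rewrite h sqr_sqrtr // divr_ge0 ?(ltW m0).
Qed.

Lemma profile_norm_ge1 : \forall n \near \oo, 1 <= profile_norm n.
Proof.
near=> n.
have n0 : (0 < n)%N by near: n; exists 1%N.
have m0 : forall j, 0 < wm n j by near: n; exact: wm_gt0.
have fG := grid_finite Xi_ok n0.
have p0 y : y \in grid_seq n -> 0 <= pi n y by exact: (pi_ge0 fG (pi_stationary n0)).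
rewrite -w_sum.
have -> : \sum_j w j = \sum_j \sum_(y <- grid_seq n | y \in W j n) pi n y * profile n y ^+ 2.
  apply: eq_bigr => j _.
  transitivity (wm n j * (w j / wm n j)); first by field; rewrite gt_eqF.
  rewrite {1}/well_mass (massE _ fG (W_grid W_partition (j := j) n0)) mulr_suml.
  by apply: eq_bigr => y /set_mem Wy; rewrite (profileE n0 (m0 j) Wy).
have [tW _ _] := W_partition n0.
rewrite -(sum_wells (W := wells n) _ tW) /profile_norm [leLHS]big_mkcond big_seq.
rewrite [leRHS]big_seq ler_sum // => y ys.
by case: ifP => // _; rewrite mulr_ge0 ?p0 // sqr_ge0.
Unshelve. all: by end_near. Qed.

Lemma recovery_exists : exists nu_ : nat -> prob Xi, \forall n \near \oo,
  prob_measure (nu_ n) (grid Xi n) = 1%E /\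
  forall y, y \in grid_seq n -> point_mass (nu_ n) y = pi n y * profile n y ^+ 2 / profile_norm n.
Proof.
have ex n : exists nu : prob Xi, (0 < n)%N -> 1 <= profile_norm n ->
  prob_measure nu (grid Xi n) = 1%E /\
  forall y, y \in grid_seq n -> point_mass nu y = pi n y * profile n y ^+ 2 / profile_norm n.
  have [/andP[n0 Z1]|h] := boolP ((0 < n)%N && (1 <= profile_norm n)); last first.
    by exists mu => n0 Z1; rewrite n0 Z1 in h.
  have Z0 : 0 < profile_norm n by exact: lt_le_trans ltr01 Z1.
  have [| |nu [nu1 nuE]] := finite_prob (G := grid Xi n)
    (w := fun y => pi n y * profile n y ^+ 2 / profile_norm n) Xi_ok (grid_finite Xi_ok n0) (@grid_carrier n).
  - move=> y /(grid_seqP _ n0) ys; rewrite divr_ge0 ?(ltW Z0) // mulr_ge0 ?sqr_ge0 //.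
    exact: (pi_ge0 (grid_finite Xi_ok n0) (pi_stationary n0)).
  - by rewrite -mulr_suml divff // gt_eqF.
  exists nu => _ _; split=> // y /(grid_seqP _ n0) gy.
  by rewrite /point_mass nuE.
have [nu_ nuP] := choice ex; exists nu_; near=> n; apply: nuP.
  by near: n; exists 1%N.
by near: n; exact: profile_norm_ge1.
Unshelve. all: by end_near. Qed.

Definition profile_energy n : R :=
  theta n * energy (grid_seq n) (rate n) (pi n) (profile n).

Lemma profile_energy_cvg : profile_energy n @[n --> \oo] --> sqrt_form r w.
Proof.
pose form n := 2^-1 * \sum_i \sum_j
  (Num.sqrt (w i * offdiag (rn n) i j) - Num.sqrt (w j * offdiag (rn n) j i)) ^+ 2.
have formc : form n @[n --> \oo] --> sqrt_form r w.
  have off i j : offdiag (rn n) i j @[n --> \oo] --> offdiag r i j.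
    rewrite /offdiag; have [ij|ij] := eqVneq i j; first exact: cvg_cst.
    exact: rate_cvg.
  have term i j : Num.sqrt (w i * offdiag (rn n) i j) @[n --> \oo] --> Num.sqrt (w i * offdiag r i j).
    by apply: cvg_sqrt; apply: cvgM; [exact: cvg_cst|exact: off].
  apply: cvgM; first exact: cvg_cst.
  apply: cvg_sum_seq => i _ _; apply: cvg_sum_seq => j _ _.
  rewrite expr2; under eq_fun do rewrite expr2.
  by apply: cvgM; apply: cvgB; exact: term.
apply: (cvg_near_eq _ formc); near=> n.
have n0 : (0 < n)%N by near: n; exists 1%N.
have m0 : forall j, 0 < wm n j by near: n; exact: wm_gt0.
have W0 : forall j, W j n !=set0 by near: n; exact: W_neq0.
have rn0 : forall j k, 0 <= rn n j k by near: n; exact: rate_ge0.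
have bal : forall j k, wm n j * rn n j k = wm n k * rn n k j by near: n; exact: rate_balance.
have [tW _ _] := W_partition n0.
have h := energy_well_ext (W := wells n) (grid_finite Xi_ok n0) (rate_ok n0) (chain_irr n0)
  (pi_reversible n0) (fun i => W_grid W_partition (j := i) n0) tW W0 m_gt1
  (fun j => Num.sqrt (w j / wm n j)).
rewrite /profile_energy /form h mulrCA; congr (_ * _); rewrite mulr_sumr.
apply: eq_bigr => i _; rewrite mulr_sumr; apply: eq_bigr => j _.
rewrite /offdiag eq_sym; case: eqVneq => [->|ji].
  by rewrite !mulr0 !sqrtr0 !subrr !expr0n !mulr0.
set t := theta n * flow (grid Xi n) (rate n) (pi n) (wells n) i j.
have tE : t = wm n i * rn n i j by rewrite scaled_rateE // gt_eqF.
have t0 : 0 <= t by rewrite tE mulr_ge0 ?(ltW (m0 i)).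
have sq k : t * (w k / wm n k) = w k * (t / wm n k) by rewrite mulrCA.
have -> : w i * rn n i j = t * (w i / wm n i) by rewrite tE; field; rewrite gt_eqF.
have -> : w j * rn n j i = t * (w j / wm n j) by rewrite tE bal; field; rewrite gt_eqF.
rewrite !(sqrtrM _ t0) -mulrBr exprMn sqr_sqrtr // mulrA -/t; congr (_ * _).
by rewrite -sqrrN opprB.
Unshelve. all: by end_near. Qed.

Lemma recovery_energy (nu_ : nat -> prob Xi) :
  (\forall n \near \oo, prob_measure (nu_ n) (grid Xi n) = 1%E /\
    forall y, y \in grid_seq n ->
      point_mass (nu_ n) y = pi n y * profile n y ^+ 2 / profile_norm n) ->
  \forall n \near \oo, ((theta n)%:E * level2_functional n (rate n) (nu_ n)
    <= (profile_energy n)%:E)%E.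
Proof.
move=> nuP; near=> n.
have n0 : (0 < n)%N by near: n; exists 1%N.
have [nu1 nuE] : prob_measure (nu_ n) (grid Xi n) = 1%E /\
    forall y, y \in grid_seq n ->
      point_mass (nu_ n) y = pi n y * profile n y ^+ 2 / profile_norm n by near: n.
have Z1 : 1 <= profile_norm n by near: n; exact: profile_norm_ge1.
have Z0 : 0 < profile_norm n by exact: lt_le_trans ltr01 Z1.
rewrite /profile_energy EFinM lee_pmul2l ?lte_fin ?theta_gt0 //.
rewrite /level2_functional nu1 eqxx.
set s := Num.sqrt (profile_norm n)^-1.
have s2 : s ^+ 2 = (profile_norm n)^-1 by rewrite sqr_sqrtr // invr_ge0 ltW.
have h := rate_functional_le_energy (grid_finite Xi_ok n0) (rate_ok n0) (pi_stationary n0)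
  (pi_reversible n0) (v := point_mass (nu_ n)) (f := fun y => profile n y * s).
apply: le_trans (h _) _ => [y ys|]; first by rewrite nuE // exprMn s2 -mulrA.
rewrite lee_fin /energy ler_pM2l ?invr_gt0 // big_seq [leRHS]big_seq.
apply: ler_sum => y ys; rewrite big_seq [leRHS]big_seq; apply: ler_sum => z zs.
have fG := grid_finite Xi_ok n0.
have pr : 0 <= pi n y * rate n y z.
  by rewrite mulr_ge0 ?(chain_rate_ge0 fG (rate_ok n0)) // (pi_ge0 fG (pi_stationary n0)).
rewrite ler_wpM2l // -mulrBl exprMn s2 ler_piMr ?sqr_ge0 // invf_le1 //.
Unshelve. all: by end_near. Qed.

(** A limit point is a mixture [w'].  The wells have total mass 1 under it, and total mass
    [(profile_norm n)^-1] before the limit, so the norm tends to 1; then the masses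
    of the base wells identify [w'] with [w]. *)
Lemma recovery_limit (nu_ : nat -> prob Xi) (phi : nat -> nat) nu :
  (\forall n \near \oo, prob_measure (nu_ n) (grid Xi n) = 1%E /\
    forall y, y \in grid_seq n ->
      point_mass (nu_ n) y = pi n y * profile n y ^+ 2 / profile_norm n) ->
  (forall k, (phi k < phi k.+1)%N) -> nu_ (phi k) @[k --> \oo] --> nu ->
  atomic nu (mix w).
Proof.
move=> nuP phi_incr nu_cvg; have oF := subseq_oo phi_incr.
have [w' [w'0 w'1 nu_w']] : exists w, [/\ forall j, 0 <= w j, \sum_j w j = 1 & atomic nu (mix w)].
  have E1 : \forall n \near \oo, ((theta n)%:E * level2_functional n (rate n) (nu_ n)
      <= (sqrt_form r w + 1)%:E)%E.
    near=> n; apply: le_trans (_ : (profile_energy n)%:E <= _)%E.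
      by near: n; exact: recovery_energy.
    by rewrite lee_fin; near: n; apply: (cvgr_le _ profile_energy_cvg); rewrite ltrDl.
  have := I_limits phi_incr nu_cvg (oF _ E1).
  by have [->|[w' [w'0 w'1 nu_w' _]] _] := I_dichotomy nu; [|exists w'].
have nu1 : \forall n \near phi @ \oo, prob_measure (nu_ n) (grid Xi n) = 1%E.
  by apply: oF; apply: filterS nuP => n [].
have wp i : well_prob (nu_ n) n i @[n --> phi @ \oo] --> mix w' i.
  exact: (well_prob_cvg oF nu_cvg nu_w' (mix_ge0 w'0) (mix_sum w'1) nu1).
have wpE : \forall n \near \oo, forall j i, 0 < wt j i ->
    well_prob (nu_ n) n i = a1 n i / wm n j * w j * (profile_norm n)^-1.
  near=> n => j i wi.
  have n0 : (0 < n)%N by near: n; exists 1%N.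
  have m0 : forall j, 0 < wm n j by near: n; exact: wm_gt0.
  have [_ nuE] : prob_measure (nu_ n) (grid Xi n) = 1%E /\
    forall y, y \in grid_seq n ->
      point_mass (nu_ n) y = pi n y * profile n y ^+ 2 / profile_norm n by near: n.
  rewrite mass_W1E // !mulr_suml /well_prob big_seq_cond [RHS]big_seq_cond.
  apply: eq_bigr => y /andP[ys /set_mem Wy]; rewrite nuE // (profileE n0 (m0 j)).
    by rewrite -!mulrA; congr (_ * _); rewrite mulrCA !mulrA.
  by rewrite W_union //; exists i.
(* under the mixture [w'] the wells of the level have total mass 1 *)
have Zc : (profile_norm n)^-1 @[n --> phi @ \oo] --> (1 : R).
  have S : \sum_j \sum_(i | 0 < wt j i) well_prob (nu_ n) n i @[n --> phi @ \oo] -->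
      \sum_j \sum_(i | 0 < wt j i) mix w' i.
    by apply: cvg_sum_seq => j _ _; apply: cvg_sum_seq => i _ _; exact: wp.
  have S1 : \sum_j \sum_(i | 0 < wt j i) mix w' i = 1.
    rewrite -w'1; apply: eq_bigr => j _.
    rewrite -[RHS]mulr1 -(wt_sum j) [in RHS](bigID (fun i => 0 < wt j i)) /=.
    rewrite [X in _ + X]big1 ?addr0 => [|i ni]; last first.
      by apply/eqP; rewrite eq_le wt_ge0 andbT leNgt.
    by rewrite mulr_sumr; apply: eq_bigr => i wi; rewrite (mix_supp w' wi).
  rewrite S1 in S; apply: (cvg_near_eq _ S); near=> n.
  have n0 : (0 < n)%N by near: n; apply: oF; exists 1%N.
  have m0 : forall j, 0 < wm n j by near: n; apply: oF; exact: wm_gt0.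
  have E : forall j i, 0 < wt j i ->
    well_prob (nu_ n) n i = a1 n i / wm n j * w j * (profile_norm n)^-1 by near: n; exact: oF.
  transitivity (\sum_j w j * (profile_norm n)^-1).
    by rewrite -mulr_suml w_sum mul1r.
  apply: eq_bigr => j _; rewrite (eq_bigr _ (fun i => E j i)).
  by rewrite -!mulr_suml sum_a1 // divff ?mul1r // gt_eqF.
have ww i : mix w' i = mix w i.
  have [[j wi]|ni] := pselect (exists j, 0 < wt j i); last first.
    have z v : mix v i = 0.
      rewrite /mix big1 // => j _; suff -> : wt j i = 0 by rewrite mulr0.
      by apply/eqP; rewrite eq_le wt_ge0 andbT leNgt; apply/negP => wi; apply: ni; exists j.
    by rewrite !z.
  have c1 : well_prob (nu_ n) n i @[n --> phi @ \oo] --> wt j i * w j * 1.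
    apply: (cvg_near_eq (g := fun n => a1 n i / wm n j * w j * (profile_norm n)^-1)).
      apply: oF; apply: filterS wpE => n; exact.
    apply: cvgM Zc; apply: cvgM; last exact: cvg_cst.
    exact: (cvg_finer oF (wt_lim wi)).
  have := cvg_unique _ (wp i) c1; rewrite mulr1 (mix_supp w wi) [w j * _]mulrC; exact.
by move=> f; rewrite nu_w'; apply: eq_bigr => i _; rewrite ww.
Unshelve. all: by end_near. Qed.

Lemma recovery_sequence : exists2 nu_ : nat -> prob Xi, nu_ @ \oo --> mu &
  (limn_esup (fun n => ((theta n)%:E * level2_functional n (rate n) (nu_ n))%E)
     <= reduced_rate r w)%E.
Proof.
have [nu_ nuP] := recovery_exists; exists nu_.
  apply/cvg_probP => f; apply/cvgrPdist_le => e e0; apply: contrapT => nh.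
  have [phi phi_incr phiP] := frequently_subseq nh.
  have [sg [nu [sg_incr nu_cvg]]] := prob_seq_compact Xi_ok (nu_ \o phi).
  have ps_incr k : ((phi \o sg) k < (phi \o sg) k.+1)%N.
    exact: leq_trans (phi_incr (sg k)) (subseq_mono phi_incr (sg_incr k)).
  have nu_w := recovery_limit nuP ps_incr nu_cvg.
  have nf : test_integrals nu f = test_integrals mu f by rewrite nu_w mu_w.
  move/cvg_probP : nu_cvg => /(_ f) /cvgrPdist_le /(_ e e0) [K _ hK].
  by apply: (phiP (sg K)); have := hK K (leqnn K); rewrite /= nf.
apply: limn_esup_le => e e0; near=> n.
apply: (@le_trans _ _ (profile_energy n)%:E); first by near: n; exact: recovery_energy.
apply: (@le_trans _ _ (sqrt_form r w + e)%:E); last first.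
  rewrite EFinD leeD2r //; exact: (sqrt_form_le wm_gt0 rate_ge0 rate_balance rate_cvg w_ge0).
by rewrite lee_fin; near: n; apply: (cvgr_le _ profile_energy_cvg); rewrite ltrDl.
Unshelve. all: by end_near. Qed.

End Recovery.

Lemma level_liminf (mu_ : nat -> prob Xi) (mu : prob Xi) : mu_ @ \oo --> mu ->
  (I mu <= limn_einf (fun n => (theta n)%:E * level2_functional n (rate n) (mu_ n)))%E.
Proof.
move=> mu_cvg; apply: le_limn_einf => c cI; apply: contrapT => nh.
have [phi phi_incr phiP] := frequently_subseq nh.
have mu_phi : mu_ (phi k) @[k --> \oo] --> mu.
  exact: (cvg_finer (subseq_oo phi_incr) mu_cvg).
have le_c k : ((theta (phi k))%:E * level2_functional (phi k) (rate (phi k)) (mu_ (phi k))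
    <= c%:E)%E by rewrite leNgt; apply/negP => /ltW; exact: phiP.
have I_fin : (I mu < +oo)%E 
  by apply: (I_limits phi_incr mu_phi (c := c)); apply: nearW => k; exact: le_c.
have [I_oo|[w [w0 w1 mu_w Iw]]] := I_dichotomy mu; first by rewrite I_oo in I_fin.
move: cI; rewrite Iw ltNge => /negP; apply.
have mu_c : \forall n \near phi @ \oo,
    ((theta n)%:E * level2_functional n (rate n) (mu_ n) <= c%:E)%E.
  by exists 0%N => // k _; exact: le_c.
exact: (reduced_rate_le_liminf (F := phi @ \oo) _ (subseq_oo phi_incr) mu_phi mu_w w0 w1 mu_c).
Qed.

Lemma level_gamma_cvg :
  gamma_cvg (fun n mu => ((theta n)%:E * level2_functional n (rate n) mu)%E) I.
Proof.
split; first by move=> mu_ mu; exact: level_liminf.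
move=> mu; have [I_oo|[w [w0 w1 mu_w Iw]]] := I_dichotomy mu.
  by exists (fun=> mu); [exact: cvg_cst|rewrite I_oo leey].
by rewrite Iw; exact: recovery_sequence.
Qed.

End LevelConvergence.

(** * From one level to the next *)

Section NextLevel.
Variables (m' : nat) (W' : 'I_m' -> nat -> set V) (cls : 'I_m' -> set 'I_m)
  (M : 'I_m' -> 'I_m -> R).
Hypotheses (cls_inj : injective cls)
  (clsP : forall C, closed_irreducible_class r C <-> exists k, C = cls k)
  (M_stationary : forall k, is_stationary (cls k) r (M k))
  (W'_union : forall k n, (0 < n)%N -> W' k n = \bigcup_(j in cls k) W j n).

Let r_ge0 := offdiag_ge0 rate_ge0 rate_cvg.

Let cls_class k : closed_irreducible_class r (cls k).
Proof. by apply/clsP; exists k. Qed.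

Lemma cls_unique j k k' : cls k j -> cls k' j -> k = k'.
Proof. by move=> kj k'j; apply: cls_inj; exact: class_disjoint kj k'j. Qed.

(** By uniqueness the stationary state is the limit of the normalised masses, which
    is positive and inherits detailed balance. *)
Lemma M_limit k : [/\ forall j, cls k j -> 0 < M k j,
  forall i j, cls k i -> cls k j -> M k i * offdiag r i j = M k j * offdiag r j i &
  forall j, cls k j -> wm n j / (\sum_(i | i \in cls k) wm n i) @[n --> \oo] --> M k j].
Proof.
have [rho [rho0 rho_bal rho1 rho_lim]] :=
  class_limit (cls_class k) wm_gt0 rate_balance rate_cvg.
have ME j (kj : cls k j) : M k j = rho j :=
  stationary_proportional r_ge0 (cls_class k) rho0 rho_bal rho1 (M_stationary k) kj.
split=> [j kj|i j ki kj|j kj]; first by rewrite (ME j kj); exact: rho0.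
  by rewrite (ME i ki) (ME j kj); exact: rho_bal.
by rewrite (ME j kj); exact: rho_lim.
Qed.

Lemma M_sum k : \sum_(j | j \in cls k) M k j = 1.
Proof. by rewrite -fsum_fin; exact: (M_stationary k).1.2. Qed.

Definition next_weight k i := \sum_(j | j \in cls k) M k j * wt j i.

(** The mixture with weights [a] of the stationary states of the classes. *)
Definition spread (a : 'I_m' -> R) j := \sum_(k | j \in cls k) a k * M k j.

Lemma spreadE a j k : cls k j -> spread a j = a k * M k j.
Proof.
move=> kj; rewrite /spread (bigD1 k) /=; last exact: mem_set.
rewrite big1 ?addr0 // => k' /andP[/set_mem k'j].
by rewrite (cls_unique k'j kj) eqxx.
Qed.

Lemma spread0 a j : (forall k, ~ cls k j) -> spread a j = 0.
Proof. by move=> nj; rewrite /spread big1 // => k /set_mem /nj. Qed.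

Lemma mix_next a i : \sum_k a k * next_weight k i = mix (spread a) i.
Proof.
rewrite /mix /spread /next_weight.
under eq_bigr do rewrite big_mkcond mulr_sumr.
rewrite exchange_big /=; apply: eq_bigr => j _.
rewrite [in RHS]big_mkcond mulr_suml; apply: eq_bigr => k _.
by case: ifP => _; rewrite ?mulrA // mulr0 mul0r.
Qed.

Lemma spread_ge0 a : (forall k, 0 <= a k) -> forall j, 0 <= spread a j.
Proof.
move=> a0 j; rewrite sumr_ge0 // => k /set_mem kj; rewrite mulr_ge0 //.
by have [M0 _ _] := M_limit k; rewrite ltW ?M0.
Qed.

Lemma spread_sum a : \sum_j spread a j = \sum_k a k.
Proof.
rewrite /spread; under eq_bigr do rewrite big_mkcond.
rewrite exchange_big /=; apply: eq_bigr => k _.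
by rewrite -big_mkcond -mulr_sumr M_sum mulr1.
Qed.

Lemma spread_rate0 a : (forall k, 0 <= a k) -> reduced_rate r (spread a) = 0%E.
Proof.
move=> a0; apply: (reduced_rate_balance0 rate_ge0 rate_cvg (spread_ge0 a0)).
have half i j k : cls k i -> spread a i * offdiag r i j = spread a j * offdiag r j i.
  move=> ki; rewrite (spreadE _ ki); have [kj|nkj] := pselect (cls k j).
    rewrite (spreadE _ kj) -!mulrA; congr (_ * _).
    by have [_ bal _] := M_limit k; exact: bal.
  have [_ out _] := cls_class k.
  have ij : i != j by apply/eqP => ij; apply: nkj; rewrite -ij.
  rewrite offdiagE // out // mulr0.
  have [[k' k'j]|nj] := pselect (exists k', cls k' j).
    have [_ out' _] := cls_class k'; rewrite offdiagE 1?eq_sym // out' ?mulr0 //.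
    by move=> k'i; apply: nkj; rewrite (cls_unique ki k'i).
  by rewrite spread0 ?mul0r // => k' k'j; apply: nj; exists k'.
move=> i j; have [[k ki]|ni] := pselect (exists k, cls k i); first exact: half ki.
have [[k kj]|nj] := pselect (exists k, cls k j); first by apply/esym; exact: half kj.
rewrite !spread0 ?mul0r // => k h; [by apply: nj; exists k|by apply: ni; exists k].
Qed.

(** A state charged by [v] lies in a closed class, and there [v] is proportional to the
    stationary state. *)
Lemma rate0_spread v : (forall j, 0 <= v j) -> reduced_rate r v = 0%E ->
  forall j, v j = spread (fun k => \sum_(i | i \in cls k) v i) j.
Proof.
move=> v0 rv0 j.
have bal := reduced_rate0_balance wm_gt0 rate_ge0 rate_balance rate_cvg v0 rv0.
have [[k kj]|nj] := pselect (exists k, cls k j).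
  have [M0 Mbal _] := M_limit k; rewrite (spreadE _ kj).
  apply: (balance_proportional r_ge0 (cls_class k) M0 Mbal (M_sum k) _ kj) => i ki.
  by rewrite mulr_sumr; apply: eq_bigr => l _; rewrite bal.
rewrite spread0 => [|k kj]; last by apply: nj; exists k.
apply/eqP; rewrite eq_le v0 andbT leNgt; apply/negP => vj.
have [C Ccls Cj] := class_of_support r_ge0 v0 bal vj.
by apply: nj; have [k Ck] := (clsP C).1 Ccls; exists k; rewrite -Ck.
Qed.

Lemma next_weight_gt0 k i : 0 < next_weight k i -> exists2 j, cls k j & 0 < wt j i.
Proof.
move=> h; apply: contrapT => nh; move: h; rewrite /next_weight big1 ?ltxx // => j /set_mem kj.
suff -> : wt j i = 0 by rewrite mulr0.
by apply/eqP; rewrite eq_le wt_ge0 andbT leNgt; apply/negP => wi; apply: nh; exists j.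
Qed.

Lemma next_weightE k j i : cls k j -> 0 < wt j i -> next_weight k i = M k j * wt j i.
Proof.
move=> kj wi; rewrite /next_weight (bigD1 j) /=; last exact: mem_set.
rewrite big1 ?addr0 // => j' /andP[_ jj'].
suff -> : wt j' i = 0 by rewrite mulr0.
apply/eqP; rewrite eq_le wt_ge0 andbT leNgt; apply/negP => wi'.
by move: jj'; rewrite (wt_disj wi' wi) eqxx.
Qed.

Lemma next_weight_ge0 k i : 0 <= next_weight k i.
Proof.
rewrite sumr_ge0 // => j /set_mem kj; rewrite mulr_ge0 //.
by have [M0 _ _] := M_limit k; rewrite ltW ?M0.
Qed.

Lemma next_weight_sum k : \sum_i next_weight k i = 1.
Proof.
rewrite /next_weight exchange_big /= -[RHS](M_sum k); apply: eq_bigr => j _.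
by rewrite -mulr_sumr wt_sum mulr1.
Qed.

Lemma next_weight_disj k k' i : 0 < next_weight k i -> 0 < next_weight k' i -> k = k'.
Proof.
move=> /next_weight_gt0[j kj wj] /next_weight_gt0[j' k'j' wj'].
by apply: cls_unique kj _; rewrite (wt_disj wj wj').
Qed.

Lemma next_union n k : (0 < n)%N ->
  W' k n = \bigcup_(i in [set i | 0 < next_weight k i]) W1 i n.
Proof.
move=> n0; rewrite W'_union //; have [M0 _ _] := M_limit k.
apply/seteqP; split=> y.
  move=> [j kj]; rewrite W_union // => -[i /= wi Wi]; exists i => //=.
  by rewrite (next_weightE kj wi) mulr_gt0 ?M0.
move=> [i /= /next_weight_gt0[j kj wi] Wi]; exists j => //.
by rewrite W_union //; exists i.
Qed.

Lemma next_limit k i : 0 < next_weight k i ->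
  a1 n i / well_mass W' n k @[n --> \oo] --> next_weight k i.
Proof.
move=> /next_weight_gt0[j kj wi]; rewrite (next_weightE kj wi).
have [_ _ /(_ j kj) Mlim] := M_limit k.
apply: (cvg_near_eq _ (cvgM Mlim (wt_lim wi))); near=> n.
have n0 : (0 < n)%N by near: n; exists 1%N.
have m0 : forall j, 0 < wm n j by near: n; exact: wm_gt0.
have fG := grid_finite Xi_ok n0.
have -> : well_mass W' n k = \sum_(i | i \in cls k) wm n i.
  have sub : W' k n `<=` grid Xi n.
    by rewrite W'_union // => y [l _ Wl]; exact: (W_grid W_partition n0 Wl).
  rewrite /well_mass (massE _ fG sub) W'_union //.
  rewrite (eq_bigr _ (fun l _ => massE (pi n) fG (W_grid W_partition (j := l) n0))).
  rewrite big_mkcond /=; under [RHS]eq_bigr do rewrite big_mkcond /=.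
  rewrite exchange_big /=; apply: eq_bigr => y _.
  case: ifPn => [/set_mem[l kl Wl]|/negP nW].
    rewrite (bigD1 l) /=; last exact: mem_set.
    rewrite [X in X + _]ifT ?(mem_set Wl) // big1 ?addr0 // => l' /andP[_ ll'].
    by rewrite memNset // => Wl'; move: ll'; rewrite (W_disjoint W_partition n0 Wl' Wl) eqxx.
  rewrite big1 // => l /set_mem kl; rewrite memNset // => Wl; apply: nW.
  by apply: mem_set; exists l.
set S := \sum_(_ | _) _.
have S0 : S != 0.
  rewrite gt_eqF // /S (bigD1 j) /=; last exact: mem_set.
  by rewrite ltr_pwDl ?m0 // sumr_ge0 // => l _; rewrite ltW ?m0.
by rewrite /=; field; rewrite S0 gt_eqF // m0.
Unshelve. all: by end_near. Qed.

End NextLevel.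

End WeightedLevel.
End BaseWells.
End Expansion.

(** * Atomic measures and mixtures *)

Section Atoms.
Context {R : realType} {d : nat} {Xi : space R d} {N1 : nat} {x : 'I_N1 -> 'rV[R]_d}.
Hypotheses (Xi_ok : is_state_space Xi) (x_Xi : forall j, carrier Xi (x j)) (x_inj : injective x).

(** The measure of [atomic] as a set function. *)
Definition atom_law (b : 'I_N1 -> R) : set (borelV R d) -> \bar R :=
  fun A => (\sum_i b i * (x i \in A)%:R)%:E.

Lemma atom_law_point b i : atom_law b [set x i] = (b i)%:E.
Proof.
congr EFin; rewrite (bigD1 i) //= mem_set // mulr1 big1 ?addr0 // => j ji.
by rewrite memNset ?mulr0 //= => /x_inj ij; rewrite ij eqxx in ji.
Qed.

Let fin_x : finite_set (range x).
Proof. exact/finite_image/finite_finset. Qed.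

Let sub_x : range x `<=` carrier Xi.
Proof. by move=> _ [i _ <-]. Qed.

Lemma sum_atoms (F : 'rV[R]_d -> R) :
  \sum_(y <- finmap.enum_fset (fset_set (range x))) F y = \sum_i F (x i).
Proof.
rewrite -(big_map x predT F); apply: perm_big; apply: uniq_perm.
- exact: finmap.fset_uniq.
- by rewrite map_inj_uniq // index_enum_uniq.
move=> y; rewrite in_enum //; apply/idP/mapP => [/set_mem[i _ <-]|[i _ ->]].
  by exists i; rewrite ?mem_index_enum.
by apply: mem_set; exists i.
Qed.

Lemma atom_law_test (mu : prob Xi) b : meas_eq (prob_measure mu) (atom_law b) ->
  \sum_i b i = 1 -> atomic x mu b.
Proof.
move=> mub b1 f; rewrite (test_integrals_enum Xi_ok f fin_x sub_x); last first.
  rewrite mub; last exact: finite_borel.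
  rewrite /atom_law; congr EFin; rewrite -[RHS]b1; apply: eq_bigr => i _.
  have xi : range x (x i) by exists i.
  by rewrite (mem_set xi) mulr1.
rewrite sum_atoms; apply: eq_bigr => i _.
by rewrite mub ?atom_law_point 1?mulrC //; exact: set1_borel.
Qed.

Lemma atom_law_exists b : (forall i, 0 <= b i) -> \sum_i b i = 1 ->
  exists mu : prob Xi, meas_eq (prob_measure mu) (atom_law b).
Proof.
move=> b0 b1; pose v y := \sum_i b i * (x i == y)%:R.
have vx i : v (x i) = b i.
  rewrite /v (bigD1 i) //= eqxx mulr1 big1 ?addr0 // => j ji.
  by rewrite (inj_eq x_inj) (negbTE ji) mulr0.
have [| |mu [mu1 muv]] := finite_prob (w := v) Xi_ok fin_x sub_x.
- by move=> _ [i _ <-]; rewrite vx.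
- by rewrite sum_atoms -b1; apply: eq_bigr => i _.
exists mu => A mA.
have E := mass_enum fin_x mu1 mA.
rewrite -[LHS]fineK; last exact: fin_num_measure.
rewrite /prob_measure E big_mkcond sum_atoms; congr EFin; apply: eq_bigr => i _.
have -> : sval mu [set x i] = (b i)%:E by rewrite -vx; apply: muv; exists i => //.
by case: ifP; rewrite ?mulr1 ?mulr0.
Qed.

End Atoms.

Section Weights.
Context {R : realType} {d : nat}.
Variables (N : nat -> nat) (x : 'I_(N 1%N) -> 'rV[R]_d)
  (cls : forall p, 'I_(N p.+1) -> set 'I_(N p)) (M : forall p, 'I_(N p.+1) -> 'I_(N p) -> R).

(** The weight of the base point [x i] in the [j]-th metastable measure. *)
Fixpoint well_weight p : 'I_(N p.+1) -> 'I_(N 1%N) -> R :=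
  match p with
  | 0%N => fun j i => (i == j)%:R
  | p'.+1 => next_weight (well_weight (p := p')) (@cls p'.+1) (@M p'.+1)
  end.

Lemma mixture_atoms m (wt : 'I_m -> 'I_(N 1%N) -> R) (w : 'I_m -> R) A :
  mixture w (fun j => atom_law (x := x) (wt j)) A = atom_law (x := x) (mix wt w) A.
Proof.
rewrite /mixture /atom_law; under eq_bigr do rewrite -EFinM.
rewrite sumEFin; congr EFin; rewrite /mix.
under eq_bigr do rewrite mulr_sumr.
rewrite exchange_big /=; apply: eq_bigr => i _; rewrite mulr_suml.
by apply: eq_bigr => j _; rewrite mulrA.
Qed.

Lemma metastable_statesE p (j : 'I_(N p.+1)) A :
  metastable_states x cls M j A = atom_law (x := x) (well_weight j) A.
Proof.
elim: p j => [|p IH] j /=.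
  rewrite /atom_law (bigD1 j) //= eqxx mul1r big1 ?addr0 ?diracE // => i ij.
  by rewrite (negbTE ij) mul0r.
rewrite fsum_fin; under eq_bigr do rewrite IH -EFinM.
rewrite sumEFin; congr EFin; rewrite /next_weight.
under eq_bigr do rewrite mulr_sumr.
rewrite exchange_big /=; apply: eq_bigr => i _; rewrite mulr_suml.
by apply: eq_bigr => k _; rewrite mulrA.
Qed.

Lemma mixtureE p (w : 'I_(N p.+1) -> R) A :
  mixture w (@metastable_states R d N x cls M p) A =
  atom_law (x := x) (mix (@well_weight p) w) A.
Proof.
by rewrite -mixture_atoms; apply: eq_bigr => j _; rewrite metastable_statesE.
Qed.

End Weights.

(** * The full expansion *)

Section ExpansionHierarchy.
Variables (R : realType) (d : nat) (Xi : space R d)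
    (rate : nat -> 'rV[R]_d -> 'rV[R]_d -> R) (pi : nat -> 'rV[R]_d -> R)
    (disp : measure_display) (Omega : nat -> measurableType disp)
    (X : forall n, R -> Omega n -> 'rV[R]_d)
    (P : forall n, 'rV[R]_d -> probability (Omega n) R)
    (N : nat -> nat) (I0 : prob Xi -> \bar R) (x : 'I_(N 1%N) -> 'rV[R]_d)
    (q : nat) (theta : nat -> nat -> R)
    (W : forall p, 'I_(N p) -> nat -> set 'rV[R]_d)
    (Delta : nat -> nat -> set 'rV[R]_d)
    (r : forall p, 'I_(N p) -> 'I_(N p) -> R)
    (cls : forall p, 'I_(N p.+1) -> set 'I_(N p))
    (M : forall p, 'I_(N p.+1) -> 'I_(N p) -> R) (beta : nat -> R).
Hypotheses (Xi_ok : is_state_space Xi)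
    (rate_ok : forall n, (0 < n)%N -> is_jump_rate (grid Xi n) (rate n))
    (chain_irr : forall n, (0 < n)%N -> irreducible (grid Xi n) (rate n))
    (chain_X : forall n, (0 < n)%N ->
      is_markov_chain (grid Xi n) (rate n) (@X n) (@P n))
    (pi_stationary : forall n, (0 < n)%N ->
      is_stationary (grid Xi n) (rate n) (pi n))
    (pi_reversible : forall n, (0 < n)%N ->
      detailed_balance (grid Xi n) (rate n) (pi n))
    (I0_ge0 : forall mu, (0 <= I0 mu)%E)
    (A0_gamma : gamma_cvg (fun n => @level2_functional R d Xi n (rate n)) I0)
    (x_Xi : forall j, carrier Xi (x j)) (x_inj : injective x)
    (A0_zero : forall mu : prob Xi,
      I0 mu = 0%E <->
      exists w, is_mixture (fun j A => \d_(x j : borelV R d) A) mu w)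
    (q_gt0 : (0 < q)%N)
    (theta_gt0 : forall p n, (0 < p <= q)%N -> (0 < n)%N -> 0 < theta p n)
    (theta1 : prec (fun=> 1) (theta 1%N))
    (theta_prec : forall p, (0 < p < q)%N -> prec (theta p) (theta p.+1))
    (W_partition : forall p n, (0 < p <= q)%N -> (0 < n)%N ->
      is_partition (grid Xi n) (fun j => @W p j n) (Delta p n))
    (A1_lim : forall p (i j : 'I_(N p)), (0 < p <= q)%N -> i != j ->
      theta p n *
        mean_jump_rate (grid Xi n) (rate n) (@X n) (@P n) (pi n)
          (fun k => @W p k n) i j @[n --> \oo] --> @r p i j)
    (A1_pos : forall p, (0 < p <= q)%N ->
      exists i j : 'I_(N p), j != i /\ 0 < @r p i j)
    (A2_inj : forall p, (0 < p < q)%N -> injective (@cls p))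
    (A2_cls : forall p (C : set 'I_(N p)), (0 < p < q)%N ->
      closed_irreducible_class (@r p) C <-> exists m, C = @cls p m)
    (A2_union : forall p (m : 'I_(N p.+1)) n, (0 < p < q)%N -> (0 < n)%N ->
      @W p.+1 m n = \bigcup_(j in @cls p m) @W p j n)
    (M_stationary : forall p m, (0 < p < q)%N ->
      is_stationary (@cls p m) (@r p) (@M p m))
    (A3 : exists! C : set 'I_(N q), closed_irreducible_class (@r q) C)
    (A4a_weak : forall j : 'I_(N 1%N),
      weak_cvg Xi (fun n => cond_measure (pi n) (@W 1%N j n))
        (fun A => \d_(x j : borelV R d) A))
    (A4b : exists2 eps : R, 0 < eps &
      forall j n, (0 < n)%N -> sball Xi (x j) eps `&` grid Xi n `<=` @W 1%N j n)
    (beta_gt0 : forall n, (0 < n)%N -> 0 < beta n)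
    (beta_theta : prec beta (theta 1%N))
    (A5 : forall n (j : 'I_(N 1%N)) (h : 'rV[R]_d -> R), (0 < n)%N ->
            forall z, @W 1%N j n z ->
            \sum_(y \in @W 1%N j n)
              pi n y / mass (pi n) (@W 1%N j n) * (h y - h z) ^+ 2
            <= beta n * dirichlet (rate n) (pi n) (@W 1%N j n) h).

Local Notation wt p := (@well_weight R N cls M p).
Local Notation states p := (@metastable_states R d N x cls M p).
Local Notation I := (@limit_functionals R d Xi N x cls M r I0).

Let W1_sub j n : (0 < n)%N -> @W 1%N j n `<=` grid Xi n.
Proof. by move=> n0 y Wy; have [_ _ <-] := @W_partition 1%N n q_gt0 n0; left; exists j. Qed.

Let W1_disj i j n y : (0 < n)%N -> @W 1%N i n y -> @W 1%N j n y -> i = j.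
Proof. by move=> n0 Wi Wj; have [tW _ _] := @W_partition 1%N n q_gt0 n0; apply: tW => //; exists y. Qed.

Definition weights_ok p := [/\ forall j i, 0 <= wt p j i,
  forall j, \sum_i wt p j i = 1,
  forall j j' i, 0 < wt p j i -> 0 < wt p j' i -> j = j',
  forall n j, (0 < n)%N -> @W p.+1 j n = \bigcup_(i in [set i | 0 < wt p j i]) @W 1%N i n &
  forall j i, 0 < wt p j i ->
    mass (pi n) (@W 1%N i n) / well_mass pi (@W p.+1) n j @[n --> \oo] --> wt p j i].

Section AtLevel.
Variables (p : nat) (hp : (p < q)%N).

Let Wp n (n0 : (0 < n)%N) := @W_partition p.+1 n hp n0.
Let thp n (n0 : (0 < n)%N) := @theta_gt0 p.+1 n hp n0.
Let rp i j (ij : i != j) := @A1_lim p.+1 i j hp ij.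
Let m_gt1 : exists i j : 'I_(N p.+1), i != j.
Proof. by have [i [j [ij _]]] := @A1_pos p.+1 hp; exists j, i. Qed.

Hypothesis ok : weights_ok p.
Let ge0 : forall j i, 0 <= wt p j i. Proof. by case: ok. Qed.
Let sum1 : forall j, \sum_i wt p j i = 1. Proof. by case: ok. Qed.
Let disj : forall j j' i, 0 < wt p j i -> 0 < wt p j' i -> j = j'. Proof. by case: ok. Qed.
Let union : forall n j, (0 < n)%N ->
  @W p.+1 j n = \bigcup_(i in [set i | 0 < wt p j i]) @W 1%N i n.
Proof. by case: ok. Qed.
Let lim : forall j i, 0 < wt p j i ->
    mass (pi n) (@W 1%N i n) / well_mass pi (@W p.+1) n j @[n --> \oo] --> wt p j i.
Proof. by case: ok. Qed.

Lemma weights_ok_next (hp1 : (p.+1 < q)%N) : weights_ok p.+1.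
Proof.
have clsP C := @A2_cls p.+1 C hp1.
have Mst k := @M_stationary p.+1 k hp1.
have Wu k n (n0 : (0 < n)%N) := @A2_union p.+1 k n hp1 n0.
split=> /=.
- exact: (next_weight_ge0 Xi_ok rate_ok chain_irr pi_stationary pi_reversible W1_sub A4a_weak
    chain_X Wp thp rp m_gt1 ge0 sum1 union clsP Mst).
- exact: (next_weight_sum sum1 Mst).
- exact: (next_weight_disj ge0 disj (@A2_inj p.+1 hp1) clsP).
- exact: (next_union Xi_ok rate_ok chain_irr pi_stationary pi_reversible W1_sub A4a_weak
    chain_X Wp thp rp m_gt1 ge0 sum1 disj union clsP Mst Wu).
- exact: (next_limit Xi_ok rate_ok chain_irr pi_stationary pi_reversible W1_sub A4a_weak
    chain_X Wp thp rp m_gt1 ge0 sum1 disj union lim clsP Mst Wu).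
Qed.

Lemma is_mixtureP (mu : prob Xi) w : is_mixture (states p) mu w <->
  [/\ forall j, 0 <= w j, \sum_j w j = 1 &
    meas_eq (prob_measure mu) (atom_law (x := x) (mix (wt p) w))].
Proof.
split=> [[[w0 w1] muw]|[w0 w1 muw]].
  split=> [j||A mA]; [exact: w0|by rewrite -fsumT|by rewrite muw // mixtureE].
split; first by split=> [j _|]; [exact: w0|rewrite fsumT].
by move=> A mA; rewrite muw // mixtureE.
Qed.

(** The measures of one level have disjoint supports, so a point in the support of
    the [j]-th measure shows the [j]-th weight. *)
Lemma mixture_unique (mu : prob Xi) w w' : is_mixture (states p) mu w -> is_mixture (states p) mu w' ->
  w = w'.
Proof.
move=> /is_mixtureP[_ _ muw] /is_mixtureP[_ _ muw']; apply/funext => j.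
have [i wi] := wt_supp ge0 sum1 j.
have := muw [set x i] (set1_borel _); rewrite muw'; last exact: set1_borel.
rewrite !(atom_law_point x_inj) !(mix_supp ge0 disj _ wi) => -[].
by move/(mulIf (lt0r_neq0 wi)).
Qed.

Lemma reduced_dichotomy mu :
  (exists w, is_mixture (states p) mu w /\ I p.+1 mu = reduced_rate (@r p.+1) w) \/
  (~ (exists w, is_mixture (states p) mu w)) /\ I p.+1 mu = +oo%E.
Proof.
rewrite /limit_functionals /reduced_functional; case: pselect => h; last by right.
by left; exists (sval (cid h)); split=> //; exact: svalP.
Qed.

Lemma reducedE mu w : is_mixture (states p) mu w -> I p.+1 mu = reduced_rate (@r p.+1) w.
Proof.
move=> mw; have [[w' [mw' ->]]|[nw _]] := reduced_dichotomy mu.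
  by rewrite (mixture_unique mw' mw).
by exfalso; apply: nw; exists w.
Qed.

Let rn_ge0 := rate_ge0 Xi_ok rate_ok chain_irr pi_stationary pi_reversible W1_sub A4a_weak
    Wp thp m_gt1 ge0 sum1 union.
Let rn_cvg := rate_cvg Xi_ok rate_ok chain_irr pi_stationary W1_sub A4a_weak
    chain_X Wp rp m_gt1 ge0 sum1 union.

Lemma reduced_finite mu : (I p.+1 mu < +oo)%E <-> exists w, is_mixture (states p) mu w.
Proof.
split=> [|[w mw]]; first by have [[w [mw _]] _|[_ ->]] := reduced_dichotomy mu; [exists w|rewrite ltxx].
by rewrite (reducedE mw); apply: (reduced_rate_fin rn_ge0 rn_cvg); have /is_mixtureP[] := mw.
Qed.

Lemma reduced_zero mu (hp1 : (p.+1 < q)%N) :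
  I p.+1 mu = 0%E <-> exists a, is_mixture (states p.+1) mu a.
Proof.
have clsP C := @A2_cls p.+1 C hp1.
have Mst k := @M_stationary p.+1 k hp1.
have inj := @A2_inj p.+1 hp1.
have mix_eq a : mix (wt p.+1) a = mix (wt p) (spread (@cls p.+1) (@M p.+1) a).
  by apply/funext => i; exact: mix_next.
have mixP a : is_mixture (states p.+1) mu a <-> [/\ forall j, 0 <= a j, \sum_j a j = 1 &
    meas_eq (prob_measure mu) (atom_law (x := x) (mix (wt p) (spread (@cls p.+1) (@M p.+1) a)))].
  rewrite -mix_eq; split=> [[[w0 w1] muw]|[w0 w1 muw]].
    split=> [j||A mA]; [exact: w0|by rewrite -fsumT|by rewrite muw // mixtureE].
  split; first by split=> [j _|]; [exact: w0|rewrite fsumT].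
  by move=> A mA; rewrite muw // mixtureE.
split=> [Imu|[a /mixP[a0 a1 mua]]].
  have [[w [mw Iw]]|[_ I_oo]] := reduced_dichotomy mu; last by rewrite I_oo in Imu.
  have /is_mixtureP[w0 w1 muw] := mw.
  have rw0 : reduced_rate (@r p.+1) w = 0%E by rewrite -Iw.
  have wE := rate0_spread Xi_ok rate_ok chain_irr pi_stationary pi_reversible W1_sub A4a_weak
    chain_X Wp thp rp m_gt1 ge0 sum1 union inj clsP Mst w0 rw0.
  exists (fun k => \sum_(i | i \in @cls p.+1 k) w i); apply/mixP; split.
  - by move=> k; rewrite sumr_ge0.
  - by rewrite -(spread_sum Mst) -[RHS]w1; apply: eq_bigr => j _; rewrite -wE.
  - by move=> A mA; rewrite muw //; congr (atom_law (mix _ _) _); apply/funext => j; exact: wE.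
rewrite (@reducedE _ (spread (@cls p.+1) (@M p.+1) a)).
  exact: (spread_rate0 Xi_ok rate_ok chain_irr pi_stationary pi_reversible W1_sub A4a_weak
    chain_X Wp thp rp m_gt1 ge0 sum1 union inj clsP Mst a0).
apply/is_mixtureP; split=> //; last by rewrite (spread_sum Mst).
exact: (spread_ge0 Xi_ok rate_ok chain_irr pi_stationary pi_reversible W1_sub A4a_weak
    chain_X Wp thp rp m_gt1 ge0 sum1 union clsP Mst a0).
Qed.

Lemma reduced_gamma_cvg : prec beta (theta p.+1) ->
  (forall (phi : nat -> nat) (nu_ : nat -> prob Xi) nu (c : R),
     (forall k, (phi k < phi k.+1)%N) -> nu_ (phi k) @[k --> \oo] --> nu ->
     (\forall k \near \oo, ((theta p.+1 (phi k))%:E *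
        level2_functional (phi k) (rate (phi k)) (nu_ (phi k)) <= c%:E)%E) ->
     (I p.+1 nu < +oo)%E) ->
  gamma_cvg (fun n mu => ((theta p.+1 n)%:E * level2_functional n (rate n) mu)%E) (I p.+1).
Proof.
move=> bt; apply: (level_gamma_cvg Xi_ok rate_ok chain_irr pi_stationary pi_reversible x_Xi
  W1_sub W1_disj A4a_weak A4b beta_gt0 A5 chain_X Wp thp rp m_gt1 bt ge0 sum1 disj union lim) => nu.
have [[w [/is_mixtureP[w0 w1 nuw] Iw]]|[_ I_oo]] := reduced_dichotomy nu; last by left.
right; exists w; split=> //; apply: (atom_law_test Xi_ok x_Xi x_inj nuw).
exact: (mix_sum sum1 w1).
Qed.

(** The unique closed class is treated as a one-element family of classes, the
    next level being that of the single measure [mu]. *)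
Lemma unique_class_zero : (exists! C, closed_irreducible_class (@r p.+1) C) ->
  exists mu, I p.+1 mu = 0%E /\
    forall nu, I p.+1 nu = 0%E -> meas_eq (prob_measure nu) (prob_measure mu).
Proof.
move=> [C [C_cls C_uniq]].
have a_gt0 := wm_gt0 Xi_ok chain_irr pi_stationary pi_reversible W1_sub A4a_weak Wp ge0 sum1 union.
have rn_bal := rate_balance Xi_ok rate_ok chain_irr pi_stationary pi_reversible W1_sub A4a_weak
    (theta p.+1) Wp m_gt1 ge0 sum1 union.
have [rho [rho0 bal rho1 _]] := class_limit C_cls a_gt0 rn_bal rn_cvg.
pose cls1 (_ : 'I_1) := C; pose M1 (_ : 'I_1) := rho.
have inj : injective cls1 by move=> i j _; rewrite !ord1.
have clsP D : closed_irreducible_class (@r p.+1) D <-> exists k, D = cls1 k.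
  by split=> [/C_uniq CD|[k ->//]]; exists ord0.
have Mst k : is_stationary (cls1 k) (@r p.+1) (M1 k) by exact: balance_stationary.
pose w1 := spread cls1 M1 (fun=> 1).
have w1_ge0 : forall j, 0 <= w1 j.
  exact: (spread_ge0 Xi_ok rate_ok chain_irr pi_stationary pi_reversible W1_sub A4a_weak
    chain_X Wp thp rp m_gt1 ge0 sum1 union clsP Mst (fun=> ler01)).
have w1_sum : \sum_j w1 j = 1 by rewrite (spread_sum Mst) big_ord1.
have [mu muE] := atom_law_exists Xi_ok x_Xi x_inj (mix_ge0 ge0 w1_ge0) (mix_sum sum1 w1_sum).
have mu_mix : is_mixture (states p) mu w1 by exact/is_mixtureP.
exists mu; split.
  rewrite (reducedE mu_mix).
  exact: (spread_rate0 Xi_ok rate_ok chain_irr pi_stationary pi_reversible W1_sub A4a_weak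
    chain_X Wp thp rp m_gt1 ge0 sum1 union inj clsP Mst (fun=> ler01)).
move=> nu Inu; have [[w [/is_mixtureP[w0 ws nuw] Iw]]|[_ I_oo]] := reduced_dichotomy nu; last first.
  by rewrite I_oo in Inu.
have rw0 : reduced_rate (@r p.+1) w = 0%E by rewrite -Iw.
have wE := rate0_spread Xi_ok rate_ok chain_irr pi_stationary pi_reversible W1_sub A4a_weak
    chain_X Wp thp rp m_gt1 ge0 sum1 union inj clsP Mst w0 rw0.
set a := (fun k => _) in wE.
(* the single class carries the whole mass *)
have a1 : a = fun=> 1.
  apply/funext => k; rewrite [k]ord1 -ws -(big_ord1 +%R a) -(spread_sum Mst).
  by apply: eq_bigr => j _; rewrite -wE.
move=> A mA; rewrite nuw // muE //; congr (atom_law (mix _ _) _).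
by apply/funext => j; rewrite wE a1.
Qed.

End AtLevel.

Lemma weights_okP p : (p < q)%N -> weights_ok p.
Proof.
elim: p => [_|p IH hp]; last exact: (weights_ok_next (ltnW hp) (IH (ltnW hp)) hp).
have supp (j i : 'I_(N 1%N)) : (0 < ((i == j)%:R : R)) = (i == j).
  by case: eqP => _; rewrite ?ltr01 ?ltxx.
split=> /=.
- by move=> j i; case: eqP.
- by move=> j; rewrite (bigD1 j) //= eqxx big1 ?addr0 // => i /negbTE ->.
- by move=> j j' i; rewrite !supp => /eqP <- /eqP.
- move=> n j n0; apply/seteqP; split=> [y Wy|y [i /=]]; first by exists j; rewrite //= supp.
  by rewrite supp => /eqP ->.
move=> j i; rewrite supp => /eqP ->; rewrite eqxx.
apply: (cvg_near_eq _ (cvg_cst _)); near=> n; rewrite divff // gt_eqF //.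
by near: n; exact: (a1_gt0_near Xi_ok pi_stationary W1_sub A4a_weak).
Unshelve. all: by end_near. Qed.

Lemma prec_trans (a b c : nat -> R) : (forall n, (0 < n)%N -> 0 < b n) ->
  prec a b -> prec b c -> prec a c.
Proof.
move=> b0 ab bc; have h : a n / b n * (b n / c n) @[n --> \oo] --> (0 * 0 : R) by exact: cvgM.
rewrite mul0r in h; apply: (cvg_near_eq _ h); near=> n.
have n0 : (0 < n)%N by near: n; exists 1%N.
by rewrite mulrA divfK // gt_eqF // b0.
Unshelve. all: by end_near. Qed.

Lemma beta_prec p : (p < q)%N -> prec beta (theta p.+1).
Proof.
elim: p => // p IH hp; apply: prec_trans (IH (ltnW hp)) (@theta_prec p.+1 hp) => n.
by apply: theta_gt0; exact: ltnW hp.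
Qed.

Lemma I_ge0 p mu : (0 <= I p mu)%E.
Proof.
case: p => [|p] //; have [[w [_ ->]]|[_ ->]] := reduced_dichotomy p mu; last exact: leey.
exact: reduced_rate_ge0.
Qed.

Lemma finite_iff_zero p mu : (p < q)%N -> (I p.+1 mu < +oo)%E <-> I p mu = 0%E.
Proof.
move=> hp; apply: iff_trans (reduced_finite hp (weights_okP hp) mu) _.
case: p hp => [|p] hp; first by apply: iff_sym; exact: A0_zero.
by apply: iff_sym; exact: (reduced_zero (ltnW hp) (weights_okP (ltnW hp))).
Qed.

(** The 0-th scale is 1, so that the hypothesis on [I_n] itself starts the induction. *)
Definition speed p n : R := if p is 0%N then 1 else theta p n.

Lemma speed_ge0 p n : (p <= q)%N -> (0 < n)%N -> 0 <= speed p n.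
Proof. by case: p => [|p] hp n0; [exact: ler01|exact/ltW/theta_gt0]. Qed.

(** A bound for [theta p.+1 n * I_n] makes [speed p n * I_n] tend to 0, so the limit point
    is a zero of the functional of level [p], where the next functional is finite. *)
Lemma speed_gamma_cvg p : (p <= q)%N ->
  gamma_cvg (fun n mu => ((speed p n)%:E * level2_functional n (rate n) mu)%E) (I p).
Proof.
elim: p => [_|p IH hp].
  suff -> : (fun n mu => ((speed 0 n)%:E * level2_functional n (rate n) mu)%E) =
    (fun n => @level2_functional R d Xi n (rate n)) by [].
  by apply/funext => n; apply/funext => mu; rewrite mul1e.
apply: (reduced_gamma_cvg hp (weights_okP hp) (beta_prec hp)) => phi nu_ nu c phi_incr nu_cvg nu_c.
apply/(finite_iff_zero nu hp); apply/eqP; rewrite eq_le I_ge0 andbT.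
apply/lee_addgt0Pr => e e0; rewrite add0e.
apply: (subseq_liminf (IH (ltnW hp)).1 phi_incr nu_cvg (c := e)).
have sp : speed p n / theta p.+1 n * (c + 1) @[n --> \oo] --> (0 * (c + 1) : R).
  apply: cvgM (cvg_cst _); case: p hp {IH nu_c} => [|p] hp; [exact: theta1|exact: (@theta_prec p.+1 hp)].
rewrite mul0r in sp.
have sp_e := subseq_oo phi_incr (cvgr_le _ sp _ e0).
near=> k.
have k0 : (0 < phi k)%N.
  by apply: leq_trans (subseq_ge phi_incr k); near: k; exists 1%N.
have h : ((theta p.+1 (phi k))%:E * level2_functional (phi k) (rate (phi k)) (nu_ (phi k)) <= c%:E)%E.
  by near: k.
have he : speed p (phi k) / theta p.+1 (phi k) * (c + 1) <= e by near: k; exact: sp_e.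
have th0 : 0 < theta p.+1 (phi k) by exact: theta_gt0.
have s0 : 0 <= speed p (phi k) by exact: speed_ge0 (ltnW hp) k0.
apply: (@le_trans _ _ (speed p (phi k) / theta p.+1 (phi k) * (c + 1))%:E); last by rewrite lee_fin.
have -> : (speed p (phi k))%:E = ((speed p (phi k) / theta p.+1 (phi k))%:E * (theta p.+1 (phi k))%:E)%E.
  by rewrite -EFinM divfK // gt_eqF.
rewrite [leRHS]EFinM -muleA lee_wpmul2l ?lee_fin ?divr_ge0 ?(ltW th0) //.
by apply: le_trans h _; rewrite lee_fin lerDl.
Unshelve. all: by end_near. Qed.

Lemma hierarchy_expansion :
  full_gamma_expansion (fun n => @level2_functional R d Xi n (rate n)) q theta I.
Proof.
split.
- by move=> p mu _; exact: I_ge0.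
- split=> //; have th0 : \forall n \near \oo, 0 < theta 1%N n.
    by near=> n; apply: theta_gt0 => //; near: n; exists 1%N.
  apply/(gtr0_cvgV0 th0); apply: (cvg_near_eq _ theta1).
  by apply: nearW => n; rewrite div1r.
- split=> // -[//|p] /= hp; exact: (speed_gamma_cvg hp).
- by move=> p mu hp; exact: finite_iff_zero.
have last_level q' (h : (q' < q)%N) := unique_class_zero h (weights_okP h).
by case: (q) q_gt0 last_level A3 => // q' _ last_level; exact: last_level.
Unshelve. all: by end_near. Qed.

End ExpansionHierarchy.

Theorem theorem2p7 (R : realType) (d : nat)
    (Xi : space R d) (Xi_ok : is_state_space Xi)
    (rate : nat -> 'rV[R]_d -> 'rV[R]_d -> R)
    (pi : nat -> 'rV[R]_d -> R)
    (disp : measure_display) (Omega : nat -> measurableType disp)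
    (X : forall n, R -> Omega n -> 'rV[R]_d)
    (P : forall n, 'rV[R]_d -> probability (Omega n) R)
    (rate_ok : forall n, (0 < n)%N -> is_jump_rate (grid Xi n) (rate n))
    (chain_irr : forall n, (0 < n)%N -> irreducible (grid Xi n) (rate n))
    (chain_X : forall n, (0 < n)%N ->
      is_markov_chain (grid Xi n) (rate n) (X n) (P n))
    (pi_stationary : forall n, (0 < n)%N ->
      is_stationary (grid Xi n) (rate n) (pi n))
    (pi_reversible : forall n, (0 < n)%N ->
      detailed_balance (grid Xi n) (rate n) (pi n))
    (N : nat -> nat)
    (I0 : prob Xi -> \bar R) (I0_ge0 : forall mu, (0 <= I0 mu)%E)
    (A0_gamma : gamma_cvg (fun n => @level2_functional R d Xi n (rate n)) I0)
    (x : 'I_(N 1%N) -> 'rV[R]_d)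
    (x_Xi : forall j, carrier Xi (x j)) (x_inj : injective x)
    (A0_zero : forall mu : prob Xi,
      I0 mu = 0%E <->
      exists w, is_mixture (fun j A => \d_(x j : borelV R d) A) mu w)
    (q : nat) (q_gt0 : (0 < q)%N)
    (theta : nat -> nat -> R)
    (theta_gt0 : forall p n, (0 < p <= q)%N -> (0 < n)%N -> 0 < theta p n)
    (theta1 : prec (fun=> 1) (theta 1%N))
    (theta_prec : forall p, (0 < p < q)%N -> prec (theta p) (theta p.+1))
    (W : forall p, 'I_(N p) -> nat -> set 'rV[R]_d)
    (Delta : nat -> nat -> set 'rV[R]_d)
    (W_partition : forall p n, (0 < p <= q)%N -> (0 < n)%N ->
      is_partition (grid Xi n) (fun j => W p j n) (Delta p n))
    (r : forall p, 'I_(N p) -> 'I_(N p) -> R)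
    (A1_lim : forall p (i j : 'I_(N p)), (0 < p <= q)%N -> i != j ->
      theta p n *
        mean_jump_rate (grid Xi n) (rate n) (X n) (P n) (pi n)
          (fun k => W p k n) i j @[n --> \oo] --> r p i j)
    (A1_pos : forall p, (0 < p <= q)%N ->
      exists i j : 'I_(N p), j != i /\ 0 < r p i j)
    (cls : forall p, 'I_(N p.+1) -> set 'I_(N p))
    (A2_inj : forall p, (0 < p < q)%N -> injective (cls p))
    (A2_cls : forall p (C : set 'I_(N p)), (0 < p < q)%N ->
      closed_irreducible_class (r p) C <-> exists m, C = cls p m)
    (A2_union : forall p (m : 'I_(N p.+1)) n, (0 < p < q)%N -> (0 < n)%N ->
      W p.+1 m n = \bigcup_(j in cls p m) W p j n)
    (M : forall p, 'I_(N p.+1) -> 'I_(N p) -> R)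
    (M_stationary : forall p m, (0 < p < q)%N ->
      is_stationary (cls p m) (r p) (M p m))
    (A3 : exists! C : set 'I_(N q), closed_irreducible_class (r q) C)
    (A4a_mass : mass (pi n) (\bigcup_j W 1%N j n) @[n --> \oo] --> (1 : R))
    (A4a_weak : forall j : 'I_(N 1%N),
      weak_cvg Xi (fun n => cond_measure (pi n) (W 1%N j n))
        (fun A => \d_(x j : borelV R d) A))
    (A4b : exists2 eps : R, 0 < eps &
      trivIset [set: 'I_(N 1%N)] (fun j => sball Xi (x j) eps) /\
      forall j n, (0 < n)%N -> sball Xi (x j) eps `&` grid Xi n `<=` W 1%N j n)
    (A5 : exists beta : nat -> R,
      [/\ (forall n, (0 < n)%N -> 0 < beta n),
          prec beta (theta 1%N)
        & forall n (j : 'I_(N 1%N)) (h : 'rV[R]_d -> R), (0 < n)%N ->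
            forall z, W 1%N j n z ->
            \sum_(y \in W 1%N j n)
              pi n y / mass (pi n) (W 1%N j n) * (h y - h z) ^+ 2
            <= beta n * dirichlet (rate n) (pi n) (W 1%N j n) h]) :
  full_gamma_expansion (fun n => @level2_functional R d Xi n (rate n)) q theta
    (limit_functionals x cls M r I0).

Proof.
have [beta [beta_gt0 beta_theta gap]] := A5.
have [eps eps0 [_ balls]] := A4b.
have balls1 : exists2 eps : R, 0 < eps & forall j n, (0 < n)%N ->
    sball Xi (x j) eps `&` grid Xi n `<=` W 1%N j n by exists eps.
exact: (hierarchy_expansion Xi_ok rate_ok chain_irr chain_X pi_stationary pi_reversible
  I0_ge0 A0_gamma x_Xi x_inj A0_zero q_gt0 theta_gt0 theta1 theta_prec W_partition
  A1_lim A1_pos A2_inj A2_cls A2_union M_stationary A3 A4a_weak balls1 beta_gt0 beta_theta gap).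
Qed.
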